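(* Suppose $1<p\le q<\infty$ and let $b$ be a normal form parameter. For $n=1,2,\dots$ let $$b_n=2^{-n}\sum_{k=1}^{n2^n}\chi_{(0,b^{-1}(k2^{-n}))}.$$ The following are equivalent for $H_b:L^p\to L^q$: (i) $H_b$ is compact; (ii) $H_b$ is a norm limit of finite-rank operators; (iii) $H_{b_n}\to H_b$ in operator norm (as bounded operators from $L^p$ to $L^q$); (iv) $\lim_{x\to\infty}b(x)^{1/p'}x^{1/q}=0$ and $\lim_{x\to0+}b(x)^{1/p'}x^{1/q}=0$.
   Context: $L^+$ is the set of Lebesgue measurable functions $(0,\infty)\to[0,\infty]$, and $L^p$, $\|\cdot\|_p$ are the usual (complex) Lebesgue space and norm for Lebesgue measure on $(0,\infty)$; $p'$ denotes the conjugate exponent, $\frac1p+\frac1{p'}=1$. A normal form parameter is a non-increasing function $b:(0,\infty)\to[0,\infty]$; its generalized inverse is $b^{-1}(t)=\sup\{x>0:t<b(x)\}$ for $t>0$, with $\sup\emptyset=0$. Put $H_bf(x)=\int_0^{b(x)}f(t)\,dt$ for $f\in L^+$. When this positive operator is bounded from the non-negative functions in $L^p$ to $L^q$, it is extended linearly to a bounded operator $H_b:L^p\to L^q$. Each of (i), (ii), (iii) is understood to include that $H_b$ is a bounded operator $L^p\to L^q$ (and in (iii), that the $H_{b_n}$ are bounded for all sufficiently large $n$); finite-rank operators are bounded operators $L^p\to L^q$ with finite-dimensional range. $\chi_E$ is the characteristic function of $E$. *)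

(* Defs.v *)
From HB Require Import structures.
From mathcomp Require Import all_boot all_order all_algebra.
From mathcomp Require Import all_classical all_reals all_analysis.
From mathcomp Require Import measurable_realfun complex.

Set Implicit Arguments.
Unset Strict Implicit.
Unset Printing Implicit Defensive.

Import Order.TTheory GRing.Theory Num.Theory ComplexField.
Import numFieldNormedType.Exports.

Local Open Scope classical_set_scope.
Local Open Scope ring_scope.

Section ComplexLebesgueSpace.
Context (d : measure_display) (T : measurableType d) (R : realType).
Variables (mu : {measure set T -> \bar R}) (p : R).

(* R[i]^o is R[i] seen as a module over itself, so that T -> R[i]^o is a complex
   vector space. *)
Definition measurable_cfun (f : T -> R[i]^o) : Prop :=
  measurable_fun [set: T] (fun x => complex.Re (f x)) /\
  measurable_fun [set: T] (fun x => complex.Im (f x)).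

Definition cLnorm (f : T -> R[i]^o) : \bar R :=
  Lnorm mu p%:E (fun x => (Normc.normc (f x))%:E).

Definition cLfun : {pred (T -> R[i]^o)} :=
  mem [set f : T -> R[i]^o | measurable_cfun f /\ (cLnorm f < +oo)%E].

Record cLfunType (p1 : 1 <= p) :=
  CLfun { cLfun_val :> T -> R[i]^o ; cLfun_valP : cLfun_val \in cLfun }.

End ComplexLebesgueSpace.

Section cLfun_theory.
Context (d : measure_display) (T : measurableType d) (R : realType).
Variables (mu : {measure set T -> \bar R}) (p : R) (p1 : 1 <= p).
Implicit Types f g : T -> R[i]^o.

Lemma measurable_normc f : measurable_cfun f ->
  measurable_fun [set: T] (fun x => Normc.normc (f x)).
Proof.
move=> [mRe mIm].
have -> : (fun x => Normc.normc (f x)) = Num.sqrt \o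
    (fun x => complex.Re (f x) ^+ 2 + complex.Im (f x) ^+ 2).
  by apply/funext => x /=; case: (f x).
apply: measurableT_comp.
  exact: (continuous_measurable_fun (@sqrt_continuous R)).
by apply: measurable_funD; exact: measurable_funX.
Qed.

Lemma measurable_cfunD f g : measurable_cfun f -> measurable_cfun g ->
  measurable_cfun (f + g).
Proof.
move=> [mfR mfI] [mgR mgI]; split.
  apply: eq_measurable_fun (measurable_funD mfR mgR) => x _ /=.
  by rewrite /= fctE; case: (f x) => a b; case: (g x).
apply: eq_measurable_fun (measurable_funD mfI mgI) => x _ /=.
by rewrite /= fctE; case: (f x) => a b; case: (g x).
Qed.

Lemma measurable_cfunZ (a : R[i]) f : measurable_cfun f ->
  measurable_cfun (a *: f).
Proof.
case: a => a b [mR mI]; split.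
  have m1 := measurable_funM (@measurable_cst _ _ T _ setT a) mR.
  have m2 := measurable_funM (@measurable_cst _ _ T _ setT b) mI.
  apply: eq_measurable_fun (measurable_funB m1 m2) => x _ /=.
  by rewrite fctE; case: (f x).
have m1 := measurable_funM (@measurable_cst _ _ T _ setT a) mI.
have m2 := measurable_funM (@measurable_cst _ _ T _ setT b) mR.
apply: eq_measurable_fun (measurable_funD m1 m2) => x _ /=.
by rewrite fctE; case: (f x).
Qed.


Let measurable_pow (w : T -> R) : measurable_fun setT w ->
  measurable_fun setT (fun x : T => (`|(w x)%:E| `^ p)%E).
Proof.
move=> mw; apply: (@measurableT_comp _ _ _ _ _ _ (fun x => (x `^ p)%E)).
  exact: measurable_poweR.
by apply: measurableT_comp => //; exact/measurable_EFinP.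
Qed.

Let ge0_le_Lnorm (u v : T -> R) :
  measurable_fun setT u -> measurable_fun setT v ->
  (forall x, 0 <= u x) -> (forall x, u x <= v x) ->
  (Lnorm mu p%:E (EFin \o u) <= Lnorm mu p%:E (EFin \o v))%E.
Proof.
move=> mu_ mv u0 uv; rewrite unlock /=.
have p0 : 0 <= p by exact: le_trans p1.
apply: gt0_ler_poweR.
- by rewrite invr_ge0.
- by rewrite in_itv /= leey andbT integral_ge0 // => x _; exact: poweR_ge0.
- by rewrite in_itv /= leey andbT integral_ge0 // => x _; exact: poweR_ge0.
apply: ge0_le_integral => //.
- exact: measurable_pow.
- exact: measurable_pow.
move=> x _ /=; rewrite lee_fin; apply: ge0_ler_powR; rewrite ?nnegrE //.
by rewrite !ger0_norm // (le_trans (u0 x)).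
Qed.

Let normc_ge0 (z : R[i]) : 0 <= Normc.normc z.
Proof. by case: z => a b; exact: sqrtr_ge0. Qed.

Lemma cLnormD f g : measurable_cfun f -> measurable_cfun g ->
  (cLnorm mu p (f + g)%R <= cLnorm mu p f + cLnorm mu p g)%E.
Proof.
move=> mf mg; have mnf := measurable_normc mf; have mng := measurable_normc mg.
apply: le_trans (minkowski_EFin mu mnf mng p1).
apply: ge0_le_Lnorm => //.
- exact/measurable_normc/measurable_cfunD.
- exact: measurable_funD.
- by move=> x; exact: le_normcD.
Qed.

Lemma cLnormZ (a : R[i]) f : f \in cLfun mu p ->
  cLnorm mu p (a *: f)%R = ((Normc.normc a)%:E * cLnorm mu p f)%E.
Proof.
rewrite inE => -[mf fy].
have pE : (1 <= p%:E)%E by rewrite lee_fin.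
have uP : (fun x => Normc.normc (f x)) \in Lfun mu p%:E.
  by apply/andP; split; rewrite inE //=; exact: measurable_normc.
have := LnormZ (Lfun_Sub pE uP) (Normc.normc a).
rewrite ger0_norm // => <-.
by apply: eq_Lnorm => x /=; rewrite fctE Normc.normcM.
Qed.

Lemma ae_eq_cLnorm f g : measurable_cfun f -> measurable_cfun g ->
  (\forall x \ae mu, f x = g x) -> cLnorm mu p f = cLnorm mu p g.
Proof.
move=> mf mg fg; rewrite /cLnorm unlock /=; congr (_ `^ _)%E.
apply: ae_eq_integral => //; [exact/measurable_pow/measurable_normc..|].
by apply: filterS fg => x -> _.
Qed.

Lemma cLnorm_eq0 f : measurable_cfun f -> cLnorm mu p f = 0%E ->
  \forall x \ae mu, f x = 0.
Proof.
move=> mf /Lnorm_eq0_eq0 h.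
have : (fun x => (Normc.normc (f x))%:E) = \0%E %[ae mu].
  apply: h; last by rewrite lte_fin (lt_le_trans ltr01).
  exact/measurable_EFinP/measurable_normc.
by apply: filterS => x /(_ I) [] /Normc.eq0_normc.
Qed.

Lemma cLnorm0 : cLnorm mu p 0%R = 0%E.
Proof.
rewrite -(@Lnorm0 _ _ _ mu p%:E); last first.
  by rewrite eqe gt_eqF // (lt_le_trans ltr01).
by apply: eq_Lnorm => x; congr (_%:E); exact: Normc.normc0.
Qed.

Lemma cLfun_submod_closed : submod_closed (@cLfun _ T R mu p).
Proof.
split.
  by rewrite inE; split; [split; exact: measurable_cst | rewrite cLnorm0].
move=> a f g fP gP; have := fP; have := gP; rewrite !inE.
move=> -[mg gy] [mf fy]; have mZ := measurable_cfunZ a mf.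
split; first exact: measurable_cfunD.
apply: le_lt_trans (cLnormD mZ mg) _.
rewrite cLnormZ // lte_add_pinfty // lte_mul_pinfty // lee_fin.
exact: normc_ge0.
Qed.

End cLfun_theory.

Section cLspace.
Context (d : measure_display) (T : measurableType d) (R : realType).
Variables (mu : {measure set T -> \bar R}) (p : R) (p1 : 1 <= p).
Implicit Types f g : cLfunType mu p1.

HB.instance Definition _ := GRing.isSubmodClosed.Build _ _ (@cLfun _ T R mu p)
  (cLfun_submod_closed mu p1).

HB.instance Definition _ := [isSub for @cLfun_val _ _ _ mu p p1].
HB.instance Definition _ := [Choice of cLfunType mu p1 by <:].
HB.instance Definition _ := [SubChoice_isSubLmodule of cLfunType mu p1 by <:].

Definition cLfun_ae (f g : cLfunType mu p1) : bool :=
  `[< \forall x \ae mu, f x = g x >].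

Let cLfun_ae_refl : reflexive cLfun_ae.
Proof. by move=> f; apply/asboolP; exact: nearW. Qed.

Let cLfun_ae_sym : symmetric cLfun_ae.
Proof.
by move=> f g; apply/asboolP/asboolP; apply: filterS => x ->.
Qed.

Let cLfun_ae_trans : transitive cLfun_ae.
Proof.
move=> g f h /asboolP fg /asboolP gh; apply/asboolP.
by apply: filterS2 fg gh => x -> ->.
Qed.

Canonical cLfun_ae_equiv :=
  EquivRel cLfun_ae cLfun_ae_refl cLfun_ae_sym cLfun_ae_trans.

(* The complex L^p space of mu: functions of finite p-norm modulo equality almost
   everywhere; the instance at the end of the section makes it a normed module
   over R[i]. *)
Definition cLspace : Type := {eq_quot cLfun_ae}%qT.

HB.instance Definition _ := Choice.on cLspace.
HB.instance Definition _ := EqQuotient.on cLspace.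

Local Notation cls := (\pi_cLspace)%qT.

(* A representative of the class F. *)
Definition cLspace_fun (F : cLspace) : T -> R[i]^o := repr F.

Lemma cLspaceP (f g : cLfunType mu p1) :
  reflect (\forall x \ae mu, f x = g x) (cls f == cls g).
Proof. by rewrite eqmodE; exact: asboolP. Qed.

Lemma repr_cLspace (f : cLfunType mu p1) :
  \forall x \ae mu, cLspace_fun (cls f) x = f x.
Proof. by apply/cLspaceP; rewrite reprK. Qed.

Definition cLspace_zero : cLspace := cls 0.
Definition cLspace_opp (F : cLspace) : cLspace := cls (- repr F).
Definition cLspace_add (F G : cLspace) : cLspace := cls (repr F + repr G).
Definition cLspace_scale (a : R[i]) (F : cLspace) : cLspace := cls (a *: repr F).

Let LoppE f :
  cLspace_opp (cls f) = cls (- f).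
Proof.
apply/eqP/cLspaceP; apply: filterS (repr_cLspace f) => x.
by rewrite /cLspace_fun /= !fctE => ->.
Qed.

Let LaddE f g :
  cLspace_add (cls f) (cls g) = cls (f + g).
Proof.
apply/eqP/cLspaceP; apply: filterS2 (repr_cLspace f) (repr_cLspace g) => x.
by rewrite /cLspace_fun /= !fctE => -> ->.
Qed.

Let LscaleE a f :
  cLspace_scale a (cls f) = cls (a *: f).
Proof.
apply/eqP/cLspaceP; apply: filterS (repr_cLspace f) => x.
by rewrite /cLspace_fun /= !fctE => ->.
Qed.

Let LaddA : associative cLspace_add.
Proof.
elim/quotW => f; elim/quotW => g; elim/quotW => h.
by rewrite (LaddE g h) (LaddE f (g + h)) (LaddE f g) (LaddE _ h) addrA.
Qed.

Let LaddC : commutative cLspace_add.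
Proof. by elim/quotW => f; elim/quotW => g; rewrite (LaddE f g) (LaddE g f) addrC. Qed.

Let Ladd0 : left_id cLspace_zero cLspace_add.
Proof. by elim/quotW => f; rewrite (LaddE 0 f) add0r. Qed.

Let LaddN : left_inverse cLspace_zero cLspace_opp cLspace_add.
Proof. by elim/quotW => f; rewrite (LoppE f) (LaddE _ f) addNr. Qed.

HB.instance Definition _ := GRing.isZmodule.Build cLspace LaddA LaddC Ladd0 LaddN.

Let LscaleA a b F : cLspace_scale a (cLspace_scale b F) = cLspace_scale (a * b) F.
Proof. by elim/quotW : F => f; rewrite (LscaleE b f) !LscaleE scalerA. Qed.

Let Lscale1 : left_id 1 cLspace_scale.
Proof. by elim/quotW => f; rewrite LscaleE scale1r. Qed.

Let LscaleDr : right_distributive cLspace_scale +%R.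
Proof.
move=> a; elim/quotW => f; elim/quotW => g.
by rewrite [X in cLspace_scale a X](LaddE f g) !LscaleE [RHS]LaddE scalerDr.
Qed.

Let LscaleDl F : {morph cLspace_scale^~ F : a b / a + b}.
Proof.
move=> a b; elim/quotW : F => f.
by rewrite !LscaleE [RHS]LaddE scalerDl.
Qed.

HB.instance Definition _ :=
  GRing.Zmodule_isLmodule.Build R[i] cLspace LscaleA Lscale1 LscaleDr LscaleDl.

Lemma cLspace_addE f g : cls f + cls g = cls (f + g).
Proof. exact: LaddE. Qed.

Lemma cLspace_oppE f : - cls f = cls (- f).
Proof. exact: LoppE. Qed.

Lemma cLspace_scaleE (a : R[i]) f : a *: cls f = cls (a *: f).
Proof. exact: LscaleE. Qed.

Definition cLspace_norm (F : cLspace) : R :=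
  fine (cLnorm mu p (cLspace_fun F)).

Lemma cLspace_normE f : (cLspace_norm (cls f))%:E = cLnorm mu p f.
Proof.
have [mf fy] := set_mem (cLfun_valP f).
have [mr ry] := set_mem (cLfun_valP (repr (cls f))).
rewrite /cLspace_norm (ae_eq_cLnorm p mr mf (repr_cLspace f)) fineK //.
by rewrite ge0_fin_numE // Lnorm_ge0.
Qed.

Let normD (F G : cLspace) :
  (cLspace_norm (F + G))%:C%C <= (cLspace_norm F)%:C%C + (cLspace_norm G)%:C%C.
Proof.
elim/quotW : F => f; elim/quotW : G => g.
have [mf _] := set_mem (cLfun_valP f).
have [mg _] := set_mem (cLfun_valP g).
rewrite -rmorphD lecR -lee_fin EFinD cLspace_addE !cLspace_normE.
exact: cLnormD.
Qed.

Let normZ (a : R[i]) (F : cLspace) :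
  (cLspace_norm (a *: F))%:C%C = `|a| * (cLspace_norm F)%:C%C.
Proof.
elim/quotW : F => f; rewrite cLspace_scaleE.
suff -> : cLspace_norm (cls (a *: f)) = Normc.normc a * cLspace_norm (cls f).
  by rewrite rmorphM.
apply: EFin_inj; rewrite EFinM !cLspace_normE.
exact: cLnormZ (cLfun_valP f).
Qed.

Let norm_eq0 (F : cLspace) : (cLspace_norm F)%:C%C = 0 -> F = 0.
Proof.
elim/quotW : F => f /complexI F0; apply/eqP/cLspaceP.
have [mf _] := set_mem (cLfun_valP f).
by apply: (cLnorm_eq0 p1) => //; rewrite -cLspace_normE F0.
Qed.

HB.instance Definition _ :=
  Lmodule_isNormed.Build R[i] cLspace normD normZ norm_eq0.

End cLspace.
Arguments cLspace {d T R} mu {p} p1.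

Section BoundedOperators.
Context (R : realType) (V W : normedModType R[i]).
Implicit Types A : V -> W.

(* Norms take their values in R[i], hence the real part. *)
Definition opnorm A : \bar R :=
  ereal_sup [set (complex.Re `|A v|)%:E | v in [set v : V | `|v| <= 1]].

Definition bounded_operator A : Prop := (opnorm A < +oo)%E.

Definition compact_operator A : Prop :=
  precompact (A @` [set v : V | `|v| <= 1]).

Definition finite_rank A : Prop :=
  exists (m : nat) (e : 'I_m -> W), forall v, exists c : 'I_m -> R[i],
    A v = \sum_(i < m) c i *: e i.

End BoundedOperators.

Section NormalFormHardyOperator.
Context (R : realType).

(* The real line with its Lebesgue measurable (Caratheodory) sets, rather than
   just the Borel ones. *)
Definition lebR : measurableType _ :=
  caratheodory_type ((@wlength R idfun)^*)%mu.

Definition halfline : set lebR := [set x : R | 0 < x].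

Lemma measurable_halfline : measurable halfline.
Proof.
apply: sub_caratheodory.
have := @measurable_itv R `]0, +oo[.
congr measurable; apply/seteqP; split => x /=; by rewrite in_itv /= andbT.
Qed.

(* Lebesgue measure of the part of a set lying in (0,+oo): functions are total on
   the line, but their values outside (0,+oo) do not matter. *)
Definition halfline_measure : {measure set lebR -> \bar R} :=
  mrestr (@completed_lebesgue_measure R) measurable_halfline.

Definition Lp (p : R) (p1 : 1 <= p) := cLspace halfline_measure p1.

HB.instance Definition _ p (p1 : 1 <= p) := NormedModule.on (Lp p1).

Definition Lp_fun (p : R) (p1 : 1 <= p) (f : Lp p1) : lebR -> R[i]^o :=
  cLspace_fun f.

Implicit Types b : R -> \bar R.

Definition normal_form b : Prop :=
  (forall x, 0 < x -> (0 <= b x)%E) /\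
  (forall x y, 0 < x -> x <= y -> (b y <= b x)%E).

(* The maximum with 0 implements sup set0 = 0; otherwise it has no effect. *)
Definition ginv b (t : R) : \bar R :=
  maxe 0%E (ereal_sup [set x%:E | x in [set x : R | 0 < x /\ (t%:E < b x)%E]]).

Definition step_parameter b (n : nat) (x : R) : \bar R :=
  (2 ^- n * \sum_(1 <= k < (n * 2 ^ n).+1)
     \1_[set y : R | 0 < y /\ (y%:E < ginv b (k%:R / 2 ^+ n))%E] x)%:E.

(* Meant for measurable f with values in [0,+oo]. *)
Definition hardy b (f : lebR -> \bar R) (x : R) : \bar R :=
  \int[@completed_lebesgue_measure R]_(t in
    [set t : R | 0 < t /\ (t%:E < b x)%E]) f t.

(* H is the bounded linear extension to the complex space L^p of the positive
   operator hardy b on the non-negative functions of L^p. Such an H exists iff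
   hardy b is bounded from these functions to L^q, and it is then unique since
   every element of L^p is a linear combination of four non-negative ones. *)
Definition hardy_operator (p q : R) (p1 : 1 <= p) (q1 : 1 <= q) b
    (H : {linear Lp p1 -> Lp q1}) : Prop :=
  bounded_operator H /\
  forall f : Lp p1, (\forall x \ae halfline_measure, 0 <= Lp_fun f x) ->
    \forall x \ae halfline_measure,
      hardy b (fun t => (complex.Re (Lp_fun f t))%:E) x = (complex.Re (Lp_fun (H f) x))%:E /\
      complex.Im (Lp_fun (H f) x) = 0.

End NormalFormHardyOperator.

(* Main.v *)
(* Write G(x) for the integral of f over (0, b(x)). Hoelder's inequality with the
   weight t^(1/(p p')) bounds G(x)^p by a weighted integral of f^p; interpolating
   with the unweighted Hoelder bound for G(x)^(q-p) and applying Tonelli's theorem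
   shows that b(x)^(1/p') x^(1/q) < e on a set of x's makes H_b restricted to this
   set of norm O(e). Under (iv) this disposes of x near 0 and infinity, uniformly
   for b and its minorants b_n, while in between b - b_n <= 2^-n; hence
   H_{b_n} -> H_b in norm, and H_{b_n} has finite rank since b_n takes finitely many
   values, the nonzero ones on bounded sets.
   Conversely, if H_b is compact or a norm limit of the H_{b_n}, then the L^q-norms
   of H_b f on (0, d) and (M, oo) are uniformly small over the nonnegative f of the
   unit ball; testing with f = s^(-1/p) on (0, s), s <= b(x), gives (iv). Norm limits
   of finite-rank operators are compact because L^q is complete. *)
From HB Require Import structures.
Require Import Defs.
From mathcomp Require Import all_boot all_order all_algebra.
From mathcomp Require Import all_classical all_reals all_analysis.
From mathcomp Require Import measurable_realfun complex.
From mathcomp Require Import ring lra.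

Set Implicit Arguments.
Unset Strict Implicit.
Unset Printing Implicit Defensive.

Import Order.TTheory GRing.Theory Num.Theory.
Import numFieldNormedType.Exports.

Local Open Scope classical_set_scope.
Local Open Scope ring_scope.

(** The interval (0, b(x)) is enclosed in the explicit region t^(1/p') x^(1/q) < e. Its sections in
    either variable are initial intervals, so Tonelli's theorem yields closed formulas although b
    may jump or be infinite, and b enters the bound only through e. The same estimate thus serves b,
    the b_n and their differences. The defining property of H gives a formula on nonnegative classes
    only, so the converse tests H on these alone. In (iii) the operators H_{b_n} are merely bounded;
    this already forces b_n to vanish for large x, while b_n <= n controls x near 0. Each of (i),
    (ii), (iii) asserts that some H exists. The steps to (ii) and (iii) pass through (iv), from
    which H and all H_{b_n} are built anew. From (ii), condition (iv) is reached by way of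
    compactness, because arbitrary finite-rank operators have no pointwise formula. *)

Local Notation normc := Normc.normc.

(** * Lebesgue measure on the half-line *)

Section MeasureRestriction.
Context d (T : measurableType d) (R : realType).
Variables (mu : {measure set T -> \bar R}) (D : set T) (mD : measurable D).
Local Open Scope ereal_scope.

(** [mu] is the sum of its restrictions to [D] and to the complement of [D]; the second is null
    inside [D], the first outside. *)
Lemma ge0_integral_mrestr (A : set T) (f : T -> \bar R) : measurable A ->
  measurable_fun A f -> (forall x, A x -> 0 <= f x) ->
  \int[mrestr mu mD]_(x in A) f x = \int[mu]_(x in A `&` D) f x.
Proof.
move=> mA mf f0.
have mDC : measurable (~` D) by exact: measurableC.
have f0' x : (A `&` D) x -> 0 <= f x by case=> /f0.
have mf' : measurable_fun (A `&` D) f by exact: measurable_funS mf.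
have mAD : measurable (A `&` D) by exact: measurableI.
rewrite (@eq_measure_integral _ _ _ (A `&` D)
  (measure_add (mrestr mu mD) (mrestr mu mDC)) mu); last first.
  move=> B mB BD; rewrite /measure_add/= /msum !big_ord_recl big_ord0/= /mrestr.
  rewrite adde0 -[in LHS](setIT B) -(setUv D) setIUr measureU//.
  - exact: measurableI.
  - exact: measurableI.
  - by rewrite setIACA setICr setI0.
rewrite ge0_integral_measure_add//.
rewrite [X in _ = _ + X]null_set_integral ?adde0//; last first.
  transitivity (mu ((A `&` D) `&` ~` D)) => //.
  by rewrite -setIA setICr setI0 measure0.
rewrite -[in LHS](setIT A) -(setUv D) setIUr ge0_integral_setU//=.
- rewrite [X in _ + X]null_set_integral ?adde0//.
  + exact: measurableI.
  + exact: measurable_funS mf.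
  + transitivity (mu ((A `&` ~` D) `&` D)) => //.
    by rewrite -setIA setICl setI0 measure0.
- exact: measurableI.
- by rewrite -setIUr setUv setIT.
- by move=> x [] [] /f0.
- by apply/disj_setPS => x [[_ ?] [_ ]].
Qed.

End MeasureRestriction.

(** The measures may live on different sigma-algebras: [phi] is later the identity from
    Caratheodory-measurable to Borel sets, which carries Borel computations over to the completed
    measure. *)
Lemma ge0_integral_preimage d1 d2 (X : measurableType d1) (Y : measurableType d2)
    (R : realType) (phi : X -> Y) (m1 : {measure set X -> \bar R})
    (m2 : {measure set Y -> \bar R}) (D : set Y) (f : Y -> \bar R) :
  measurable_fun setT phi ->
  (forall A, measurable A -> m1 (phi @^-1` A) = m2 A) ->
  measurable D -> measurable_fun D f -> (forall x, D x -> (0 <= f x)%E) ->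
  (\int[m1]_(x in phi @^-1` D) f (phi x) = \int[m2]_(x in D) f x)%E.
Proof.
move=> mphi m12 mD mf f0.
rewrite -(ge0_integral_pushforward mphi) //; last by move=> x /[!inE] /f0.
by apply: eq_measure_integral => A mA AD; exact: m12.
Qed.

Section HalfLine.
Context (R : realType).
Local Notation lam := (halfline_measure R).
Local Notation mu := (@completed_lebesgue_measure R).
Local Notation leb := (@lebesgue_measure R).
Local Open Scope ereal_scope.

Lemma borel_lebR (A : set R) : measurable A -> measurable (A : set (lebR R)).
Proof. exact: sub_caratheodory. Qed.

Lemma measurable_id_lebR :
  measurable_fun [set: lebR R] (id : lebR R -> measurableTypeR R).
Proof. by move=> _ A mA; rewrite setTI; exact: borel_lebR. Qed.

Lemma measurable_fun_lebR d (Y : measurableType d) (D : set R) (f : R -> Y) :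
  measurable D -> measurable_fun D f -> measurable_fun (D : set (lebR R)) f.
Proof. by move=> mD mf _ A mA; apply: borel_lebR; exact: mf. Qed.

Lemma ge0_integral_lebR (D : set R) (f : R -> \bar R) : measurable D ->
  measurable_fun D f -> (forall x, D x -> 0 <= f x) ->
  \int[mu]_(x in D) f x = \int[leb]_(x in D) f x.
Proof.
move=> mD mf f0.
by apply: (@ge0_integral_preimage _ _ (lebR R) (measurableTypeR R) R
  (id : lebR R -> measurableTypeR R) mu leb D f measurable_id_lebR).
Qed.

Lemma integral_halfline (D : set (lebR R)) (f : lebR R -> \bar R) : measurable D ->
  measurable_fun D f -> (forall x, D x -> 0 <= f x) ->
  \int[lam]_(x in D) f x = \int[mu]_(x in D `&` @halfline R) f x.
Proof. exact: ge0_integral_mrestr. Qed.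

Lemma halfline_borel (A : set R) : measurable A ->
  lam A = leb (A `&` [set x | (0 < x)%R]).
Proof. reflexivity. Qed.

Lemma measurable_gt0 : measurable [set x : R | (0 < x)%R].
Proof.
have := @measurable_itv R `]0%R, +oo[.
by congr measurable; apply/seteqP; split => x /=; rewrite in_itv /= andbT.
Qed.

Lemma halfline_lt (s : R) : (0 <= s)%R -> lam [set t : R | (t < s)%R] = s%:E.
Proof.
move=> s0; rewrite halfline_borel; last first.
  have := @measurable_itv R `]-oo, s[.
  by congr measurable; apply/seteqP; split => x /=; rewrite in_itv /=.
rewrite [X in leb X](_ : _ = `]0%R, s[%classic); last first.
  by apply/seteqP; split => x /=; rewrite in_itv /=; [case=> -> ->|case/andP].
rewrite lebesgue_measure_itv/= lte_fin; have [_|s1] := ltrP; first by rewrite sube0.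
by congr EFin; apply/eqP; rewrite eq_le s0 s1.
Qed.

Lemma halfline_sigma_finite : sigma_finite setT lam.
Proof.
exists (fun n => [set t : R | (t < n%:R)%R]).
  apply/esym/seteqP; split => // x _; exists (Num.truncn `|x|%R).+1 => //=.
  by rewrite (le_lt_trans (ler_norm x))// truncnS_gt.
move=> n; split; last by rewrite halfline_lt// ltry.
apply: borel_lebR; have := @measurable_itv R `]-oo, n%:R[.
by congr measurable; apply/seteqP; split => x /=; rewrite in_itv /=.
Qed.

Definition halfline_sf : {sigma_finite_measure set (lebR R) -> \bar R} :=
  HB.pack (Measure.sort lam)
    (Measure_isSigmaFinite.Build _ _ _ (Measure.sort lam) halfline_sigma_finite).

Lemma halfline_tonelli (f : lebR R * lebR R -> \bar R) :
  measurable_fun setT f -> (forall x, 0 <= f x) ->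
  \int[lam]_x \int[lam]_y f (x, y) = \int[lam]_y \int[lam]_x f (x, y).
Proof.
by move=> mf f0; exact: (@fubini_tonelli _ _ _ _ _ halfline_sf halfline_sf).
Qed.

Lemma halfline_set1 (x : R) : lam [set x] = 0.
Proof.
rewrite halfline_borel//; apply/eqP; rewrite eq_le measure_ge0 andbT.
rewrite -(lebesgue_measure_set1 x); apply: le_measure; rewrite ?inE//.
by apply: measurableI => //; exact: measurable_gt0.
Qed.

#[global] Instance halfline_ae_filter : Filter (nbhs (almost_everywhere lam)).
Proof. exact: (@ae_filter_ringOfSetsType _ (lebR R) R (halfline_measure R)). Qed.

Lemma halfline_aeW (P : R -> Prop) : (forall x, (0 < x)%R -> P x) ->
  \forall x \ae lam, P x.
Proof.
move=> h; exists (~` @halfline R); split.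
- exact/measurableC/measurable_halfline.
- by rewrite /halfline_measure /= /mrestr setICl measure0.
- by move=> x /= nP x0; apply: nP; exact: h.
Qed.

Lemma halfline_ae_neq (x : R) : \forall y \ae lam, y <> x.
Proof.
exists [set x]; split; last by move=> y /= /contrapT.
  by apply: borel_lebR; exact: (@measurable_set1 R).
exact: halfline_set1.
Qed.

End HalfLine.

Section Monotone.
Context (R : realType).
Local Open Scope ereal_scope.

(** Superlevel sets of [g] on the half-line are intervals, hence Borel. *)
Lemma nonincreasing_halfline_measurable (g : R -> \bar R) :
  (forall x y, (0 < x)%R -> (x <= y)%R -> g y <= g x) ->
  measurable_fun (@halfline R) (g : lebR R -> \bar R).
Proof.
move=> gd; apply: (measurability (@ErealGenOInfty.G R)).
  exact: ErealGenOInfty.measurableE.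
move=> _ [_ [r ->] <-]; apply: borel_lebR; apply: is_interval_measurable.
move=> x y [/= x0 _] [/= _ ry] z /andP[xz zy].
rewrite /halfline /=; split; first exact: (lt_le_trans x0).
move: ry; rewrite /= !in_itv /= !andbT => ry.
by apply: (lt_le_trans ry); apply: gd => //; exact: (lt_le_trans x0).
Qed.

End Monotone.

Section PowerIntegral.
Context (R : realType).
Local Notation lam := (halfline_measure R).
Local Notation leb := (@lebesgue_measure R).

Lemma continuous_powR (a x : R) : 0 < x -> {for x, continuous (@powR R ^~ a)}.
Proof.
move=> x0; apply: differentiable_continuous; apply/derivable1_diffP.
by apply: derivable_powR; rewrite in_itv/= x0.
Qed.

(** The fundamental theorem of calculus, applied away from 0 because t^(a-1) blows up there when a <
    1. *)
Lemma integral_powR_itv (a x y : R) : 0 < a -> 0 < x -> x < y ->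
  (\int[leb]_(t in `[x, y]) (t `^ (a - 1))%:E = (y `^ a / a - x `^ a / a)%:E)%E.
Proof.
move=> a0 x0 xy; rewrite EFinB.
have y0 := lt_trans x0 xy.
have c (b z : R) : 0 < z -> {for z, continuous (fun t : R => t `^ b / a)}.
  by move=> z0; apply: cvgM; [exact: continuous_powR|exact: cvg_cst].
apply: (@continuous_FTC2 _ _ (fun t => t `^ a / a)) => //.
- apply: continuous_in_subspaceT => t /[!inE]/= /[!in_itv]/= /andP[xt _].
  by apply: continuous_powR; exact: lt_le_trans xt.
- split.
  + move=> t /[!in_itv]/= /andP[xt _]; apply: derivableM => //.
    by apply: derivable_powR; rewrite in_itv/= andbT (lt_trans x0).
  + by apply: cvg_at_right_filter; exact: c.
  + by apply: cvg_at_left_filter; exact: c.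
- move=> t /[!in_itv]/= /andP[xt _].
  have t0 := lt_trans x0 xt.
  rewrite derive1E deriveM//; last first.
    by apply: derivable_powR; rewrite in_itv/= andbT.
  rewrite [X in X + _](_ : _ = 0) ?add0r; last first.
    by rewrite (_ : (fun=> a^-1) = cst a^-1)// derive_cst scaler0.
  rewrite -derive1E powR_derive1 ?in_itv/= ?andbT//.
  by rewrite /GRing.scale/= mulrA mulVf ?mul1r// gt_eqF.
Qed.

(** Monotone convergence along intervals exhausting ]0, r]; the subtracted term at the left endpoint
    is dropped, an inequality being all that the Hardy estimate uses. *)
Lemma integral_powR_lt (a r : R) : 0 < a -> 0 < r ->
  (\int[leb]_(t in `]0%R, r]) (t `^ (a - 1))%:E <= (r `^ a / a)%:E)%E.
Proof.
move=> a0 r0.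
(* The offset 2 keeps the left endpoint strictly below [r] even for n = 0, as [integral_powR_itv]
   requires. *)
pose F (n : nat) : set R := `[(r / n.+2%:R), r]%classic.
have ltFr (n : nat) : r / n.+2%:R < r.
  by rewrite ltr_pdivrMr// ltr_pMr// ltr1n.
have FE : \bigcup_n F n = `]0%R, r]%classic.
  apply/seteqP; split => x /=.
    case=> n _; rewrite /F /= !in_itv /= => /andP[nx ->]; rewrite andbT.
    by apply: lt_le_trans nx; rewrite divr_gt0.
  rewrite in_itv/= => /andP[x0 xr].
  exists (Num.truncn (r / x)) => //; rewrite /F/= in_itv/= xr andbT.
  rewrite ler_pdivrMr// mulrC -ler_pdivrMr//.
  rewrite (le_trans (ltW (truncnS_gt _)))// ler_nat.
  by [].
have mp (n : nat) : measurable_fun (F n) (fun t : R => (t `^ (a - 1))%:E).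
  by apply/measurable_EFinP; exact: measurable_funTS.
have h : (\int[leb]_(t in F n) (t `^ (a - 1))%:E)%E @[n --> \oo] -->
    (\int[leb]_(t in `]0%R, r]) (t `^ (a - 1))%:E)%E.
  rewrite -FE; apply: ge0_nondecreasing_set_cvg_integral => //.
    move=> n m nm; apply/subsetPset => x; rewrite /F /= !in_itv/= => /andP[nx ->].
    rewrite andbT; apply: le_trans nx.
    by apply: ler_wpM2l; [exact: ltW|rewrite lef_pV2 ?posrE// ler_nat].
    by move=> n; exact: measurable_itv.
  by move=> n x _; rewrite lee_fin powR_ge0.
rewrite -(cvg_lim _ h)//; apply: lime_le; first by apply/cvg_ex; eexists; exact: h.
apply: nearW => n; rewrite integral_powR_itv// ?divr_gt0// lee_fin gerBl.
by rewrite divr_ge0 ?powR_ge0// ltW.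
Qed.

(** The domain is (0, D^(1/a)). The bound is used with a = 1/p' in the inner variable and with
    exponent 1/q in the outer one. *)
Lemma halfline_powR_lt (a D : R) : 0 < a -> 0 < D ->
  (\int[lam]_(t in [set t : R | (0 < t)%R /\ (t `^ a < D)%R]) ((t : R) `^ (a - 1))%:E
   <= (D / a)%:E)%E.
Proof.
move=> a0 D0.
have r0 : 0 < D `^ a^-1 by rewrite powR_gt0.
have rD : (D `^ a^-1) `^ a = D by rewrite -powRrM mulVf ?gt_eqF// powRr1// ltW.
rewrite [X in integral _ X](_ : _ = `]0%R, (D `^ a^-1)[%classic :> set R); last first.
  apply/seteqP; split => t /=; rewrite in_itv/=.
    case=> t0 tD; rewrite t0/=.
    rewrite -(@powRr1 _ t) ?ltW// -(divff (lt0r_neq0 a0)) powRrM.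
    by rewrite gt0_ltr_powR ?nnegrE ?invr_gt0 ?powR_ge0// ltW.
  case/andP => t0 tD; split => //; rewrite -[ltRHS]rD.
  by rewrite gt0_ltr_powR ?nnegrE// ltW.
have mp (A : set R) : measurable_fun A (fun t : R => (t `^ (a - 1))%:E).
  by apply/measurable_EFinP; exact: measurable_funTS.
rewrite integral_halfline; last 3 first.
- exact: (borel_lebR (@measurable_itv _ _)).
- exact: (measurable_fun_lebR (@measurable_itv _ _) (mp _)).
- by move=> x _; rewrite lee_fin powR_ge0.
rewrite [X in integral _ X](_ : _ = `]0%R, (D `^ a^-1)[%classic :> set R); last first.
  by apply/setIidl => t /=; rewrite in_itv/= => /andP[].
rewrite ge0_integral_lebR//; last by move=> x _; rewrite lee_fin powR_ge0.
rewrite -[in leRHS]rD; apply: le_trans (integral_powR_lt a0 r0).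
apply: ge0_subset_integral => //.
- exact: mp.
- by move=> x _; rewrite lee_fin powR_ge0.
- by move=> t /=; rewrite !in_itv/= => /andP[-> /ltW ->].
Qed.

End PowerIntegral.

(** * A Hardy inequality *)

Section HoelderOn.
Context d (T : measurableType d) (R : realType).
Variable m : {measure set T -> \bar R}.
Local Open Scope ereal_scope.

(** Hoelder on the whole space for [u] and [v] cut off to 0 outside [S]. *)
Lemma hoelder_on (S : set T) (u v : T -> R) (p p' : R) : measurable S ->
  measurable_fun setT u -> measurable_fun setT v ->
  (forall x, (0 <= u x)%R) -> (forall x, (0 <= v x)%R) ->
  (0 < p)%R -> (0 < p')%R -> (p^-1 + p'^-1 = 1)%R ->
  \int[m]_(x in S) (u x * v x)%:E <=
  (\int[m]_(x in S) (u x `^ p)%:E) `^ p^-1 * (\int[m]_(x in S) (v x `^ p')%:E) `^ p'^-1.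
Proof.
move=> mS mu_ mv u0 v0 p0 p'0 pp'.
have mr (w : T -> R) : measurable_fun setT w -> measurable_fun setT (w \_ S).
  by move=> mw; apply/(measurable_restrictT w mS); exact: measurable_funTS mw.
have r0 (w : T -> R) x : (forall x, 0 <= w x)%R -> (0 <= (w \_ S) x)%R.
  by move=> w0; rewrite patchE; case: ifP => // _; exact: lexx.
have Nr (w : T -> R) (r : R) : (0 < r)%R -> (forall x, 0 <= w x)%R ->
    'N[m]_r%:E[EFin \o (w \_ S)] = (\int[m]_(x in S) (w x `^ r)%:E) `^ r^-1.
  move=> r_gt0 w0; have rN0 := lt0r_neq0 r_gt0.
  transitivity (('N[m]_r%:E[EFin \o (w \_ S)] `^ r) `^ r^-1).
    by rewrite -poweRrM mulfV// poweRe1// Lnorm_ge0.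
  rewrite powR_Lnorm; last exact: rN0.
  apply: (congr1 (fun z => z `^ r^-1)).
  rewrite [RHS]integral_mkcond; apply: eq_integral => x _ /=.
  rewrite ger0_norm ?r0// !patchE; case: ifP => // _.
  by rewrite powR0 ?gt_eqF.
have := hoelder m (mr _ mu_) (mr _ mv) p0 p'0 pp'.
rewrite !Nr//; apply: le_trans.
rewrite Lnorm1 integral_mkcond le_eqVlt; apply/orP; left; apply/eqP.
apply: eq_integral => x _ /=; rewrite ger0_norm ?mulr_ge0 ?r0//.
by rewrite !patchE; case: ifP => // _; rewrite mulr0.
Qed.

End HoelderOn.

Section HardyInequality.
Context (R : realType) (p p' q : R).
Hypotheses (hp : 1 < p) (hpq : p <= q) (hp' : p^-1 + p'^-1 = 1).
Local Notation lam := (halfline_measure R).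
Local Notation a := (p'^-1).
Local Notation c := (q^-1).
Local Open Scope ereal_scope.

Let p0 : (0 < p)%R. Proof. exact: lt_trans hp. Qed.
Let q0 : (0 < q)%R. Proof. exact: lt_le_trans hpq. Qed.

Lemma conjugate_gt0 : (0 < p')%R.
Proof.
rewrite -invr_gt0 (_ : a = 1 - p^-1)%R; last by rewrite -hp' addrC addKr.
by rewrite subr_gt0 invf_lt1.
Qed.

Let p'0 : (0 < p')%R := conjugate_gt0.
Let a0 : (0 < a)%R. Proof. by rewrite invr_gt0. Qed.
Let c0 : (0 < c)%R. Proof. by rewrite invr_gt0. Qed.
Let ap : (a * p = p - 1)%R.
Proof.
have -> : (a = 1 - p^-1)%R by rewrite -hp' addrC addKr.
by rewrite mulrBl mul1r mulVf// gt_eqF.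
Qed.
Let a1 : (a - 1 = - p^-1)%R. Proof. by rewrite -hp' opprD addrCA subrr addr0. Qed.

(* [below (b x)] lies in [sector e x] as soon as b(x)^(1/p') x^(1/q) < e, and the
   condition is symmetric in the two variables up to exchanging the exponents. *)
Definition in_sector (e : R) (z : lebR R * lebR R) : bool :=
  ((0 < (z.1 : R)) && (0 < (z.2 : R)) && ((z.2 : R) `^ a * (z.1 : R) `^ c < e))%R.

Definition sector (e x : R) : set (lebR R) := [set t | in_sector e (x, t)].

Lemma measurable_fst_lebR : measurable_fun [set: lebR R * lebR R]
  (fun z => z.1 : measurableTypeR R).
Proof. exact: (measurableT_comp (@measurable_id_lebR R) measurable_fst). Qed.

Lemma measurable_snd_lebR : measurable_fun [set: lebR R * lebR R]
  (fun z => z.2 : measurableTypeR R).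
Proof. exact: (measurableT_comp (@measurable_id_lebR R) measurable_snd). Qed.

Lemma measurable_in_sector e : measurable_fun setT (in_sector e).
Proof.
apply: measurable_and; first apply: measurable_and.
- exact: measurable_fun_ltr measurable_fst_lebR.
- exact: measurable_fun_ltr measurable_snd_lebR.
- apply: measurable_fun_ltr => //; apply: measurable_funM.
  + exact: measurableT_comp (measurable_powR _) measurable_snd_lebR.
  + exact: measurableT_comp (measurable_powR _) measurable_fst_lebR.
Qed.

Lemma measurable_sector e x : measurable (sector e x).
Proof.
have := measurableT_comp (measurable_in_sector e) (measurable_pair1 (x : lebR R)).
by move=> /(_ measurableT [set true] I); rewrite setTI.
Qed.

Let measurable_powlebR (b : R) :
  measurable_fun [set: lebR R] (fun t : lebR R => (t : R) `^ b)%R.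
Proof. exact: measurableT_comp (measurable_powR _) (@measurable_id_lebR R). Qed.

Section Bound.
Variables (f : lebR R -> R) (n e : R).
Hypotheses (mf : measurable_fun setT f) (f0 : forall t, (0 <= f t)%R) (n0 : (0 <= n)%R).
Hypothesis (e0 : (0 < e)%R).
Hypothesis fn : \int[lam]_t (f t `^ p)%:E <= (n `^ p)%:E.

Lemma halfline_hoelder S : measurable S ->
  \int[lam]_(t in S) (f t)%:E <= n%:E * lam S `^ a.
Proof.
move=> mS.
have m1 : measurable_fun [set: lebR R] (fun=> 1%R : R) by exact: measurable_cst.
have := hoelder_on lam mS mf m1 f0 (fun=> ler01) p0 p'0 hp'.
under eq_integral do rewrite mulr1.
move=> /le_trans; apply; apply: lee_pmul; rewrite ?poweR_ge0//.
  have -> : n%:E = (n `^ p)%:E `^ p^-1.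
    by rewrite poweR_EFin -powRrM mulfV ?gt_eqF// powRr1.
  rewrite gt0_ler_poweR ?invr_ge0 ?(ltW p0)//.
  - by rewrite in_itv/= leey andbT integral_ge0// => t _; rewrite lee_fin powR_ge0.
  - by rewrite in_itv/= leey andbT lee_fin powR_ge0.
  apply: le_trans fn; apply: (ge0_subset_integral _ mS measurableT).
  - by apply/measurable_EFinP; exact: measurableT_comp (measurable_powR _) mf.
  - by move=> t _; rewrite lee_fin powR_ge0.
  - by [].
by rewrite powR1 /= integral_cst// mul1e.
Qed.

Definition sector_integral x := \int[lam]_(t in sector e x) (f t)%:E.

Lemma lt_powR_inv (b y r : R) : (0 < b -> 0 <= y -> 0 <= r -> y `^ b < r ->
  y < r `^ b^-1)%R.
Proof.
move=> b0 y0 r0 yr; rewrite -[ltLHS](@powRr1 _ y)// -(divff (lt0r_neq0 b0)) powRrM.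
by rewrite gt0_ltr_powR ?nnegrE ?invr_gt0 ?powR_ge0.
Qed.

(** Over [x] the sector lies in t < (e x^(-1/q))^p', an interval whose length to the power 1/p' is e
    x^(-1/q); the rest is unweighted Hoelder. *)
Lemma sector_integral_le x : (0 < x)%R ->
  sector_integral x <= (n * (e * x `^ (- c)))%:E.
Proof.
move=> x0; apply: le_trans (halfline_hoelder (measurable_sector e x)) _.
have xc0 : (0 < x `^ c)%R by rewrite powR_gt0.
have D0 : (0 < e * x `^ (- c))%R by rewrite mulr_gt0// powR_gt0.
rewrite EFinM lee_pmul// ?poweR_ge0//.
have r0 : (0 <= (e * x `^ (- c)) `^ p')%R by rewrite powR_ge0.
have -> : (e * x `^ (- c))%:E =
    (lam [set t : R | (t < (e * x `^ (- c)) `^ p')%R]) `^ a.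
  rewrite halfline_lt// poweR_EFin -powRrM mulfV ?gt_eqF// powRr1//.
  exact: ltW.
rewrite gt0_ler_poweR ?(ltW a0)// ?in_itv/= ?leey ?measure_ge0//.
apply: le_measure; rewrite ?inE//.
- exact: measurable_sector.
- by apply: borel_lebR; have := @measurable_itv R `]-oo, ((e * x `^ (- c)) `^ p')%R[;
    congr measurable; apply/seteqP; split => y /=; rewrite in_itv.
- move=> t; rewrite /sector /in_sector /= => /andP[/andP[_ t0] te].
  rewrite -(invrK p'); apply: lt_powR_inv => //; rewrite ?ltW//.
  by rewrite powRN ltr_pdivlMr.
Qed.

Definition sector_weight x := \int[lam]_(t in sector e x) (f t `^ p * (t : R) `^ a)%:E.

(** Hoelder for f = (f t^(1/(p p'))) t^(-1/(p p')). The p'-th power of the second factor is t^(-1/p)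
    = t^(1/p' - 1), integrable at 0, with integral over the section at most p' e x^(-1/q). *)
Lemma sector_integral_le_weight x : (0 < x)%R ->
  sector_integral x <= sector_weight x `^ p^-1 * ((e * x `^ (- c)) / a)%:E `^ a.
Proof.
move=> x0.
have xc0 : (0 < x `^ c)%R by rewrite powR_gt0.
have D0 : (0 < e * x `^ (- c))%R by rewrite mulr_gt0// powR_gt0.
pose u (t : lebR R) := (f t * (t : R) `^ (a * p^-1))%R.
pose v (t : lebR R) := ((t : R) `^ (- (a * p^-1)))%R.
have mu_ : measurable_fun setT u by exact: measurable_funM mf (measurable_powlebR _).
have mv : measurable_fun setT v by exact: measurable_powlebR.
have u0 t : (0 <= u t)%R by rewrite mulr_ge0 ?powR_ge0.
have v0 t : (0 <= v t)%R by exact: powR_ge0.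
have := hoelder_on lam (measurable_sector e x) mu_ mv u0 v0 p0 p'0 hp'.
rewrite (_ : \int[lam]_(t in _) (u t * v t)%:E = sector_integral x); last first.
  apply: eq_integral => t; rewrite inE /sector /in_sector /= => /andP[/andP[_ t0] _].
  by rewrite /u /v powRN mulfK// gt_eqF// powR_gt0.
rewrite (_ : \int[lam]_(t in _) (u t `^ p)%:E = sector_weight x); last first.
  apply: eq_integral => t; rewrite inE /sector /in_sector /= => /andP[/andP[_ t0] _].
  by rewrite /u powRM ?powR_ge0// -powRrM -mulrA mulVf ?gt_eqF// mulr1.
move=> /le_trans; apply; apply: lee_pmul; rewrite ?poweR_ge0//.
rewrite gt0_ler_poweR ?(ltW a0)//.
- by rewrite in_itv/= leey andbT integral_ge0// => t _; rewrite lee_fin powR_ge0.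
- by rewrite in_itv/= leey andbT lee_fin divr_ge0 ?ltW.
apply: le_trans (halfline_powR_lt a0 D0).
rewrite (_ : sector e x = [set t : R | (0 < t)%R /\ (t `^ a < e * x `^ (- c))%R]).
  rewrite le_eqVlt; apply/orP; left; apply/eqP; apply: eq_integral => t _.
  rewrite /v -powRrM; congr (_ `^ _)%:E.
  by rewrite a1 mulNr mulrAC mulVf ?mul1r// gt_eqF.
apply/seteqP; split => t; rewrite /sector /in_sector /= powRN ltr_pdivlMr// x0/=.
  by case/andP => -> ->.
by case=> -> ->.
Qed.

Definition sector_const := (n `^ (q - p) * a^-1 `^ (p - 1) * e `^ (q - 1))%R.

(** Write J for the sector integral, W for its weighted version and D = e x^(-1/q). Then J^(q-p) <=
    (n D)^(q-p) and J^p <= W (D/a)^(p-1). The powers of D combine to D^(q-1), whose x-part is x^(1/q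
    - 1); the other factors form [sector_const]. *)
Lemma sector_integral_pow x : (0 < x)%R ->
  sector_integral x `^ q <= (sector_const * x `^ (c - 1))%:E * sector_weight x.
Proof.
move=> x0.
have D0 : (0 < e * x `^ (- c))%R by rewrite mulr_gt0// powR_gt0.
set D := (e * x `^ (- c))%R in D0.
have J0 : 0 <= sector_integral x by apply: integral_ge0 => t _; rewrite lee_fin.
have W0 : 0 <= sector_weight x.
  by apply: integral_ge0 => t _; rewrite lee_fin mulr_ge0 ?powR_ge0.
have := sector_integral_le x0; have := sector_integral_le_weight x0.
rewrite -/D; case: (sector_integral x) J0 => [j| |//]; last by rewrite leye_eq.
rewrite !lee_fin => j0 J1 J2; rewrite poweR_EFin.
have -> : (j `^ q = j `^ (q - p) * j `^ p)%R.
  by rewrite -powRD ?subrK// gt_eqF.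
have J1p : (j `^ p)%:E <= sector_weight x * ((D / a) `^ (p - 1))%:E.
  rewrite -poweR_EFin.
  have -> : sector_weight x * ((D / a) `^ (p - 1))%:E =
      (sector_weight x `^ p^-1 * (D / a)%:E `^ a) `^ p.
    rewrite poweRM ?poweR_ge0// -!poweRrM mulVf ?gt_eqF// poweRe1//.
    by rewrite ap poweR_EFin.
  apply: gt0_ler_poweR J1; rewrite ?(ltW p0)// in_itv/= leey andbT ?lee_fin//.
  by rewrite mule_ge0 ?poweR_ge0 ?lee_fin ?powR_ge0.
rewrite EFinM; apply: (@le_trans _ _ (((n * D) `^ (q - p))%:E *
    (sector_weight x * ((D / a) `^ (p - 1))%:E))).
  apply: lee_pmul; rewrite ?lee_fin ?powR_ge0//.
  by rewrite ge0_ler_powR ?subr_ge0 ?nnegrE// mulr_ge0// ltW.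
rewrite muleCA muleC -EFinM le_eqVlt; apply/orP; left; apply/eqP; congr (_%:E * _).
rewrite /sector_const powRM ?(ltW D0)// powRM ?(ltW D0)// ?invr_ge0 ?(ltW p'0)//.
have -> : (n `^ (q - p) * D `^ (q - p) * (D `^ (p - 1) * a^-1 `^ (p - 1)) =
  n `^ (q - p) * a^-1 `^ (p - 1) * (D `^ (q - p) * D `^ (p - 1)))%R by ring.
rewrite -powRD; last by rewrite (gt_eqF D0) implybT.
rewrite [(q - p + _)%R]addrA subrK /D powRM ?powR_ge0 ?(ltW e0)// -powRrM.
have -> : (- c * (q - 1) = c - 1)%R by rewrite mulrBr mulr1 mulNr mulVf ?gt_eqF// opprK addrC.
by rewrite !mulrA.
Qed.

(** The cutoff is a case distinction on the product, so that the iterated integral runs over the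
    full product space, as in [halfline_tonelli]. *)
Definition sector_kernel (z : lebR R * lebR R) : R :=
  if in_sector e z
  then (f z.2 `^ p * (z.2 : R) `^ a * (sector_const * (z.1 : R) `^ (c - 1)))%R else 0%R.

Lemma sector_const_ge0 : (0 <= sector_const)%R.
Proof. by rewrite !mulr_ge0// powR_ge0. Qed.

Lemma sector_kernel_ge0 z : (0 <= sector_kernel z)%R.
Proof.
by rewrite /sector_kernel; case: ifP => // _; rewrite !mulr_ge0 ?powR_ge0 ?sector_const_ge0.
Qed.

Lemma measurable_sector_kernel : measurable_fun setT sector_kernel.
Proof.
apply: measurable_fun_ifT; [exact: measurable_in_sector| |exact: measurable_cst].
apply: measurable_funM; first apply: measurable_funM.
- apply: measurableT_comp (measurable_powR _) _.
  exact: measurableT_comp mf measurable_snd.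
- exact: measurableT_comp (measurable_powR _) measurable_snd_lebR.
- apply: measurable_funM => //.
  exact: measurableT_comp (measurable_powR _) measurable_fst_lebR.
Qed.

Lemma sector_kernelE x : (0 < x)%R ->
  \int[lam]_t (sector_kernel (x, t))%:E =
  (sector_const * x `^ (c - 1))%:E * sector_weight x.
Proof.
move=> x0; rewrite /sector_weight -ge0_integralZl; last 4 first.
- exact: measurable_sector.
- apply/measurable_EFinP; apply: measurable_funTS; apply: measurable_funM;
    last exact: measurable_powlebR.
  exact: measurableT_comp (measurable_powR _) mf.
- by move=> t _; rewrite lee_fin mulr_ge0 ?powR_ge0.
- by rewrite lee_fin mulr_ge0 ?powR_ge0 ?sector_const_ge0.
rewrite [RHS]integral_mkcond; apply: eq_integral => t _.
rewrite /sector_kernel patchE.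
have -> : (t \in sector e x) = in_sector e (x, t) by rewrite /sector; apply: asboolb.
by case: ifP => //= _; rewrite -EFinM mulrC.
Qed.

(** After the exchange, the x-section at fixed t is x^(1/q) < e t^(-1/p'), over which x^(1/q - 1)
    integrates to at most q e t^(-1/p'). The weight t^(1/p') cancels exactly and the integral of f^p
    remains. *)
Lemma sector_kernel_int : \int[lam]_x \int[lam]_t (sector_kernel (x, t))%:E <=
  (q * a^-1 `^ (p - 1) * e `^ q * n `^ q)%:E.
Proof.
have ceq : (0 <= sector_const * e * q)%R.
  by rewrite mulr_ge0 ?(ltW q0)// mulr_ge0 ?(ltW e0)// sector_const_ge0.
rewrite (@halfline_tonelli R (fun z => (sector_kernel z)%:E)); last 2 first.
- by apply/measurable_EFinP; exact: measurable_sector_kernel.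
- by move=> z; rewrite lee_fin sector_kernel_ge0.
have mfp : measurable_fun setT (fun t => f t `^ p)%R.
  exact: measurableT_comp (measurable_powR _) mf.
apply: (@le_trans _ _ (\int[lam]_t ((sector_const * e * q)%:E * (f t `^ p)%:E))).
  apply: (ge0_le_integral lam measurableT).
  - by move=> t _; apply: integral_ge0 => x _; rewrite lee_fin sector_kernel_ge0.
  - apply: (@measurable_fun_fubini_tonelli_G _ _ _ _ _ (halfline_sf R)
      (fun z => (sector_kernel z)%:E)).
    + by apply/measurable_EFinP; exact: measurable_sector_kernel.
    + by move=> z; rewrite lee_fin sector_kernel_ge0.
  - by apply: emeasurable_funM; [exact: measurable_cst|apply/measurable_EFinP].
  move=> t _; have [t0|t0] := leP (t : R) 0%R.
    rewrite integral0_eq.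
      rewrite -EFinM lee_fin.
      by rewrite mulr_ge0 ?powR_ge0.
    by move=> x _; rewrite /sector_kernel /in_sector /= (ltNge 0%R (t : R)) t0 /= andbF.
  have ta0 : (0 < (t : R) `^ a)%R by rewrite powR_gt0.
  have De : (0 < e / (t : R) `^ a)%R by rewrite divr_gt0.
  pose S := [set x : R | (0 < x)%R /\ (x `^ c < e / (t : R) `^ a)%R].
  have mS : measurable (S : set (lebR R)).
    have := measurableT_comp (measurable_in_sector e) (measurable_pair2 (t : lebR R)).
    move=> /(_ measurableT [set true] I); rewrite setTI; congr measurable.
    apply/seteqP; split => x; rewrite /S /in_sector /= t0 ltr_pdivlMr// mulrC andbT.
      by case/andP.
    by case=> -> ->.
  rewrite (_ : \int[lam]_x _ = \int[lam]_(x in S)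
     ((f t `^ p * (t : R) `^ a * sector_const)%:E * ((x : R) `^ (c - 1))%:E)).
    rewrite (ge0_integralZl _ mS); last 3 first.
    - by apply/measurable_EFinP; exact: measurable_funTS.
    - by move=> x _; rewrite lee_fin powR_ge0.
    - by rewrite lee_fin !mulr_ge0 ?powR_ge0 ?sector_const_ge0.
    apply: le_trans.
      apply: lee_pmul; [| |exact: lexx|exact: (halfline_powR_lt c0 De)].
      - by rewrite lee_fin !mulr_ge0 ?powR_ge0 ?sector_const_ge0.
      - by apply: integral_ge0 => x _; rewrite lee_fin powR_ge0.
    rewrite -!EFinM lee_fin invrK le_eqVlt; apply/orP; left; apply/eqP.
    by field; rewrite ?gt_eqF.
  rewrite [RHS]integral_mkcond; apply: eq_integral => x _.
  rewrite /sector_kernel patchE.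
  have -> : (x \in S) = in_sector e (x, t).
    apply/idP/idP; rewrite inE /S /in_sector /= t0 ltr_pdivlMr// mulrC andbT.
      by case=> -> ->.
    by case/andP.
  by case: ifP => //= _; rewrite -EFinM !mulrA.
rewrite (ge0_integralZl _ measurableT); last 3 first.
- by apply/measurable_EFinP.
- by move=> t _; rewrite lee_fin powR_ge0.
- by rewrite lee_fin.
apply: le_trans.
  apply: lee_pmul; [| |exact: lexx|exact: fn].
  - by rewrite lee_fin.
  - by apply: integral_ge0 => t _; rewrite lee_fin powR_ge0.
rewrite -EFinM lee_fin /sector_const.
have -> : (n `^ q = n `^ (q - p) * n `^ p)%R by rewrite -powRD ?subrK// gt_eqF.
rewrite -[in leRHS](mulr_powRB1 (ltW e0) q0) le_eqVlt; apply/orP; left; apply/eqP.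
by ring.
Qed.

(** The sector alternative is meant for x near 0 and infinity, the second one for the range in
    between, which has length at most M. *)
Lemma hardy_bound (g : lebR R -> R) (M y : R) : (0 <= M)%R -> (0 <= y)%R ->
  measurable_fun setT g -> (forall x, (0 <= g x)%R) ->
  (\forall x \ae lam, (0 < (x : R))%R ->
     (g x)%:E <= sector_integral x \/ ((x : R) < M /\ g x <= y * n)%R) ->
  \int[lam]_x (g x `^ q)%:E <=
    ((q * a^-1 `^ (p - 1) * e `^ q + M * y `^ q) * n `^ q)%:E.
Proof.
move=> M0 y0 mg g0 hg.
pose B : set (lebR R) := [set x : R | (x < M)%R].
have mB : measurable B.
  by apply: borel_lebR; have := @measurable_itv R `]-oo, M[; congr measurable;
    apply/seteqP; split => x /=; rewrite in_itv.
have mk : measurable_fun [set: lebR R] (fun x => \int[lam]_t (sector_kernel (x, t))%:E).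
  apply: (@measurable_fun_fubini_tonelli_F _ _ _ _ _ (halfline_sf R)
    (fun z => (sector_kernel z)%:E)).
  - by apply/measurable_EFinP; exact: measurable_sector_kernel.
  - by move=> z; rewrite lee_fin sector_kernel_ge0.
have k0 x : 0 <= \int[lam]_t (sector_kernel (x, t))%:E.
  by apply: integral_ge0 => t _; rewrite lee_fin sector_kernel_ge0.
have mi : measurable_fun [set: lebR R] (fun x => ((y * n) `^ q * \1_B x)%:E).
  apply/measurable_EFinP; apply: measurable_funM; first exact: measurable_cst.
  exact: measurable_indic.
(* The two majorants are added instead of splitting the domain, so no measurability of the set where
   each alternative holds comes into question. *)
apply: (@le_trans _ _ (\int[lam]_x (\int[lam]_t (sector_kernel (x, t))%:E +
    ((y * n) `^ q * \1_B x)%:E))).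
  apply: (ae_ge0_le_integral measurableT).
  - by move=> x _; rewrite lee_fin powR_ge0.
  - by apply/measurable_EFinP; exact: measurableT_comp (measurable_powR _) mg.
  - by move=> x _; rewrite adde_ge0// lee_fin mulr_ge0 ?powR_ge0 ?indicE.
  - exact: emeasurable_funD.
  have hpos : \forall x \ae lam, (0 < (x : R))%R by apply: halfline_aeW.
  apply: filterS2 hpos hg => x x0 /(_ x0) hx _.
  have i0 : (0 <= (y * n) `^ q * \1_B x)%R by rewrite mulr_ge0 ?powR_ge0 ?indicE.
  case: hx => [gJ|[xM gy]].
    rewrite -[leLHS]adde0 leeD ?lee_fin// sector_kernelE//.
    apply: le_trans (sector_integral_pow x0); rewrite -poweR_EFin.
    apply: gt0_ler_poweR gJ; rewrite ?(ltW q0)// in_itv/= leey andbT ?lee_fin//.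
    by apply: integral_ge0 => t _; rewrite lee_fin.
  rewrite -[leLHS]add0e leeD// lee_fin indicE mem_set// mulr1.
  by rewrite ge0_ler_powR ?(ltW q0) ?nnegrE// mulr_ge0.
rewrite (ge0_integralD _ measurableT); last 4 first.
- by move=> x _; exact: k0.
- exact: mk.
- by move=> x _; rewrite lee_fin mulr_ge0 ?powR_ge0 ?indicE.
- exact: mi.
rewrite mulrDl EFinD leeD ?sector_kernel_int//.
under eq_integral do rewrite EFinM.
rewrite (ge0_integralZl _ measurableT); last 3 first.
- by apply/measurable_EFinP; exact: measurable_indic.
- by move=> x _; rewrite lee_fin indicE.
- by rewrite lee_fin powR_ge0.
rewrite integral_indic// setIT halfline_lt// -EFinM lee_fin powRM//.
by rewrite le_eqVlt; apply/orP; left; apply/eqP; ring.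
Qed.

End Bound.

End HardyInequality.

(** * Complex-valued integrals *)

Section ComplexIntegral.
Context d (T : measurableType d) (R : realType).
Variable m : {measure set T -> \bar R}.
Implicit Types (f g : T -> R[i]^o) (S : set T).

Lemma normc_ge0 (z : R[i]) : 0 <= normc z.
Proof. by case: z => x y; exact: sqrtr_ge0. Qed.

Lemma normc_le_abs (x y : R) : normc (Complex x y) <= `|x| + `|y|.
Proof.
rewrite -[leRHS]ger0_norm ?addr_ge0// -sqrtr_sqr; apply: ler_wsqrtr.
rewrite sqrrD !real_normK ?num_real// addrAC lerDl.
by rewrite mulrn_wge0// mulr_ge0.
Qed.

Lemma abs_Re_le (z : R[i]) : `|complex.Re z| <= normc z.
Proof.
by case: z => x y /=; rewrite -sqrtr_sqr; apply: ler_wsqrtr; rewrite lerDl sqr_ge0.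
Qed.

Lemma abs_Im_le (z : R[i]) : `|complex.Im z| <= normc z.
Proof.
by case: z => x y /=; rewrite -sqrtr_sqr; apply: ler_wsqrtr; rewrite lerDr sqr_ge0.
Qed.

Definition cint S f : R[i]^o :=
  Complex (\int[m]_(x in S) complex.Re (f x)) (\int[m]_(x in S) complex.Im (f x)).

Definition cintegrable S f :=
  m.-integrable S (fun x => (complex.Re (f x))%:E) /\
  m.-integrable S (fun x => (complex.Im (f x))%:E).

Lemma cintegrable_normc S f : measurable S -> measurable_cfun f ->
  (\int[m]_(x in S) (normc (f x))%:E < +oo)%E -> cintegrable S f.
Proof.
move=> mS mf foo; have [mR mI] := mf.
have inf : m.-integrable S (fun x => (normc (f x))%:E).
  apply/integrableP; split.
    apply/measurable_EFinP; apply: measurable_funTS; exact: measurable_normc.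
  apply: le_lt_trans foo.
  rewrite le_eqVlt; apply/orP; left; apply/eqP; apply: eq_integral => x _.
  by rewrite /= ger0_norm ?normc_ge0.
split.
  apply: (le_integrable mS _ _ inf) => [|x _].
    by apply/measurable_EFinP; exact: measurable_funTS.
  by rewrite lee_fin (ger0_norm (normc_ge0 _)) abs_Re_le.
apply: (le_integrable mS _ _ inf) => [|x _].
  by apply/measurable_EFinP; exact: measurable_funTS.
by rewrite lee_fin (ger0_norm (normc_ge0 _)) abs_Im_le.
Qed.

(** Real and imaginary parts are estimated separately, which costs the factor 2 carried through the
    later bounds. *)
Lemma cint_le S f : measurable S -> measurable_cfun f ->
  ((normc (cint S f))%:E <= 2%:E * \int[m]_(x in S) (normc (f x))%:E)%E.
Proof.
move=> mS mf; have [mR mI] := mf.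
have [Ioo|Ioo] := eqVneq (\int[m]_(x in S) (normc (f x))%:E)%E +oo%E.
  by rewrite Ioo gt0_muley ?leey// lte_fin.
have Ilt : (\int[m]_(x in S) (normc (f x))%:E < +oo)%E by rewrite ltey.
have [iR iI] := cintegrable_normc mS mf Ilt.
have mn : measurable_fun S (fun x => (normc (f x))%:E).
  by apply/measurable_EFinP; apply: measurable_funTS; exact: measurable_normc.
have h (g : T -> R) : measurable_fun setT g -> m.-integrable S (EFin \o g) ->
    (forall x, `|g x| <= normc (f x)) ->
    (`|\int[m]_(x in S) g x|%:E <= \int[m]_(x in S) (normc (f x))%:E)%E.
  move=> mg ig gf; rewrite EFin_normr_Rintegral//.
  apply: le_trans (le_abse_integral m mS _) _; first exact: (measurable_int m).
  apply: ge0_le_integral => //.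
  - by apply: measurableT_comp => //; exact: (measurable_int m).
  - by move=> x _; rewrite /= ?lee_fin.
apply: (@le_trans _ _ ((`|\int[m]_(x in S) complex.Re (f x)| +
   `|\int[m]_(x in S) complex.Im (f x)|)%:E)); first by rewrite lee_fin normc_le_abs.
rewrite EFinD -[2%R]/(1 + 1) EFinD ge0_muleDl ?lee_fin// mul1e.
apply: leeD; apply: h => //.
- by move=> x; exact: abs_Re_le.
- by move=> x; exact: abs_Im_le.
Qed.

Lemma cint_linear S (z : R[i]) f g : measurable S -> cintegrable S f ->
  cintegrable S g -> cint S (z *: f + g) = z * cint S f + cint S g.
Proof.
case: z => a b mS [fR fI] [gR gI]; rewrite /cint.
have iZ (k : R) (h : T -> R) : m.-integrable S (EFin \o h) ->
    m.-integrable S (EFin \o (fun x => k * h x)).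
  by move=> ih; exact: (integrableZl mS k ih).
have e1 : \int[m]_(x in S) complex.Re ((Complex a b *: f + g) x) =
  a * \int[m]_(x in S) complex.Re (f x) - b * \int[m]_(x in S) complex.Im (f x)
  + \int[m]_(x in S) complex.Re (g x).
  rewrite -!RintegralZl// -RintegralB//; [|exact: iZ..].
  rewrite -RintegralD//; last by exact: (integrableB mS (iZ _ _ fR) (iZ _ _ fI)).
  by apply: eq_Rintegral => x _; rewrite !fctE; case: (f x) (g x) => [? ?] [].
have e2 : \int[m]_(x in S) complex.Im ((Complex a b *: f + g) x) =
  a * \int[m]_(x in S) complex.Im (f x) + b * \int[m]_(x in S) complex.Re (f x)
  + \int[m]_(x in S) complex.Im (g x).
  rewrite -!RintegralZl// -RintegralD//; [|exact: iZ..].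
  rewrite -RintegralD//; last by exact: (integrableD mS (iZ _ _ fI) (iZ _ _ fR)).
  by apply: eq_Rintegral => x _; rewrite !fctE; case: (f x) (g x) => [? ?] [].
by rewrite e1 e2.
Qed.

Lemma cint_setD S S' f : measurable S -> measurable S' -> S' `<=` S ->
  cintegrable S f -> cint S f - cint S' f = cint (S `\` S') f.
Proof.
move=> mS mS' SS [fR fI].
have h (g : T -> R) : m.-integrable S (EFin \o g) ->
    \int[m]_(x in S) g x - \int[m]_(x in S') g x = \int[m]_(x in S `\` S') g x.
  move=> ig; have SE : S = S' `|` (S `\` S') by rewrite setDUK.
  rewrite {1}SE Rintegral_setU//.
  - by rewrite addrC addKr.
  - exact: measurableD.
  - by rewrite -SE.
  - by apply/disj_setPS => x [? []].
rewrite /cint -!h//.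
Qed.

Lemma ae_eq_cint S f g : measurable S -> measurable_cfun f -> measurable_cfun g ->
  (\forall x \ae m, f x = g x) -> cint S f = cint S g.
Proof.
move=> mS [fR fI] [gR gI] fg; rewrite /cint.
have h (u v : T -> R) : measurable_fun setT u -> measurable_fun setT v ->
    (\forall x \ae m, u x = v x) -> \int[m]_(x in S) u x = \int[m]_(x in S) v x.
  move=> mu_ mv uv; rewrite /Rintegral; congr fine; apply: ae_eq_integral => //.
  - by apply/measurable_EFinP; exact: measurable_funTS.
  - by apply/measurable_EFinP; exact: measurable_funTS.
  - by apply: filterS uv => x -> _.
by congr Complex; apply: h => //; apply: filterS fg => x ->.
Qed.

End ComplexIntegral.

(** * Integrals over initial intervals and the function H_b f *)

Section Below.
Context (R : realType).
Local Notation lam := (halfline_measure R).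
Local Open Scope ereal_scope.

(** Nonpositive [t] are left in: [halfline_measure] does not charge them, and the set stays an
    initial segment of the line. *)
Definition below (y : \bar R) : set (lebR R) := [set t : R | t%:E < y].

Lemma measurable_below y : measurable (below y).
Proof.
apply: borel_lebR; apply: is_interval_measurable => s t /= _ ty u /andP[_ ut].
by rewrite /below /=; apply: le_lt_trans ty; rewrite lee_fin.
Qed.

Lemma below_subset y z : y <= z -> below y `<=` below z.
Proof. by move=> yz t ty; exact: lt_le_trans yz. Qed.

Lemma halfline_below (r : R) : (0 <= r)%R -> lam (below r%:E) = r%:E.
Proof. by move=> r0; rewrite -[RHS](halfline_lt r0). Qed.

Lemma halfline_below_fin (y : \bar R) : y < +oo -> lam (below y) < +oo.
Proof.
case: y => [r _|//|_].
  have [r0|r0] := leP 0%R r; first by rewrite halfline_below ?ltry.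
  apply: (@le_lt_trans _ _ (lam (below 0%:E))); last by rewrite halfline_below ?ltry.
  apply: le_measure; rewrite ?inE; [exact: measurable_below..|].
  by apply: below_subset; rewrite lee_fin ltW.
by rewrite (_ : below -oo = set0) ?measure0// -subset0 => t; rewrite /below /= ltNge leNye.
Qed.

(** Passes from Lebesgue measure on (0, b(x)) to the half-line measure. The comparison of the two is
    made for nonnegative integrands, hence the splitting into positive and negative parts. *)
Lemma hardyE b (g : lebR R -> R) x : measurable_fun setT g ->
  hardy b (fun t => (g t)%:E) x = \int[lam]_(t in below (b x)) (g t)%:E.
Proof.
move=> mg; rewrite /hardy [LHS]integralE [RHS]integralE.
have m1 : measurable_fun (below (b x)) (fun t => (g t)%:E).
  by apply/measurable_EFinP; exact: measurable_funTS.
have e : [set t : R | (0 < t)%R /\ t%:E < b x] = below (b x) `&` @halfline R.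
  by apply/seteqP; split => t [].
rewrite !integral_halfline ?e//.
- exact: measurable_below.
- exact: measurable_funeneg.
- exact: measurable_below.
- exact: measurable_funepos.
Qed.

Lemma integral_halflineI (S : set (lebR R)) (g : lebR R -> \bar R) : measurable S ->
  measurable_fun S g -> (forall t, 0 <= g t) ->
  \int[lam]_(t in S) g t = \int[lam]_(t in S `&` @halfline R) g t.
Proof.
move=> mS mg g0.
have mSH : measurable (S `&` @halfline R).
  by apply: measurableI => //; exact: measurable_halfline.
have mg' : measurable_fun (S `&` @halfline R) g.
  exact: (measurable_funS mS (@subIsetl _ _ _) mg).
rewrite (integral_halfline mS mg (fun t _ => g0 t)).
by rewrite (integral_halfline mSH mg' (fun t _ => g0 t)) -setIA setIid.
Qed.

(** For a nonnegative integrand the integral is nonincreasing in x, as b is, hence measurable; a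
    signed [g] is treated through its two parts. For x <= 0, where [b] is unconstrained, the value 0
    is imposed. *)
Lemma measurable_below_integral (b : R -> \bar R) (g : lebR R -> R) : normal_form b ->
  measurable_fun setT g ->
  measurable_fun [set: lebR R] (fun x : lebR R =>
    if (0 < (x : R))%R then Rintegral lam (below (b x)) g else 0%R).
Proof.
move=> [_ bd] mg.
have mono (h : lebR R -> \bar R) : measurable_fun setT h -> (forall t, 0 <= h t) ->
    measurable_fun (@halfline R) (fun x : lebR R => \int[lam]_(t in below (b x)) h t).
  move=> mh h0; apply: (@nonincreasing_halfline_measurable R
    (fun x => \int[lam]_(t in below (b x)) h t)) => x y x0 xy.
  apply: ge0_subset_integral => //; [exact: measurable_below..| |].
    exact: measurable_funTS.
  by apply: below_subset; exact: bd.
have mgE : measurable_fun [set: lebR R] (EFin \o g) by apply/measurable_EFinP.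
have m1 : measurable_fun (@halfline R) (fun x : lebR R => Rintegral lam (below (b x)) g).
  rewrite /Rintegral; apply: measurableT_comp; first exact: fine_measurable.
  under eq_fun do rewrite integralE.
  apply: emeasurable_funB.
  - by apply: mono; [exact: (measurable_funepos mgE)|].
  - by apply: mono; [exact: (measurable_funeneg mgE)|].
have := (measurable_restrictT _ (@measurable_halfline R)).1 m1.
congr measurable_fun; apply/funext => x; rewrite patchE.
by have -> : (x \in @halfline R) = (0 < (x : R))%R by apply: asboolb.
Qed.

Definition hardy_cfun (b : R -> \bar R) (f : lebR R -> R[i]^o) (x : lebR R) : R[i]^o :=
  if (0 < (x : R))%R then cint lam (below (b x)) f else 0%R.

Lemma measurable_hardy_cfun b f : normal_form b -> measurable_cfun f ->
  measurable_cfun (hardy_cfun b f).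
Proof.
move=> nb [fR fI]; split.
  have := measurable_below_integral nb fR; congr measurable_fun; apply/funext => x.
  by rewrite /hardy_cfun; case: ifP.
have := measurable_below_integral nb fI; congr measurable_fun; apply/funext => x.
by rewrite /hardy_cfun; case: ifP.
Qed.

End Below.

Section HardyBound.
Context (R : realType) (p p' q : R).
Hypotheses (hp : 1 < p) (hpq : p <= q) (hp' : p^-1 + p'^-1 = 1).
Local Notation lam := (halfline_measure R).
Local Notation a := (p'^-1).
Local Notation c := (q^-1).
Local Open Scope ereal_scope.

Let p0 : (0 < p)%R. Proof. exact: lt_trans hp. Qed.
Let q0 : (0 < q)%R. Proof. exact: lt_le_trans hpq. Qed.
Let p'0 : (0 < p')%R := conjugate_gt0 hp hp'.
Let a0 : (0 < a)%R. Proof. by rewrite invr_gt0. Qed.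

Lemma cLnorm_int (r : R) (f : lebR R -> R[i]^o) : (0 < r)%R -> f \in cLfun lam r ->
  \int[lam]_t (normc (f t) `^ r)%:E = (fine (cLnorm lam r f) `^ r)%:E.
Proof.
move=> r0; rewrite inE => -[mf fy].
rewrite -poweR_EFin fineK; last by rewrite ge0_fin_numE ?Lnorm_ge0.
rewrite /cLnorm powR_Lnorm; last exact: lt0r_neq0.
by apply: eq_integral => t _; rewrite /= ger0_norm ?normc_ge0.
Qed.

Lemma cLnorm_le_int (r K : R) (g : lebR R -> R[i]^o) : (0 < r)%R -> (0 <= K)%R ->
  \int[lam]_t (normc (g t) `^ r)%:E <= (K `^ r)%:E -> cLnorm lam r g <= K%:E.
Proof.
move=> r0 K0 h; have rN0 := lt0r_neq0 r0.
have rK (x : \bar R) : 0 <= x -> (x `^ r) `^ r^-1 = x.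
  by move=> x0; rewrite -poweRrM mulfV// poweRe1.
rewrite -[leLHS]rK ?Lnorm_ge0// -[leRHS]rK ?lee_fin// poweR_EFin /cLnorm.
rewrite powR_Lnorm; last exact: rN0.
apply: gt0_ler_poweR; first by rewrite invr_ge0 ltW.
- by rewrite in_itv/= leey andbT; apply: integral_ge0 => t _; rewrite lee_fin powR_ge0.
- by rewrite in_itv/= leey andbT lee_fin powR_ge0.
apply: le_trans h; rewrite le_eqVlt; apply/orP; left; apply/eqP.
by apply: eq_integral => t _; rewrite /= ger0_norm ?normc_ge0.
Qed.

(** The q-th root of the constant in [hardy_bound], doubled because of [cint_le]. The first summand
    involves e but neither M nor y, so e can be fixed before them. *)
Definition hardy_gain (e M y : R) : R :=
  (2 * (q * a^-1 `^ (p - 1) * e `^ q + M * y `^ q) `^ c)%R.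

Lemma hardy_gain_ge0 e M y : (0 <= hardy_gain e M y)%R.
Proof. by rewrite mulr_ge0// powR_ge0. Qed.

Lemma hardy_cbound (f g : lebR R -> R[i]^o) (e M y : R) : f \in cLfun lam p ->
  measurable_cfun g -> (0 < e)%R -> (0 <= M)%R -> (0 <= y)%R ->
  (\forall x \ae lam, (0 < (x : R))%R ->
     (normc (g x))%:E <= 2%:E * sector_integral p' q (fun t => normc (f t)) e x \/
     ((x : R) < M /\ normc (g x) <= 2 * (y * fine (cLnorm lam p f)))%R) ->
  cLnorm lam q g <= (hardy_gain e M y * fine (cLnorm lam p f))%:E.
Proof.
move=> fP mg e0 M0 y0 h; have [mf fy] := set_mem fP.
set n := fine (cLnorm lam p f) in h *.
have n0 : (0 <= n)%R by rewrite fine_ge0// Lnorm_ge0.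
have mnf := measurable_normc mf.
have fn : \int[lam]_t (normc (f t) `^ p)%:E <= (n `^ p)%:E by rewrite cLnorm_int.
(* Halving absorbs the factor 2 in both alternatives. *)
pose g2 (x : lebR R) := (2^-1 * normc (g x))%R.
have mg2 : measurable_fun setT g2.
  by apply: measurable_funM; [exact: measurable_cst|exact: measurable_normc].
have g20 x : (0 <= g2 x)%R by rewrite mulr_ge0 ?invr_ge0// normc_ge0.
have := hardy_bound hp hpq hp' mnf (fun t => normc_ge0 _) n0 e0 fn M0 y0 mg2 g20.
have nK : (0 <= hardy_gain e M y * n)%R by rewrite mulr_ge0 ?hardy_gain_ge0.
move=> hb; apply: cLnorm_le_int => //.
have -> : \int[lam]_t (normc (g t) `^ q)%:E = (2 `^ q)%:E * \int[lam]_t (g2 t `^ q)%:E.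
  rewrite -(ge0_integralZl lam measurableT).
  - apply: eq_integral => t _; rewrite -EFinM -powRM// /g2 ?mulr_ge0 ?normc_ge0//.
    by rewrite mulrA mulfV// mul1r.
  - by apply/measurable_EFinP; exact: measurableT_comp (measurable_powR _) mg2.
  - by move=> t _; rewrite lee_fin powR_ge0.
  - by rewrite lee_fin powR_ge0.
have C0 : (0 <= q * a^-1 `^ (p - 1) * e `^ q + M * y `^ q)%R.
  by rewrite addr_ge0// !mulr_ge0 ?powR_ge0// ltW.
have -> : ((hardy_gain e M y * n) `^ q)%:E =
    (2 `^ q)%:E * ((q * a^-1 `^ (p - 1) * e `^ q + M * y `^ q) * n `^ q)%:E.
  rewrite -EFinM /hardy_gain powRM ?mulr_ge0 ?powR_ge0// powRM ?powR_ge0//.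
  by rewrite -[((_ `^ c) `^ q)%R]powRrM mulVf ?gt_eqF// (powRr1 C0) mulrA.
apply: lee_pmul => //.
  by apply: integral_ge0 => t _; rewrite lee_fin powR_ge0.
apply: hb; apply: filterS h => x h x0; case: (h x0) => [gJ|[xM gy]]; [left|right].
  rewrite /g2 EFinM lee_pdivrMl//.
split => //; rewrite /g2 mulrC ler_pdivrMr// mulrC//.
Qed.

Lemma cint_bound (f : lebR R -> R[i]^o) S : f \in cLfun lam p -> measurable S ->
  \int[lam]_(t in S) (normc (f t))%:E <= (fine (cLnorm lam p f))%:E * lam S `^ a.
Proof.
move=> fP mS; have [mf _] := set_mem fP.
have n0 : (0 <= fine (cLnorm lam p f))%R by rewrite fine_ge0// Lnorm_ge0.
have fn : \int[lam]_t (normc (f t) `^ p)%:E <= (fine (cLnorm lam p f) `^ p)%:E.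
  by rewrite cLnorm_int.
exact: (halfline_hoelder hp hp' (measurable_normc mf) (fun t => normc_ge0 _) n0 fn mS).
Qed.

Lemma cLfun_cintegrable (f : lebR R -> R[i]^o) S : f \in cLfun lam p ->
  measurable S -> lam S < +oo -> cintegrable lam S f.
Proof.
move=> fP mS Soo; have [mf _] := set_mem fP.
apply: cintegrable_normc => //; apply: le_lt_trans (cint_bound fP mS) _.
by apply: lte_mul_pinfty; rewrite ?lee_fin ?fine_ge0 ?Lnorm_ge0// poweR_lty.
Qed.

(** The domain of integration [S x] is left free: it is [below (b x)] for H_b, and a difference of
    two such sets for the difference of two operators. *)
Lemma cint_family_bound (f g : lebR R -> R[i]^o) (S : R -> set (lebR R)) (e M r : R) :
  f \in cLfun lam p -> measurable_cfun g -> (0 < e)%R -> (0 <= M)%R -> (0 <= r)%R ->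
  (forall x, measurable (S x)) ->
  (forall x : R, (0 < x)%R -> g x = cint lam (S x) f) ->
  (\forall x \ae lam, (0 < (x : R))%R -> S x `&` @halfline R `<=` sector p' q e x \/
      ((x : R) < M)%R /\ lam (S x) <= r%:E) ->
  cLnorm lam q g <= (hardy_gain e M (r `^ a) * fine (cLnorm lam p f))%:E.
Proof.
move=> fP mg e0 M0 r0 mS gE h; have [mf _] := set_mem fP.
apply: hardy_cbound => //; first exact: powR_ge0.
apply: filterS h => x h x0; have mnf := measurable_normc mf.
rewrite gE//; have le2 := cint_le lam (mS x) mf.
case: (h x0) => [Ssec|[xM Sr]]; [left|right].
  apply: (le_trans le2); apply: lee_pmul => //.
    by apply: integral_ge0 => t _; rewrite lee_fin normc_ge0.
  have mE A : measurable_fun A (fun t => (normc (f t))%:E).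
    by apply/measurable_EFinP; exact: measurable_funTS.
  have E0 t : 0 <= (normc (f t))%:E by rewrite lee_fin normc_ge0.
  rewrite (integral_halflineI (mS x) (mE _) E0).
  have mSH := measurableI _ _ (mS x) (@measurable_halfline R).
  exact: (ge0_subset_integral lam mSH (measurable_sector p' q e x) (mE _)
    (fun t _ => E0 t) Ssec).
split => //; rewrite -lee_fin; apply: (le_trans le2).
rewrite [leRHS]EFinM; apply: lee_pmul => //.
  by apply: integral_ge0 => t _; rewrite lee_fin normc_ge0.
apply: (le_trans (cint_bound fP (mS x))).
rewrite mulrC EFinM; apply: lee_pmul => //; rewrite ?poweR_ge0//.
  by rewrite lee_fin fine_ge0// Lnorm_ge0.
rewrite -poweR_EFin; apply: gt0_ler_poweR => //; first exact: ltW.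
- by rewrite in_itv/= leey andbT measure_ge0.
- by rewrite in_itv/= leey andbT lee_fin.
Qed.

Lemma below_sector (y : \bar R) (e x : R) : 0 <= y -> (0 < x)%R ->
  y `^ a * (x `^ c)%:E < e%:E -> below y `&` @halfline R `<=` sector p' q e x.
Proof.
move=> y0 x0 ye t [ty t0]; rewrite /sector /in_sector /= x0 /=.
rewrite (_ : (0 < (t : R))%R)//= -lte_fin EFinM; apply: le_lt_trans ye.
apply: lee_pmul; rewrite ?lee_fin ?powR_ge0// -poweR_EFin.
apply: gt0_ler_poweR; rewrite ?(ltW a0)// ?in_itv/= ?leey ?andbT ?lee_fin//.
- exact: ltW.
- exact: (ltW ty).
Qed.

End HardyBound.

(** * Operators between Lebesgue spaces *)

Section LpClasses.
Context (R : realType) (p : R) (p1 : 1 <= p).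
Local Notation lam := (halfline_measure R).
Implicit Types F G : Lp p1.

Lemma Lp_fun_cLfun F : Lp_fun F \in cLfun lam p.
Proof. exact: cLfun_valP. Qed.

Lemma Lp_fun_measurable F : measurable_cfun (Lp_fun F).
Proof. by have [] := set_mem (Lp_fun_cLfun F). Qed.

Definition Lp_class (f : lebR R -> R[i]^o) (fP : f \in cLfun lam p) : Lp p1 :=
  (\pi_(Lp p1) (CLfun p1 fP))%qT.

Lemma Lp_classE f (fP : f \in cLfun lam p) :
  \forall x \ae lam, Lp_fun (Lp_class fP) x = f x.
Proof. exact: (repr_cLspace (CLfun p1 fP)). Qed.

Lemma Lp_ext F G : (\forall x \ae lam, Lp_fun F x = Lp_fun G x) -> F = G.
Proof.
by move=> FG; rewrite -[F]reprK -[G]reprK; apply/eqP/cLspaceP.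
Qed.

Lemma Lp_funZD (z : R[i]) F G :
  \forall x \ae lam, Lp_fun (z *: F + G) x = z * Lp_fun F x + Lp_fun G x.
Proof.
have -> : z *: F + G = (\pi_(Lp p1) (z *: repr F + repr G))%qT.
  by rewrite -[F in LHS]reprK -[G in LHS]reprK cLspace_scaleE cLspace_addE.
exact: (repr_cLspace (z *: (repr F : cLfunType lam p1) + repr G)).
Qed.

Lemma Lp_funB F G :
  \forall x \ae lam, Lp_fun (F - G) x = Lp_fun F x - Lp_fun G x.
Proof.
rewrite addrC -scaleN1r; apply: filterS (Lp_funZD (-1) G F) => x ->.
by rewrite mulN1r addrC.
Qed.

Definition Lp_norm F : R := fine (cLnorm lam p (Lp_fun F)).

Lemma Lp_norm_ge0 F : 0 <= Lp_norm F.
Proof. by rewrite fine_ge0// Lnorm_ge0. Qed.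

Lemma EFin_Lp_norm F : (Lp_norm F)%:E = cLnorm lam p (Lp_fun F).
Proof.
have [_ fy] := set_mem (Lp_fun_cLfun F).
by rewrite fineK// ge0_fin_numE ?Lnorm_ge0.
Qed.

Lemma normLp F : `|F| = (Lp_norm F)%:C%C.
Proof. by []. Qed.

Lemma Lp_norm_le F (k : R) : (`|F| <= k%:C%C) = (Lp_norm F <= k).
Proof. by rewrite normLp lecR. Qed.

Lemma Lp_norm_class f (fP : f \in cLfun lam p) :
  (Lp_norm (Lp_class fP))%:E = cLnorm lam p f.
Proof.
rewrite EFin_Lp_norm; apply: (ae_eq_cLnorm p).
- exact: Lp_fun_measurable.
- by have [] := set_mem fP.
- exact: Lp_classE.
Qed.

Lemma Lp_norm_leW F (k : R) (g : lebR R -> R[i]^o) : measurable_cfun g ->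
  (\forall x \ae lam, Lp_fun F x = g x) -> (cLnorm lam p g <= k%:E)%E -> Lp_norm F <= k.
Proof.
move=> mg Fg; rewrite -lee_fin EFin_Lp_norm.
by rewrite (ae_eq_cLnorm p (Lp_fun_measurable F) mg Fg).
Qed.

End LpClasses.

Section Opnorm.
Context (R : realType) (p q : R) (p1 : 1 <= p) (q1 : 1 <= q).
Local Notation lam := (halfline_measure R).

Lemma opnorm_le (A : Lp p1 -> Lp q1) (K : R) : 0 <= K ->
  (forall F, Lp_norm (A F) <= K * Lp_norm F) -> (opnorm A <= K%:E)%E.
Proof.
move=> K0 h; apply: ge_ereal_sup => _ [F F1 <-].
change ((Lp_norm (A F))%:E <= K%:E)%E; rewrite lee_fin.
apply: (le_trans (h F)); rewrite ler_piMr// -Lp_norm_le.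
exact: F1.
Qed.

Lemma le_opnorm (A : Lp p1 -> Lp q1) F : Lp_norm F <= 1 ->
  ((Lp_norm (A F))%:E <= opnorm A)%E.
Proof.
by move=> F1; apply: ereal_sup_ubound; exists F => //=; rewrite Lp_norm_le.
Qed.

(** Inputs equal almost everywhere must have identical images, which holds for integral operators;
    linearity then only has to be checked on functions, not on classes. *)
Lemma linear_lift (T : (lebR R -> R[i]^o) -> lebR R -> R[i]^o) :
  (forall f, f \in cLfun lam p -> T f \in cLfun lam q) ->
  (forall f g, f \in cLfun lam p -> g \in cLfun lam p ->
     (\forall x \ae lam, f x = g x) -> T f = T g) ->
  (forall z f g, f \in cLfun lam p -> g \in cLfun lam p ->
     T (z *: f + g) = z *: T f + T g) ->
  exists H : {linear Lp p1 -> Lp q1},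
    forall F, \forall x \ae lam, Lp_fun (H F) x = T (Lp_fun F) x.
Proof.
move=> TL Tae Tlin.
pose H0 (F : Lp p1) : Lp q1 := Lp_class q1 (TL _ (Lp_fun_cLfun F)).
have H0E F : \forall x \ae lam, Lp_fun (H0 F) x = T (Lp_fun F) x.
  exact: Lp_classE.
have H0lin : linear H0.
  move=> z F G; apply: Lp_ext.
  have fg : z *: Lp_fun F + Lp_fun G \in cLfun lam p.
    have [_ hc] := cLfun_submod_closed lam p1.
    by apply: hc; exact: Lp_fun_cLfun.
  have TE := Tae _ _ (Lp_fun_cLfun (z *: F + G)) fg (Lp_funZD z F G).
  have h1 := H0E (z *: F + G).
  have h2 := Lp_funZD z (H0 F) (H0 G).
  have h3 := H0E F; have h4 := H0E G.
  rewrite TE Tlin ?Lp_fun_cLfun// in h1.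
  apply: filterS2 h1 (filterI h2 (filterI h3 h4)) => x -> [-> [-> ->]].
  by rewrite fctE.
pose HL := GRing.isLinear.Build R[i] (Lp p1) (Lp q1) *:%R H0 H0lin.
pose H : {linear Lp p1 -> Lp q1} := HB.pack H0 HL.
by exists H.
Qed.

End Opnorm.

Section HardyOperators.
Context (R : realType) (p p' q : R).
Hypotheses (hp : 1 < p) (hpq : p <= q) (hp' : p^-1 + p'^-1 = 1).
Context (p1 : 1 <= p) (q1 : 1 <= q).
Local Notation lam := (halfline_measure R).
Local Notation a := (p'^-1).
Local Notation c := (q^-1).
Implicit Types b : R -> \bar R.

Let p'0 : 0 < p' := conjugate_gt0 hp hp'.
Let a0 : 0 < a. Proof. by rewrite invr_gt0. Qed.

(** Condition (iv) with explicit thresholds; see [vanishingP]. *)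
Definition vanishing b := forall e : R, 0 < e -> exists d M : R,
  [/\ 0 < d, 0 < M & forall x, 0 < x -> x < d \/ M <= x ->
    (b x `^ a * (x `^ c)%:E < e%:E)%E].

(** If b were infinite at x, it would be infinite at every smaller point, in particular at one below
    [d], where the product of (iv) is less than 1. *)
Lemma vanishing_fin b x : normal_form b -> vanishing b -> 0 < x -> b x \is a fin_num.
Proof.
move=> [b0 bd] /(_ 1 ltr01)[d [M [d0 M0 h]]] x0.
rewrite ge0_fin_numE ?b0//.
have d20 : 0 < d / 2 by rewrite divr_gt0.
have y0 : 0 < Num.min x (d / 2) by rewrite lt_min x0 d20.
apply: (@le_lt_trans _ _ (b (Num.min x (d / 2)))).
  by apply: bd => //; rewrite ge_min lexx.
have yd : Num.min x (d / 2) < d.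
  by rewrite gt_min; apply/orP; right; rewrite ltr_pdivrMr// ltr_pMr// ltr1n.
have := h _ y0 (or_introl yd).
case: (b _) (b0 _ y0) => [r _ _|_|//]; first exact: ltry.
by rewrite poweRyr ?gt_eqF// gt0_mulye// lte_fin powR_gt0.
Qed.

(** Outside [d, M) the first alternative is (iv); inside, monotonicity bounds b by the finite value
    b(d). *)
Lemma vanishing_dom b e : normal_form b -> vanishing b -> 0 < e ->
  exists M r : R, [/\ 0 < M, 0 <= r & forall x, 0 < x ->
    (b x `^ a * (x `^ c)%:E < e%:E)%E \/ x < M /\ (b x <= r%:E)%E].
Proof.
move=> nb vb e0; have [b0 bd] := nb; have [d [M [d0 M0 h]]] := vb e e0.
exists M, (fine (b d)); split => //; first by rewrite fine_ge0// b0.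
move=> x x0; have [xd|dx] := ltP x d; first by left; apply: h => //; left.
have [Mx|xM] := leP M x; first by left; apply: h => //; right.
by right; split => //; rewrite fineK ?(vanishing_fin nb)//; exact: bd.
Qed.

(** The single value e = 1 in (iv) already yields boundedness. *)
Lemma hardy_cfun_bounded b : normal_form b -> vanishing b ->
  exists2 K : R, 0 <= K & forall f, f \in cLfun lam p ->
    (cLnorm lam q (hardy_cfun b f) <= (K * fine (cLnorm lam p f))%:E)%E.
Proof.
move=> nb vb; have [b0 _] := nb.
have [M [r [M0 r0 h]]] := vanishing_dom nb vb ltr01.
exists (hardy_gain p p' q 1 M (r `^ a)); first exact: hardy_gain_ge0.
move=> g gP; have [mg _] := set_mem gP.
apply: (cint_family_bound hp hpq hp' (S := fun x => below (b x)) gP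
  (measurable_hardy_cfun nb mg) ltr01 (ltW M0) r0).
- by move=> x; exact: measurable_below.
- by move=> x x0; rewrite /hardy_cfun x0.
apply: halfline_aeW => x x0 _; have [hx|[xM br]] := h x x0; [left|right].
  by apply: (below_sector hp hp') => //; exact: b0.
split => //; rewrite -(halfline_below r0); apply: le_measure; rewrite ?inE.
- exact: measurable_below.
- exact: measurable_below.
- exact: below_subset.
Qed.

Lemma cintegrable_below b f x : normal_form b -> vanishing b -> f \in cLfun lam p ->
  0 < x -> cintegrable lam (below (b x)) f.
Proof.
move=> nb vb fP x0; apply: (cLfun_cintegrable hp hp' fP (measurable_below _)).
by apply: halfline_below_fin; rewrite ltey_eq (vanishing_fin nb vb x0).
Qed.

(** Besides [hardy_operator], whose formula concerns nonnegative classes, the formula is recorded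
    for every complex class: finite rank and the comparison of two operators rest on it. *)
Lemma hardy_operator_exists b : normal_form b -> vanishing b ->
  exists2 H : {linear Lp p1 -> Lp q1}, hardy_operator b H &
    forall F, \forall x \ae lam, Lp_fun (H F) x = hardy_cfun b (Lp_fun F) x.
Proof.
move=> nb vb.
have [K K0 hK] := hardy_cfun_bounded nb vb.
have [H HE] : exists H : {linear Lp p1 -> Lp q1},
    forall F, \forall x \ae lam, Lp_fun (H F) x = hardy_cfun b (Lp_fun F) x.
  apply: linear_lift.
  - move=> f fP; have [mf fy] := set_mem fP; rewrite inE; split.
      exact: measurable_hardy_cfun.
    exact: le_lt_trans (hK f fP) (ltry _).
  - move=> f g fP gP fg; apply/funext => x; rewrite /hardy_cfun; case: ifP => // _.
    have [mf _] := set_mem fP; have [mg _] := set_mem gP.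
    exact: (ae_eq_cint (measurable_below _) mf mg fg).
  - move=> z f g fP gP; apply/funext => x; rewrite !fctE /hardy_cfun; case: ifP => [x0|_].
      by apply: cint_linear; [exact: measurable_below|exact: cintegrable_below..].
    by rewrite scaler0 addr0.
exists H => //; split.
  apply: (@le_lt_trans _ _ K%:E); last exact: ltry.
  apply: (opnorm_le K0) => F; apply: (Lp_norm_leW _ (HE F)).
    exact: (measurable_hardy_cfun nb (Lp_fun_measurable F)).
  exact: hK (Lp_fun_cLfun F).
move=> F F0; have hpos : \forall x \ae lam, 0 < (x : R) by apply: halfline_aeW.
apply: filterS2 hpos (HE F) => x x0 ->; rewrite /hardy_cfun x0.
have [mR mI] := Lp_fun_measurable F.
have [iR iI] := cintegrable_below nb vb (Lp_fun_cLfun F) x0.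
rewrite (hardyE _ _ mR); split.
  by rewrite /= /Rintegral fineK//; exact: (integrable_fin_num (measurable_below _) iR).
rewrite /= /Rintegral.
suff -> : (\int[lam]_(t in below (b x)) (complex.Im (Lp_fun F t))%:E = 0)%E by [].
rewrite -[RHS](integral0 lam (below (b x))); apply: ae_eq_integral.
- exact: measurable_below.
- by apply/measurable_EFinP; exact: measurable_funTS.
- exact: measurable_cst.
- by apply: filterS F0 => t; rewrite lecE => /andP[/eqP -> _] _.
Qed.

Lemma Lp_norm_distC (F G : Lp q1) : Lp_norm (F - G) = Lp_norm (G - F).
Proof. by apply: complexI; rewrite -!normLp distrC. Qed.

(** The difference is an integral over b'(x) <= t < b(x). This set lies below b(x), so the sector
    condition is asked of b alone; its measure b(x) - b'(x) has to be small only in the middle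
    range. *)
Lemma hardy_operator_diff b b' (H H' : Lp p1 -> Lp q1) (e M r : R) :
  normal_form b -> vanishing b -> normal_form b' -> vanishing b' ->
  (forall F, \forall x \ae lam, Lp_fun (H F) x = hardy_cfun b (Lp_fun F) x) ->
  (forall F, \forall x \ae lam, Lp_fun (H' F) x = hardy_cfun b' (Lp_fun F) x) ->
  (forall x, 0 < x -> (b' x <= b x)%E) -> 0 < e -> 0 <= M -> 0 <= r ->
  (\forall x \ae lam, 0 < (x : R) -> (b x `^ a * (x `^ c)%:E < e%:E)%E \/
     (x : R) < M /\ (b x <= b' x + r%:E)%E) ->
  (opnorm (fun F => (H' F - H F)%R) <= (hardy_gain p p' q e M (r `^ a))%:E)%E.
Proof.
move=> nb vb nb' vb' HE H'E b'b e0 M0 r0 h.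
have [b0 _] := nb; have [b'0 _] := nb'.
apply: opnorm_le; first exact: hardy_gain_ge0.
move=> F; rewrite Lp_norm_distC.
have mT := measurable_hardy_cfun nb (Lp_fun_measurable F).
have mT' := measurable_hardy_cfun nb' (Lp_fun_measurable F).
pose g := hardy_cfun b (Lp_fun F) + (-1) *: hardy_cfun b' (Lp_fun F).
have mg : measurable_cfun g by apply: (measurable_cfunD mT); exact: measurable_cfunZ.
apply: (Lp_norm_leW mg).
  apply: filterS2 (Lp_funB (H F) (H' F)) (filterI (HE F) (H'E F)) => x -> [-> ->].
  by rewrite /g !fctE scaleN1r.
apply: (cint_family_bound hp hpq hp' (S := fun x => below (b x) `\` below (b' x))
  (Lp_fun_cLfun F) mg e0 M0 r0).
- by move=> x; apply: measurableD; exact: measurable_below.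
- move=> x x0; rewrite /g !fctE scaleN1r /hardy_cfun x0; apply: cint_setD.
  + exact: measurable_below.
  + exact: measurable_below.
  + by apply: below_subset; exact: b'b.
  + by apply: cintegrable_below => //; exact: Lp_fun_cLfun.
apply: filterS h => x h x0; case: (h x0) => [hx|[xM br]]; [left|right].
  move=> t [[tb _] t0]; apply: (below_sector hp hp' _ x0 hx); last by split.
  exact: b0.
split => //; move: (b'b x x0) br (b0 x x0) (b'0 x x0).
have := vanishing_fin nb vb x0; have := vanishing_fin nb' vb' x0.
case: (b x) (b' x) => [y| |] [y'| |]// _ _; rewrite !lee_fin => y'y yr y0 y'0.
have mD := @measureD _ _ _ lam _ _ (measurable_below y%:E) (measurable_below y'%:E).
rewrite [leLHS]mD; last by apply: halfline_below_fin; exact: ltry.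
rewrite setIidr; last by apply: below_subset; rewrite lee_fin.
apply: (@le_trans _ _ (y%:E - y'%:E)%E); last by rewrite -EFinB lee_fin lerBlDl.
rewrite le_eqVlt; apply/orP; left; apply/eqP.
by congr (_ - _)%E; exact: halfline_below.
Qed.

End HardyOperators.

(** * Step parameters *)

Section CountBelow.
Context (R : realType).

(** The induction carries the bounds by r and by N together: when N + 1 < r, the new unit is
    absorbed by the bound by N. *)
Lemma count_lt_le (r : R) (N : nat) : 0 <= r ->
  (\sum_(1 <= k < N.+1) ((k%:R < r)%R : nat))%N%:R <= r.
Proof.
move=> r0; suff : (\sum_(1 <= k < N.+1) ((k%:R < r)%R : nat))%N%:R <= Num.min r N%:R.
  by rewrite le_min => /andP[].
elim: N => [|N IHN]; first by rewrite big_nil le_min r0 lexx.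
rewrite big_nat_recr//= natrD; move: IHN; rewrite !le_min => /andP[h1 h2].
case: ltP => [Nr|rN] /=.
  have e : N.+1%:R = N%:R + 1 :> R by rewrite -natr1.
  by apply/andP; split; lra.
have e : N.+1%:R = N%:R + 1 :> R by rewrite -natr1.
by apply/andP; split; lra.
Qed.

(** The count is at least min(r - 1, N), a form that is stable under passing from N to N + 1. *)
Lemma count_lt_ge (r : R) (N : nat) : r <= N%:R ->
  r <= (\sum_(1 <= k < N.+1) ((k%:R < r)%R : nat))%N%:R + 1.
Proof.
move=> rN; suff : Num.min (r - 1) N%:R <= (\sum_(1 <= k < N.+1) ((k%:R < r)%R : nat))%N%:R.
  by rewrite ge_min => /orP[]; lra.
elim: N {rN} => [|N IHN]; first by rewrite big_nil ge_min lexx orbT.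
rewrite big_nat_recr//= natrD; move: IHN; rewrite !ge_min.
have e : N.+1%:R = N%:R + 1 :> R by rewrite -natr1.
case: ltP => [Nr|rN] /= /orP[h|h].
- by apply/orP; right; lra.
- by apply/orP; right; lra.
- by apply/orP; left; lra.
- by apply/orP; left; lra.
Qed.

End CountBelow.

Section StepParameter.
Context (R : realType) (b : R -> \bar R).
Hypothesis nb : normal_form b.
Local Notation lam := (halfline_measure R).

(** Counting steps in the naturals makes the finitely many values of b_n explicit: they are 2^-n j
    with j <= n 2^n. *)
Definition step_level (n : nat) (x : R) : nat :=
  (\sum_(1 <= k < (n * 2 ^ n).+1) `[< (x%:E < ginv b (k%:R / 2 ^+ n)%R)%E >])%N.

Lemma step_parameterE n x : 0 < x ->
  step_parameter b n x = (2 ^- n * (step_level n x)%:R)%:E.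
Proof.
move=> x0; rewrite /step_parameter /step_level natr_sum; congr (_ * _)%:E.
apply: eq_bigr => k _; rewrite indicE; congr (nat_of_bool _)%:R.
by apply/idP/asboolP; rewrite inE; [case|split].
Qed.

Lemma lt_ginv (t x : R) : 0 < x -> (x%:E < ginv b t)%E -> (t%:E < b x)%E.
Proof.
move=> x0; rewrite /ginv lt_max => /orP[|].
  by rewrite lte_fin => /(lt_trans x0); rewrite ltxx.
move=> /ereal_sup_gt[_ [y [y0 ty] <-]]; rewrite lte_fin => xy.
by apply: (lt_le_trans ty); apply: nb.2 => //; exact: ltW.
Qed.

Lemma le_ginv (t x : R) : 0 < x -> (t%:E < b x)%E -> (x%:E <= ginv b t)%E.
Proof.
move=> x0 tx; rewrite /ginv le_max; apply/orP; right.
by apply: ereal_sup_ubound; exists x.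
Qed.

Lemma step_level_le n x : 0 < x -> (step_level n x <= n * 2 ^ n)%N.
Proof.
move=> x0; rewrite /step_level.
apply: (@leq_trans (\sum_(1 <= k < (n * 2 ^ n).+1) 1)%N).
  by apply: leq_sum => k _; case: asboolP.
by rewrite sum_nat_const_nat muln1 subn1.
Qed.

Lemma step_parameter_normal n : normal_form (step_parameter b n).
Proof.
split=> [x x0|x y x0 xy].
  by rewrite step_parameterE// lee_fin mulr_ge0// invr_ge0 exprn_ge0.
have y0 := lt_le_trans x0 xy.
rewrite !step_parameterE// lee_fin ler_wpM2l ?invr_ge0 ?exprn_ge0// ler_nat.
apply: leq_sum => k _; case: (asboolP (y%:E < _)%E) => // yc.
by rewrite asboolT//; apply: le_lt_trans yc; rewrite lee_fin.
Qed.

Let pow2 n : 0 < 2 ^+ n :> R. Proof. exact: exprn_gt0. Qed.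

Lemma step_parameter_le n x : 0 < x -> (step_parameter b n x <= b x)%E.
Proof.
move=> x0; rewrite step_parameterE//.
have := nb.1 x x0; case bx : (b x) => [r| |//]; last by move=> _; rewrite leey.
rewrite !lee_fin => r0; rewrite mulrC ler_pdivrMr//.
have r20 : 0 <= r * 2 ^+ n by rewrite mulr_ge0// ltW.
apply: le_trans (count_lt_le (n * 2 ^ n) r20); rewrite ler_nat.
apply: leq_sum => k _; case: asboolP => // /(lt_ginv x0).
by rewrite bx lte_fin ltr_pdivrMr// => ->.
Qed.

(* [x < ginv b t] and [t < b x] are equivalent except at the point [x = ginv b t]. *)
Lemma step_parameter_close n : \forall x \ae lam, 0 < (x : R) ->
  (b x <= n%:R%:E)%E -> (b x <= step_parameter b n x + (2 ^- n)%:E)%E.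
Proof.
have : \forall x \ae lam, forall k : nat, (x : R) <> fine (ginv b (k%:R / 2 ^+ n)).
  by apply/ae_foralln => k; exact: halfline_ae_neq.
apply: filterS => x hx x0; rewrite step_parameterE//.
have := nb.1 x x0; case bx : (b x) => [r| |//] //; rewrite -EFinD !lee_fin => r0 rn.
(* As b(x) <= n, the cap n 2^n on k cuts off no threshold below b(x). *)
have rN : r * 2 ^+ n <= (n * 2 ^ n)%N%:R by rewrite natrM natrX ler_wpM2r// ltW.
have := count_lt_ge rN.
have -> : (\sum_(1 <= k < (n * 2 ^ n).+1) ((k%:R < r * 2 ^+ n)%R : nat))%N = step_level n x.
  apply: eq_bigr => k _; congr nat_of_bool; apply/idP/asboolP => [kr|].
    rewrite lt_neqAle; apply/andP; split.
      by apply/eqP => xe; apply: (hx k); rewrite -xe.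
    by apply: le_ginv => //; rewrite bx lte_fin ltr_pdivrMr.
  by move=> /(lt_ginv x0); rewrite bx lte_fin ltr_pdivrMr.
rewrite -ler_pdivlMr// => /le_trans; apply.
by rewrite mulrDl mul1r mulrC.
Qed.

Lemma step_parameter_bounded n x : 0 < x -> (step_parameter b n x <= n%:R%:E)%E.
Proof.
move=> x0; rewrite step_parameterE// lee_fin mulrC ler_pdivrMr//.
by rewrite -natrX -natrM ler_nat step_level_le.
Qed.

(** As b_n <= b, the thresholds [d] and [M] of b work for every n. *)
Lemma step_vanishing (p' q : R) n : 0 < p' -> vanishing p' q b ->
  vanishing p' q (step_parameter b n).
Proof.
move=> p'0 vb e e0; have [d [M [d0 M0 h]]] := vb e e0.
exists d, M; split => // x x0 xd; apply: le_lt_trans (h x x0 xd).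
apply: lee_pmul => //; rewrite ?poweR_ge0 ?lee_fin ?powR_ge0//.
have s0 := (step_parameter_normal n).1 x x0.
apply: gt0_ler_poweR; rewrite ?invr_ge0 ?(ltW p'0)// ?in_itv/= ?leey ?andbT//.
  exact: nb.1.
exact: step_parameter_le.
Qed.

End StepParameter.

Lemma normc_real (R : realType) (x : R) : normc (x%:C)%C = `|x|.
Proof. by rewrite /Normc.normc /= expr0n addr0 sqrtr_sqr. Qed.

(** * Finite rank of the step operators *)

Section StepFiniteRank.
Context (R : realType) (p p' q : R).
Hypotheses (hp : 1 < p) (hpq : p <= q) (hp' : p^-1 + p'^-1 = 1).
Context (p1 : 1 <= p) (q1 : 1 <= q).
Local Notation lam := (halfline_measure R).
Local Notation a := (p'^-1).
Local Notation c := (q^-1).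
Variable (b : R -> \bar R).
Hypotheses (nb : normal_form b) (vb : vanishing p' q b).

Let p'0 : 0 < p' := conjugate_gt0 hp hp'.
Let q0 : 0 < q. Proof. exact: (lt_le_trans ltr01). Qed.

Definition level_set (n j : nat) : set (lebR R) :=
  [set x : R | 0 < x /\ step_level b n x = j].

Lemma measurable_level_set n j : measurable (level_set n j).
Proof.
have ms := @nonincreasing_halfline_measurable R (step_parameter b n)
  (fun x y => (step_parameter_normal b n).2 x y).
have := ms (@measurable_halfline R) [set (2 ^- n * j%:R)%:E] (emeasurable_set1 _).
congr measurable; apply/seteqP; split => x [x0] /=.
  have u : (2 ^- n : R) != 0 by rewrite invr_eq0 expf_neq0// pnatr_eq0.
  by rewrite step_parameterE// => -[] /(mulfI u)/eqP; rewrite eqr_nat => /eqP.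
by move=> sj; split => //; rewrite step_parameterE// sj.
Qed.

(** At a level j >= 1 the value of b_n is at least 2^-n, so for x >= 1 the product in (iv) is at
    least (2^-n)^(1/p'); (iv) with this number as e excludes large x. *)
Lemma level_set_bounded n j : (0 < j)%N -> exists M : R, 0 < M /\
  forall x : R, level_set n j x -> x < M.
Proof.
move=> j0; have e0 : 0 < (2 ^- n : R) `^ a by rewrite powR_gt0// invr_gt0 exprn_gt0.
have [d [M [_ M0 h]]] := step_vanishing nb n p'0 vb e0.
exists (Num.max M 1); split; first by rewrite lt_max M0.
move=> x [x0 sj]; rewrite ltNge; apply/negP; rewrite ge_max => /andP[Mx x1].
have := h x x0 (or_intror Mx); apply/negP; rewrite -leNgt.
rewrite step_parameterE// sj poweR_EFin -EFinM lee_fin.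
rewrite -[leLHS]mulr1; apply: ler_pM; rewrite ?powR_ge0//.
  apply: ge0_ler_powR; rewrite ?nnegrE ?invr_ge0 ?(ltW p'0) ?mulr_ge0 ?exprn_ge0//.
  by rewrite ler_peMr ?invr_ge0 ?exprn_ge0// ler1n.
have -> : 1 = 1 `^ c :> R by rewrite powR1.
by rewrite ge0_ler_powR ?nnegrE ?invr_ge0 ?(ltW q0)// ltW.
Qed.

Definition level_fun (n j : nat) (x : lebR R) : R[i]^o := (\1_(level_set n j) x)%:C%C.

Lemma level_fun_cLfun n j : (0 < j)%N -> level_fun n j \in cLfun lam q.
Proof.
move=> j0; have mS := measurable_level_set n j.
have mf : measurable_cfun (level_fun n j).
  have mi : measurable_fun [set: lebR R] (\1_(level_set n j) : lebR R -> R).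
    by apply: measurable_indic.
  by split; [exact: mi|exact: measurable_cst].
rewrite inE; split => //.
have [M [M0 hM]] := level_set_bounded n j0.
apply: (@le_lt_trans _ _ (M `^ c)%:E); last exact: ltry.
apply: (cLnorm_le_int q0 (powR_ge0 _ _)).
rewrite -powRrM mulVf ?gt_eqF// (powRr1 (ltW M0)) -(halfline_below (ltW M0)).
rewrite (_ : (fun t => _) = (fun t => (\1_(level_set n j) t)%:E)); last first.
  apply/funext => x; rewrite /level_fun indicE; congr EFin.
  rewrite normc_real; case: (_ \in _); first by rewrite normr1 powR1.
  by rewrite normr0 powR0 ?gt_eqF.
rewrite integral_indic// setIT; apply: le_measure; rewrite ?inE.
- exact: mS.
- exact: measurable_below.
- by move=> x /hM.
Qed.

Lemma Lp_fun_sum (m : nat) (z : 'I_m -> R[i]) (e : 'I_m -> Lp q1) :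
  \forall x \ae lam, Lp_fun (\sum_(i < m) z i *: e i) x =
     \sum_(i < m) z i * Lp_fun (e i) x.
Proof.
elim: m z e => [|m IHm] z e.
  rewrite big_ord0; have := Lp_funZD (-1) (0 : Lp q1) 0.
  rewrite scaler0 addr0; apply: filterS => x ->.
  by rewrite big_ord0 mulN1r addNr.
rewrite big_ord_recl; set G := (X in _ *: _ + X).
apply: filterS2 (Lp_funZD (z ord0) (e ord0) G)
  (IHm (fun i => z (lift ord0 i)) (fun i => e (lift ord0 i))) => x -> ->.
by rewrite big_ord_recl.
Qed.

(** On the level set j the image of F is constant, equal to the integral of F over (0, 2^-n j); the
    indicators of the level sets therefore span the range. *)
Lemma step_finite_rank n (H : Lp p1 -> Lp q1) :
  (forall F, \forall x \ae lam,
     Lp_fun (H F) x = hardy_cfun (step_parameter b n) (Lp_fun F) x) ->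
  finite_rank H.
Proof.
(* Index [i] stands for level i + 1. Level 0, whose set may have infinite measure, is left out. *)
move=> HE; pose e (i : 'I_(n * 2 ^ n)) := Lp_class q1 (level_fun_cLfun n (ltn0Sn i)).
exists (n * 2 ^ n)%N, e => F.
pose z (i : 'I_(n * 2 ^ n)) : R[i] := cint lam (below (2 ^- n * i.+1%:R)%:E) (Lp_fun F).
exists z.
apply: Lp_ext.
have hpos : \forall x \ae lam, 0 < (x : R) by apply: halfline_aeW.
have hall : \forall x \ae lam, forall j : nat,
    Lp_fun (Lp_class q1 (level_fun_cLfun n (ltn0Sn j))) x = level_fun n j.+1 x.
  by apply/ae_foralln => j; exact: Lp_classE.
apply: filterS2 (HE F) (filterI hpos (filterI hall (Lp_fun_sum z e))) => x -> [x0 [hx ->]].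
rewrite /hardy_cfun x0 step_parameterE//.
under eq_bigr do rewrite /e hx /level_fun indicE.
(* At level 0 the domain of integration is null, so both sides are 0. *)
have := step_level_le b n x0; case sx : (step_level b n x) => [|j] jN.
  rewrite big1 => [|i _]; last first.
    rewrite memNset ?mulr0// => -[_]; rewrite sx; discriminate.
  rewrite mulr0; apply: Normc.eq0_normc; apply/eqP; rewrite eq_le normc_ge0 andbT.
  rewrite -lee_fin; have mF := Lp_fun_measurable F.
  apply: (le_trans (cint_le lam (measurable_below _) mF)).
  have := cint_bound hp hp' (Lp_fun_cLfun F) (measurable_below 0%:E).
  rewrite (halfline_below (lexx 0)) poweR0r ?mule0 ?invr_eq0 ?gt_eqF// => h.
  apply: (@le_trans _ _ (2%:E * 0)%E); last by rewrite mule0.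
  apply: lee_pmul => //.
  by apply: integral_ge0 => t _; rewrite lee_fin normc_ge0.
rewrite (bigD1 (Ordinal jN))//= /z big1 => [|i ij]; last first.
  rewrite memNset ?mulr0// => -[_]; rewrite sx => -[ji]; move: ij.
  by rewrite -val_eqE /= ji eqxx.
by rewrite addr0 mem_set// mulr1.
Qed.

End StepFiniteRank.

(** * Sufficiency of (iv) *)

Section Convergence.
Context (R : realType).

Lemma ereal_cvg0P (T : Type) (F : set_system T) (FF : Filter F) (u : T -> \bar R) :
  (forall t, 0 <= u t)%E ->
  (u @ F --> 0%E) <-> (forall e : R, 0 < e -> \forall t \near F, (u t < e%:E)%E).
Proof.
move=> u0; split=> [uF e e0|h].
  exact: (uF _ (@nbhs_open_ereal_lt R 0 (fun=> e) e0)).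
apply/fine_cvgP; split.
  apply: filterS (h 1 ltr01) => t ut.
  by rewrite ge0_fin_numE// (lt_trans ut)// ltry.
apply/cvgrPdist_lt => e e0; apply: filterS (h e e0) => t ut /=.
rewrite sub0r normrN ger0_norm ?fine_ge0//.
by rewrite -lte_fin fineK// ge0_fin_numE// (lt_trans ut)// ltry.
Qed.

Lemma pinfty_nearP (P : R -> Prop) :
  (\forall x \near +oo, P x) <-> exists2 M : R, 0 < M & forall x, M <= x -> P x.
Proof.
split=> [[M [_ h]]|[M M0 h]].
  exists (Num.max (M + 1) 1); first by rewrite lt_max ltr01 orbT.
  by move=> x; rewrite ge_max => /andP[Mx _]; apply: h; apply: lt_le_trans Mx; rewrite ltrDl.
by exists M; split; [exact: num_real|move=> x /ltW /h].
Qed.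

Lemma at_right0_nearP (P : R -> Prop) :
  (\forall x \near 0^'+, P x) <-> exists2 d : R, 0 < d & forall x, 0 < x -> x < d -> P x.
Proof.
split=> [|[d d0 h]].
  move=> [d /= d0 h]; exists d => // x x0 xd; apply: h => //=.
  by rewrite sub0r normrN gtr0_norm.
exists d => // x /=; rewrite sub0r normrN => xd x0.
by apply: h => //; rewrite gtr0_norm in xd.
Qed.

Lemma near_pow2_le (d : R) : 0 < d -> \forall n \near \oo, 2 ^- n <= d.
Proof.
move=> d0; apply: filterS (nbhs_infty_ger d^-1) => n dn.
rewrite -(invrK d) lef_pV2 ?posrE ?invr_gt0 ?exprn_gt0//.
by apply: (le_trans dn); rewrite -natrX ler_nat ltnW// ltn_expl.
Qed.

End Convergence.

Section VanishingOperators.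
Context (R : realType) (p p' q : R).
Hypotheses (hp : 1 < p) (hpq : p <= q) (hp' : p^-1 + p'^-1 = 1).
Context (p1 : 1 <= p) (q1 : 1 <= q).
Local Notation lam := (halfline_measure R).
Local Notation a := (p'^-1).
Local Notation c := (q^-1).

Let p'0 : 0 < p' := conjugate_gt0 hp hp'.
Let a0 : 0 < a. Proof. by rewrite invr_gt0. Qed.
Let q0 : 0 < q. Proof. exact: (lt_le_trans ltr01). Qed.

Lemma vanishingP b : vanishing p' q b <->
  (b x `^ a * (x `^ c)%:E)%E @[x --> +oo] --> 0%E /\
  (b x `^ a * (x `^ c)%:E)%E @[x --> 0^'+] --> 0%E.
Proof.
have u0 x : (0 <= b x `^ a * (x `^ c)%:E)%E.
  by rewrite mule_ge0 ?poweR_ge0 ?lee_fin ?powR_ge0.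
split=> [vb|[/(ereal_cvg0P _ u0) h1 /(ereal_cvg0P _ u0) h2] e e0].
  split; apply/(ereal_cvg0P _ u0) => e e0; have [d [M [d0 M0 h]]] := vb e e0.
    apply/pinfty_nearP; exists M => // x Mx; apply: h; last by right.
    exact: lt_le_trans Mx.
  by apply/at_right0_nearP; exists d => // x x0 xd; apply: h => //; left.
have /pinfty_nearP[M M0 hM] := h1 e e0.
have /at_right0_nearP[d d0 hd] := h2 e e0.
by exists d, M; split => // x x0 [xd|Mx]; [exact: hd|exact: hM].
Qed.

(** The order of choice matters: e comes first, M is then dictated by b and e through
    [vanishing_dom], and y is adapted to M. *)
Lemma hardy_gain_small (eps : R) : 0 < eps -> exists2 e : R, 0 < e &
  forall M, 0 < M -> exists2 y : R, 0 < y &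
    forall z, 0 <= z -> z <= y -> hardy_gain p p' q e M (z `^ a) <= eps.
Proof.
move=> eps0.
pose C := q * a^-1 `^ (p - 1).
have C0 : 0 < C by rewrite mulr_gt0// powR_gt0// invr_gt0.
(* Then 2 k^(1/q) = eps, and each summand inside [hardy_gain] is allotted k / 2. *)
pose k := (eps / 2) `^ q.
have k0 : 0 < k by rewrite powR_gt0// divr_gt0.
exists ((k / 2 / C) `^ c); first by rewrite powR_gt0// !divr_gt0.
move=> M M0; exists ((k / 2 / M) `^ (a * q)^-1); first by rewrite powR_gt0// !divr_gt0.
move=> z z0 zy; rewrite /hardy_gain -/C.
have -> : C * (k / 2 / C) `^ c `^ q = k / 2.
  rewrite -powRrM mulVf ?gt_eqF// powRr1 ?divr_ge0 ?(ltW k0) ?(ltW C0)//.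
  by rewrite mulrC divfK// gt_eqF.
have hz : M * z `^ a `^ q <= k / 2.
  rewrite -powRrM -ler_pdivlMl// [leRHS]mulrC.
  have aq : 0 < a * q by rewrite mulr_gt0.
  have -> : k / 2 / M = ((k / 2 / M) `^ (a * q)^-1) `^ (a * q).
    by rewrite -powRrM mulVf ?gt_eqF// powRr1// !divr_ge0// ltW.
  by rewrite ge0_ler_powR ?(ltW aq) ?nnegrE ?powR_ge0.
rewrite mulrC -ler_pdivlMr//.
have e20 : 0 <= eps / 2 by rewrite divr_ge0// ltW.
have -> : eps / 2 = k `^ c by rewrite /k -powRrM mulfV ?gt_eqF// powRr1.
apply: ge0_ler_powR; rewrite ?nnegrE ?invr_ge0 ?(ltW q0) ?(ltW k0)//.
  by rewrite addr_ge0 ?divr_ge0 ?(ltW k0)// mulr_ge0 ?powR_ge0// ltW.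
by lra.
Qed.

Lemma opnorm_ge0 (A : Lp p1 -> Lp q1) : (0 <= opnorm A)%E.
Proof.
have z1 : Lp_norm (0 : Lp p1) <= 1 by rewrite -Lp_norm_le normr0 lecR.
by apply: le_trans (le_opnorm A z1); rewrite lee_fin Lp_norm_ge0.
Qed.

Lemma vanishing_operators b : normal_form b -> vanishing p' q b ->
  exists2 H : {linear Lp p1 -> Lp q1}, hardy_operator b H &
    exists2 Hn : nat -> {linear Lp p1 -> Lp q1},
      (forall n, hardy_operator (step_parameter b n) (Hn n) /\ finite_rank (Hn n)) &
      opnorm (fun f => Hn n f - H f) @[n --> \oo] --> 0%E.
Proof.
move=> nb vb.
have [H hH HE] := hardy_operator_exists hp hpq hp' p1 q1 nb vb.
exists H => //.
have nbn := step_parameter_normal b.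
have vbn n : vanishing p' q (step_parameter b n) := step_vanishing nb n p'0 vb.
pose Hn n := sval (cid2 (hardy_operator_exists hp hpq hp' p1 q1 (nbn n) (vbn n))).
have HnP n : hardy_operator (step_parameter b n) (Hn n).
  by rewrite /Hn; case: cid2.
have HnE n F : \forall x \ae lam,
    Lp_fun (Hn n F) x = hardy_cfun (step_parameter b n) (Lp_fun F) x.
  by rewrite /Hn; case: cid2 => G /= _ GE; exact: GE.
exists Hn.
  move=> n; split; first exact: HnP.
  exact: (step_finite_rank hp hp' nb vb (HnE n)).
apply/ereal_cvg0P => [n|eps eps0]; first exact: opnorm_ge0.
have eps20 : 0 < eps / 2 by rewrite divr_gt0.
have [e e0 he] := hardy_gain_small eps20.
have [M [r [M0 r0 hM]]] := vanishing_dom hp hp' nb vb e0.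
have [y y0 hy] := he M M0.
(* r <= n brings the middle range, where b <= r, into the scope of [step_parameter_close]; 2^-n <= y
   makes the resulting error small. *)
apply: filterS2 (near_pow2_le y0) (nbhs_infty_ger r) => n ny rn.
have n20 : 0 <= 2 ^- n :> R by rewrite invr_ge0 exprn_ge0.
apply: (@le_lt_trans _ _ (eps / 2)%:E); last first.
  by rewrite lte_fin ltr_pdivrMr// ltr_pMr// ltr1n.
apply: (@le_trans _ _ (hardy_gain p p' q e M ((2 ^- n) `^ a))%:E); last first.
  by rewrite lee_fin; exact: hy.
apply: (hardy_operator_diff hp hpq hp' nb vb (nbn n) (vbn n) HE (HnE n) _ e0 (ltW M0) n20).
  by move=> x x0; exact: step_parameter_le.
apply: filterS (step_parameter_close nb n) => x hx x0.
have [bx|[xM br]] := hM x x0; [by left|right; split => //].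
by apply: hx => //; apply: (le_trans br); rewrite lee_fin.
Qed.

End VanishingOperators.

(** * Mass near zero and infinity *)

Section Tails.
Context (R : realType) (q : R) (q1 : 1 <= q).
Local Notation lam := (halfline_measure R).
Implicit Types G : Lp q1.
Local Open Scope ereal_scope.

Let q0 : (0 < q)%R. Proof. exact: (lt_le_trans ltr01). Qed.

(** The q-th power of the norm on [S], kept without root because it is additive over disjoint
    sets. *)
Definition tail_int (S : set (lebR R)) G := \int[lam]_(x in S) (normc (Lp_fun G x) `^ q)%:E.

Lemma measurable_pow_normc G (S : set (lebR R)) :
  measurable_fun S (fun x => (normc (Lp_fun G x) `^ q)%:E).
Proof.
apply/measurable_EFinP; apply: measurable_funTS.
exact: measurableT_comp (measurable_powR _) (measurable_normc (Lp_fun_measurable G)).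
Qed.

Lemma pow_normc_ge0 G x : 0 <= (normc (Lp_fun G x) `^ q)%:E.
Proof. by rewrite lee_fin powR_ge0. Qed.

Lemma tail_int_ge0 S G : 0 <= tail_int S G.
Proof. by apply: integral_ge0 => x _; exact: pow_normc_ge0. Qed.

Lemma tail_intT G : tail_int setT G = (Lp_norm G `^ q)%:E.
Proof. exact: (cLnorm_int q0 (Lp_fun_cLfun G)). Qed.

Lemma tail_int_subset S S' G : measurable S -> measurable S' -> S `<=` S' ->
  tail_int S G <= tail_int S' G.
Proof.
move=> mS mS' SS'.
rewrite /tail_int; apply: (ge0_subset_integral lam mS mS').
- exact: measurable_pow_normc.
- by move=> x _; exact: pow_normc_ge0.
- exact: SS'.
Qed.

Lemma tail_int_le S G : measurable S -> tail_int S G <= (Lp_norm G `^ q)%:E.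
Proof. by move=> mS; rewrite -tail_intT; exact: tail_int_subset. Qed.

Lemma powR_add_le (x y : R) : (0 <= x)%R -> (0 <= y)%R ->
  ((x + y) `^ q <= 2 `^ q * (x `^ q + y `^ q))%R.
Proof.
move=> x0 y0; have [xy|yx] := leP x y.
  apply: (@le_trans _ _ ((2 * y) `^ q)%R).
    by apply: ge0_ler_powR; rewrite ?nnegrE ?(ltW q0) ?addr_ge0 ?mulr_ge0//; lra.
  by rewrite powRM// ler_wpM2l ?powR_ge0// lerDr powR_ge0.
apply: (@le_trans _ _ ((2 * x) `^ q)%R).
  by apply: ge0_ler_powR; rewrite ?nnegrE ?(ltW q0) ?addr_ge0 ?mulr_ge0//; lra.
by rewrite powRM// ler_wpM2l ?powR_ge0// lerDl powR_ge0.
Qed.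

(** The triangle inequality for q-th powers, with the crude constant 2^q. It transfers small tails
    to all elements close to a given one. *)
Lemma tail_int_perturb S G G' : measurable S ->
  tail_int S G <= (2 `^ q)%:E * (tail_int S G' + (Lp_norm (G - G')%R `^ q)%:E).
Proof.
move=> mS; apply: (@le_trans _ _ ((2 `^ q)%:E * (tail_int S G' + tail_int S (G - G')%R))).
  rewrite -(ge0_integralD lam mS); last 4 first.
  - by move=> x _; exact: pow_normc_ge0.
  - exact: measurable_pow_normc.
  - by move=> x _; exact: pow_normc_ge0.
  - exact: measurable_pow_normc.
  have msum : measurable_fun S
      (fun x => (normc (Lp_fun G' x) `^ q)%:E + (normc (Lp_fun (G - G')%R x) `^ q)%:E).
    by apply: emeasurable_funD; exact: measurable_pow_normc.
  have sum0 x : 0 <= (normc (Lp_fun G' x) `^ q)%:E + (normc (Lp_fun (G - G')%R x) `^ q)%:E.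
    by apply: adde_ge0; exact: pow_normc_ge0.
  rewrite -(ge0_integralZl lam mS msum (fun x _ => sum0 x)) ?lee_fin ?powR_ge0//.
  apply: (ae_ge0_le_integral mS).
  - by move=> x _; exact: pow_normc_ge0.
  - exact: measurable_pow_normc.
  - by move=> x _; rewrite mule_ge0// lee_fin powR_ge0.
  - by apply: emeasurable_funM; [exact: measurable_cst|exact: msum].
  apply: filterS (Lp_funB G G') => x -> _.
  rewrite -EFinD -EFinM lee_fin; apply: le_trans (powR_add_le _ _); rewrite ?normc_ge0//.
  apply: ge0_ler_powR; rewrite ?nnegrE ?(ltW q0) ?addr_ge0 ?normc_ge0//.
  have := le_normcD (Lp_fun G' x) (Lp_fun G x - Lp_fun G' x)%R.
  by rewrite [X in normc X](addrC (Lp_fun G' x)) subrK.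
apply: lee_pmul => //; first by rewrite adde_ge0 ?tail_int_ge0.
by rewrite leeD2l// tail_int_le.
Qed.

(** Monotone convergence along the windows [2^-n, 2^n): once a window carries all but e of the total
    mass, any set disjoint from it carries at most e. *)
Lemma tail_int_small G (e : R) : (0 < e)%R -> exists d M : R,
  [/\ (0 < d)%R, (0 < M)%R, tail_int (below d%:E) G <= e%:E &
      tail_int (~` below M%:E) G <= e%:E].
Proof.
move=> e0.
pose F (n : nat) : set (lebR R) := below (2 ^+ n)%:E `\` below (2 ^- n)%:E.
have mF n : measurable (F n) by apply: measurableD; exact: measurable_below.
have Fnd : {homo F : n m / (n <= m)%N >-> (n <= m)%O}.
  move=> n m nm; apply/subsetPset => x; rewrite /F /below /= !lte_fin => -[xn nx].
  have nm2 : (2 ^+ n <= 2 ^+ m :> R)%R by rewrite ler_weXn2l// ler1n.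
  split; first exact: lt_le_trans nm2.
  move=> xm; apply: nx; apply: (lt_le_trans xm).
  by rewrite lef_pV2 ?posrE ?exprn_gt0.
have FU : \bigcup_n F n = @halfline R.
  apply/seteqP; split => x /=.
    move=> [n _ [_ /negP]]; rewrite /halfline /= lte_fin -leNgt; apply: lt_le_trans.
    by rewrite invr_gt0 exprn_gt0.
  rewrite /halfline /= => x0.
  have [n nx] : exists n : nat, (2 ^- n <= (x : R))%R.
    have [n _ hn] := near_pow2_le x0; exists n; exact: (hn n (leqnn n)).
  have xi0 : (0 < (x : R)^-1 / 2)%R by rewrite divr_gt0// invr_gt0.
  have [m mx] : exists m : nat, (2 ^- m <= (x : R)^-1 / 2)%R.
    have [m _ hm] := near_pow2_le xi0; exists m; exact: (hm m (leqnn m)).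
  exists (maxn n m) => //; rewrite /F /below /= !lte_fin; split.
    apply: (@lt_le_trans _ _ (2 ^+ m)%R); last by rewrite ler_weXn2l ?ler1n// leq_maxr.
    rewrite -(invrK (2 ^+ m))%R -(invrK (x : R)) ltf_pV2 ?posrE ?invr_gt0 ?exprn_gt0//.
    apply: (le_lt_trans mx); rewrite ltr_pdivrMr// ltr_pMr ?ltr1n// invr_gt0.
    exact: x0.
  apply/negP; rewrite -leNgt; apply: le_trans nx.
  by rewrite lef_pV2 ?posrE ?exprn_gt0// ler_weXn2l ?ler1n// leq_maxl.
have cvgF : tail_int (F n) G @[n --> \oo] --> tail_int (@halfline R) G.
  rewrite -FU; apply: (ge0_nondecreasing_set_cvg_integral Fnd mF).
    by move=> n; exact: measurable_pow_normc.
  by move=> n x _; exact: pow_normc_ge0.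
have TH : tail_int (@halfline R) G = (Lp_norm G `^ q)%:E.
  rewrite -tail_intT /tail_int [RHS](integral_halflineI measurableT).
  - by rewrite setTI.
  - exact: measurable_pow_normc.
  - exact: pow_normc_ge0.
rewrite TH in cvgF.
have [n hn] : exists n, (Lp_norm G `^ q - e)%:E < tail_int (F n) G.
  have := cvgF [set y | (Lp_norm G `^ q - e)%:E < y].
  have nb := @nbhs_open_ereal_gt R (Lp_norm G `^ q)%R (fun r => r - e)%R.
  move=> /(_ (nb _))[|n _ hn]; first by rewrite gtrBl.
  by exists n; exact: (hn n (leqnn n)).
have disj S : measurable S -> S `&` F n = set0 -> tail_int S G <= e%:E.
  move=> mS SF; have SF' : [disjoint S & F n] by apply/disj_setPS; rewrite SF.
  have h : tail_int S G + tail_int (F n) G <= (Lp_norm G `^ q)%:E.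
    rewrite /tail_int -(ge0_integral_setU lam mS (mF n)); last 3 first.
    - exact: measurable_pow_normc.
    - by move=> x _; exact: pow_normc_ge0.
    - exact: SF'.
    apply: tail_int_le; exact: (measurableU _ _ mS (mF n)).
  have := tail_int_ge0 S G; have := tail_int_ge0 (F n) G; move: h hn.
  case: (tail_int S G) => [s| |]//; case: (tail_int (F n) G) => [t| |]//.
  by rewrite -EFinD !lte_fin !lee_fin; lra.
exists (2 ^- n)%R, (2 ^+ n)%R; split.
- by rewrite invr_gt0 exprn_gt0.
- by rewrite exprn_gt0.
- apply: disj; first exact: measurable_below.
  by rewrite -subset0 => x [xn [_]].
- apply: disj; first by apply: measurableC; exact: measurable_below.
  by rewrite -subset0 => x [xn []].
Qed.

End Tails.

Lemma half_le_sub (R : realFieldType) (x y : R) : 2 * y <= x -> 2^-1 * x <= x - y.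
Proof. by lra. Qed.

Lemma gtr_half (R : realFieldType) (x : R) : 0 < x -> x / 2 < x.
Proof. by lra. Qed.

(** * Necessity of (iv) *)

Section TestFunctions.
Context (R : realType) (p p' q : R).
Hypotheses (hp : 1 < p) (hpq : p <= q) (hp' : p^-1 + p'^-1 = 1).
Context (p1 : 1 <= p) (q1 : 1 <= q).
Local Notation lam := (halfline_measure R).
Local Notation a := (p'^-1).
Local Notation c := (q^-1).

Let p0 : 0 < p. Proof. exact: lt_trans hp. Qed.
Let p'0 : 0 < p' := conjugate_gt0 hp hp'.
Let a0 : 0 < a. Proof. by rewrite invr_gt0. Qed.
Let q0 : 0 < q. Proof. exact: (lt_le_trans ltr01). Qed.

Definition test_fun (s : R) (t : lebR R) : R[i]^o :=
  (s `^ (- p^-1) * \1_(below s%:E) t)%:C%C.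

Lemma test_fun_cLnorm s : 0 < s -> measurable_cfun (test_fun s) /\
  (cLnorm lam p (test_fun s) <= 1%:E)%E.
Proof.
move=> s0; have mf : measurable_cfun (test_fun s).
  split; last exact: measurable_cst.
  apply: measurable_funM; first exact: measurable_cst.
  by apply: measurable_indic; exact: measurable_below.
split=> //; apply: (cLnorm_le_int p0 ler01); rewrite powR1.
have -> : (fun t => (normc (test_fun s t) `^ p)%:E) =
    (fun t => (s^-1)%:E * (\1_(below s%:E) t)%:E)%E.
  apply/funext => t; rewrite /test_fun normc_real indicE -EFinM; congr EFin.
  rewrite ger0_norm ?mulr_ge0 ?powR_ge0//; case: (_ \in _).
    by rewrite !mulr1 -powRrM mulNr mulVf ?gt_eqF// powR_inv1// ltW.
  by rewrite !mulr0 powR0// gt_eqF.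
rewrite (ge0_integralZl lam measurableT).
- rewrite integral_indic; last 2 first.
  + exact: measurableT.
  + exact: measurable_below.
  by rewrite setIT (halfline_below (ltW s0)) -EFinM mulVf// gt_eqF.
- by apply/measurable_EFinP; apply: measurable_indic; exact: measurable_below.
- by move=> t _; rewrite lee_fin indicE.
- by rewrite lee_fin invr_ge0 ltW.
Qed.

Lemma test_fun_cLfun s : 0 < s -> test_fun s \in cLfun lam p.
Proof.
move=> s0; have [mf f1] := test_fun_cLnorm s0.
by rewrite inE; split => //; apply: (le_lt_trans f1); exact: ltry.
Qed.

Definition test_class s (s0 : 0 < s) : Lp p1 := Lp_class p1 (test_fun_cLfun s0).

Lemma test_class_norm s (s0 : 0 < s) : Lp_norm (test_class s0) <= 1.
Proof. by rewrite -lee_fin Lp_norm_class; have [] := test_fun_cLnorm s0. Qed.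

Lemma test_class_ge0 s (s0 : 0 < s) : \forall x \ae lam, 0 <= Lp_fun (test_class s0) x.
Proof.
apply: filterS (Lp_classE p1 (test_fun_cLfun s0)) => x ->.
by rewrite /test_fun lecR mulr_ge0 ?powR_ge0.
Qed.

(** A nonnegative class equals its modulus almost everywhere and its image is real and nonnegative,
    so the defining formula can be read with moduli, as the norm estimates require. *)
Lemma hardy_operator_normc b (H : {linear Lp p1 -> Lp q1}) F : hardy_operator b H ->
  (\forall x \ae lam, 0 <= Lp_fun F x) ->
  \forall x \ae lam, (normc (Lp_fun (H F) x))%:E =
    (\int[lam]_(t in below (b x)) (normc (Lp_fun F t))%:E)%E.
Proof.
move=> [_ hH] F0; have [mR _] := Lp_fun_measurable F.
have mF := measurable_normc (Lp_fun_measurable F).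
have Fn : \forall t \ae lam, complex.Re (Lp_fun F t) = normc (Lp_fun F t).
  apply: filterS F0 => t; case: (Lp_fun F t) => u v.
  by rewrite lecE /= => /andP[/eqP -> u0]; rewrite expr0n addr0 sqrtr_sqr ger0_norm.
have IE x : (\int[lam]_(t in below (b x)) (complex.Re (Lp_fun F t))%:E =
    \int[lam]_(t in below (b x)) (normc (Lp_fun F t))%:E)%E.
  apply: ae_eq_integral.
  - exact: measurable_below.
  - by apply/measurable_EFinP; exact: measurable_funTS.
  - by apply/measurable_EFinP; exact: measurable_funTS.
  - by apply: filterS Fn => t -> _.
apply: filterS (hH F F0) => x [hx Im0]; rewrite (hardyE _ _ mR) IE in hx.
rewrite hx; have : (0 <= (complex.Re (Lp_fun (H F) x))%:E)%E.
  by rewrite -hx; apply: integral_ge0 => t _; rewrite lee_fin normc_ge0.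
move: Im0; case: (Lp_fun (H F) x) => u v /= ->; rewrite lee_fin => u0.
by rewrite expr0n addr0 sqrtr_sqr ger0_norm.
Qed.

Definition window (m x : R) : set (lebR R) := below x%:E `\` below m%:E.

Lemma measurable_window m x : measurable (window m x).
Proof. by apply: measurableD; exact: measurable_below. Qed.

Lemma halfline_window m x : 0 <= m -> m <= x -> lam (window m x) = (x - m)%:E.
Proof.
move=> m0 mx.
have mD := @measureD _ _ _ lam _ _ (measurable_below x%:E) (measurable_below m%:E).
rewrite [LHS]mD; last by apply: halfline_below_fin; exact: ltry.
rewrite setIidr; last by apply: below_subset; rewrite lee_fin.
by rewrite EFinB; congr (_ - _)%E; apply: halfline_below => //; exact: le_trans mx.
Qed.

(** For y in [m, x) monotonicity gives s <= b(y), so the whole integral s^(1 - 1/p) = s^(1/p') of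
    the test function is collected; its q-th power is then integrated over a length x - m. *)
Lemma hardy_test_lower b (H : {linear Lp p1 -> Lp q1}) s (s0 : 0 < s) m x :
  hardy_operator b H -> (forall u v, 0 < u -> u <= v -> (b v <= b u)%E) ->
  0 <= m -> m < x -> (s%:E <= b x)%E ->
  (((x - m) * s `^ (a * q))%:E <= tail_int (window m x) (H (test_class s0)))%E.
Proof.
move=> hH bd m0 mx sb.
have -> : (((x - m) * s `^ (a * q))%:E =
    \int[lam]_(y in window m x) (s `^ (a * q))%:E)%E.
  rewrite integral_cst; last exact: measurable_window.
  by rewrite [X in (_ * X)%E](halfline_window m0 (ltW mx)) -EFinM mulrC.
apply: (ae_ge0_le_integral (measurable_window m x)).
- by move=> y _; rewrite lee_fin powR_ge0.
- exact: measurable_cst.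
- by move=> y _; exact: pow_normc_ge0.
- exact: measurable_pow_normc.
have hpos : \forall x \ae lam, 0 < (x : R) by apply: halfline_aeW.
apply: filterS2 hpos (hardy_operator_normc hH (test_class_ge0 s0)) => y y0 hy [yx _].
have sby : (s%:E <= b y)%E by apply: (le_trans sb); apply: bd => //; apply: ltW; exact: yx.
rewrite lee_fin powRrM; apply: ge0_ler_powR; rewrite ?nnegrE ?(ltW q0) ?powR_ge0 ?normc_ge0//.
rewrite -lee_fin hy.
have mT : measurable_fun [set: lebR R] (fun t => normc (Lp_fun (test_class s0) t)).
  exact: (measurable_normc (Lp_fun_measurable _)).
apply: (@le_trans _ _ (\int[lam]_(t in below s%:E) (normc (Lp_fun (test_class s0) t))%:E)%E);
  last first.
  apply: (ge0_subset_integral lam (measurable_below _) (measurable_below _)).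
  - by apply/measurable_EFinP; exact: measurable_funTS.
  - by move=> t _; rewrite lee_fin normc_ge0.
  - exact: below_subset.
rewrite (@ae_eq_integral _ _ _ lam (below s%:E) (fun=> (s `^ (- p^-1))%:E)); last 4 first.
- exact: measurable_below.
- by apply/measurable_EFinP; exact: measurable_funTS.
- exact: measurable_cst.
- apply: filterS (Lp_classE p1 (test_fun_cLfun s0)) => t tE ts.
  rewrite /test_class tE /test_fun normc_real indicE mem_set// mulr1.
  by rewrite ger0_norm// powR_ge0.
rewrite integral_cst; last exact: measurable_below.
rewrite [X in (_ * X)%E](halfline_below (ltW s0)) -EFinM lee_fin.
rewrite -[X in _ * X](powRr1 (ltW s0)) -powRD; last by rewrite (gt_eqF s0) implybT.
by rewrite -hp' addKr.
Qed.

(** Restricted to nonnegative classes, those on which [hardy_operator] gives a formula. *)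
Definition small_tails (H : Lp p1 -> Lp q1) := forall e : R, 0 < e ->
  exists d M : R, [/\ 0 < d, 0 < M & forall F, (\forall x \ae lam, 0 <= Lp_fun F x) ->
    Lp_norm F <= 1 -> (tail_int (below d%:E) (H F) <= e%:E)%E /\
      (tail_int (~` below M%:E) (H F) <= e%:E)%E].

(** Test functions of every width s <= b(x) are used rather than s = b(x), since b(x) may be 0 or,
    at this stage, infinite. *)
Lemma small_tails_vanishing b (H : {linear Lp p1 -> Lp q1}) : normal_form b ->
  hardy_operator b H -> small_tails H -> vanishing p' q b.
Proof.
move=> [b0 bd] hH tH e e0.
have e20 : 0 < e / 2 by rewrite divr_gt0.
(* Half of e makes the final inequality strict; the outer factor 1/2 pays for x - M >= x / 2, valid
   for x >= 2 M. *)
pose eps := (e / 2) `^ q / 2.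
have eps0 : 0 < eps by rewrite divr_gt0// powR_gt0.
have [d [M [d0 M0 h]]] := tH eps eps0.
exists d, (2 * M); split => //; first by rewrite mulr_gt0.
move=> x x0 hx.
have key s : 0 < s -> (s%:E <= b x)%E -> s `^ a * x `^ c <= e / 2.
  move=> s0 sb; have [h1 h2] := h _ (test_class_ge0 s0) (test_class_norm s0).
  have hs : x * s `^ (a * q) <= (e / 2) `^ q.
    have -> : (e / 2) `^ q = 2 * eps by rewrite /eps [RHS]mulrC divfK.
    case: hx => [xd|Mx].
      have := hardy_test_lower s0 hH bd (lexx 0) x0 sb; rewrite subr0 => hl.
      have bs : below x%:E `<=` below d%:E by apply: below_subset; rewrite lee_fin ltW.
      have : ((x * s `^ (a * q))%:E <= eps%:E)%E.
        apply: (le_trans hl); apply: le_trans h1; apply: tail_int_subset.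
        - exact: measurable_window.
        - exact: measurable_below.
        - exact: subset_trans (@subDsetl _ _ _) bs.
      by rewrite lee_fin => h3; apply: (le_trans h3); rewrite ler_peMl ?(ltW eps0)// ler1n.
    have Mx' : M < x by apply: lt_le_trans Mx; rewrite ltr_pMl// ltr1n.
    have hl := hardy_test_lower s0 hH bd (ltW M0) Mx' sb.
    have : (((x - M) * s `^ (a * q))%:E <= eps%:E)%E.
      apply: (le_trans hl); apply: le_trans h2; apply: tail_int_subset.
      - exact: measurable_window.
      - by apply: measurableC; exact: measurable_below.
      - exact: subDsetr.
    rewrite lee_fin => h3; rewrite -ler_pdivrMl// mulrA; apply: le_trans h3.
    by rewrite ler_wpM2r ?powR_ge0// half_le_sub.
  have -> : e / 2 = ((e / 2) `^ q) `^ c.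
    by rewrite -powRrM mulfV ?gt_eqF// powRr1// ltW.
  have -> : s `^ a * x `^ c = (x * s `^ (a * q)) `^ c.
    rewrite powRM ?powR_ge0 ?(ltW x0)// mulrC; congr (_ * _).
    by rewrite -powRrM -mulrA mulfV ?mulr1// gt_eqF.
  apply: ge0_ler_powR; rewrite ?nnegrE ?invr_ge0 ?(ltW q0) ?powR_ge0//.
  by rewrite mulr_ge0 ?powR_ge0// ltW.
have xc0 : 0 < x `^ c by rewrite powR_gt0.
have := b0 x x0; case bx : (b x) => [r| |//].
  rewrite lee_fin le_eqVlt => /orP[/eqP <-|r0].
    by rewrite poweR_EFin powR0 ?gt_eqF// mul0e lte_fin.
  rewrite poweR_EFin -EFinM lte_fin; apply: (@le_lt_trans _ _ (e / 2)).
    by apply: key => //; rewrite bx.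
  exact: gtr_half.
(* If b(x) is infinite, s may be chosen with s^(1/p') x^(1/q) = e, against the bound e / 2. *)
move=> _; exfalso.
have s0 : 0 < (e / x `^ c) `^ p' by rewrite powR_gt0// divr_gt0.
have := key _ s0; rewrite bx leey => /(_ isT).
rewrite -powRrM mulfV ?gt_eqF// powRr1 ?divr_ge0 ?(ltW e0) ?(ltW xc0)//.
by rewrite divfK ?gt_eqF// leNgt gtr_half.
Qed.

(** Each G in the compact closure has small tails at some scale 2^-n, 2^n, and nearby elements
    inherit them up to a constant; the near-covering form of compactness makes the scale uniform. *)
Lemma compact_small_tails (H : {linear Lp p1 -> Lp q1}) : compact_operator H ->
  small_tails H.
Proof.
rewrite /compact_operator precompactE => /compact_near_coveringP cH e e0.
pose K := closure (H @` [set v : Lp p1 | `|v| <= 1]).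
have Ksub F : Lp_norm F <= 1 -> K (H F).
  by move=> F1; apply: subset_closure; exists F => //=; rewrite -[1]/(1%:C)%C Lp_norm_le.
pose P (n : nat) (G : Lp q1) :=
  (tail_int (below (2 ^- n)%:E) G <= e%:E)%E /\
  (tail_int (~` below (2 ^+ n)%:E) G <= e%:E)%E.
have mb (y : R) : measurable (below y%:E) by exact: measurable_below.
have mbC (y : R) : measurable (~` below y%:E) by apply: measurableC; exact: mb.
suff : \forall n \near \oo, K `<=` P n.
  move=> [n _ /(_ n (leqnn n)) hn].
  exists (2 ^- n), (2 ^+ n); split; rewrite ?invr_gt0 ?exprn_gt0// => F F0 F1.
  exact: (hn _ (Ksub F F1)).
apply: cH => G KG.
(* Chosen so that 2^q (k + k) = e in [tail_int_perturb]. *)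
pose k := e / 2 `^ q / 2.
have k0 : 0 < k by rewrite !divr_gt0// powR_gt0.
have [d [M [d0 M0 hd hM]]] := tail_int_small G k0.
have r0 : 0 < k `^ c by rewrite powR_gt0.
have pert G' S : measurable S -> Lp_norm (G' - G) <= k `^ c ->
    (tail_int S G <= k%:E)%E -> (tail_int S G' <= e%:E)%E.
  move=> mS GG SG; apply: (le_trans (tail_int_perturb G' G mS)).
  have -> : e%:E = ((2 `^ q)%:E * (k%:E + k%:E))%E.
    by rewrite -EFinD -EFinM; congr EFin; rewrite /k; field; rewrite ?gt_eqF ?powR_gt0.
  rewrite lee_wpmul2l ?lee_fin ?powR_ge0//; apply: leeD => //; rewrite lee_fin.
  have -> : k = (k `^ c) `^ q by rewrite -powRrM mulVf ?gt_eqF// powRr1// ltW.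
  by rewrite ge0_ler_powR ?(ltW q0) ?nnegrE ?powR_ge0 ?Lp_norm_ge0.
have nG : \forall G' \near G, Lp_norm (G' - G) <= k `^ c.
  have r0' : 0 < (k `^ c)%:C%C by rewrite ltcR.
  apply: filterS (nbhsx_ballx G _ r0') => G'.
  rewrite -ball_normE /= distrC => /ltW; by rewrite Lp_norm_le.
have nn : \forall n \near \oo, 2 ^- n <= d /\ 2 ^- n <= M^-1.
  have Mi0 : 0 < M^-1 by rewrite invr_gt0.
  by apply: filterS2 (near_pow2_le d0) (near_pow2_le Mi0).
exists ([set G' | Lp_norm (G' - G) <= k `^ c], [set n | 2 ^- n <= d /\ 2 ^- n <= M^-1]).
  by split.
move=> [G' n] /= [hG [n1 n2]]; split; apply: pert => //.
  by apply: le_trans hd; apply: tail_int_subset => //; apply: below_subset; rewrite lee_fin.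
apply: le_trans hM; apply: tail_int_subset => //; apply: subsetC.
apply: below_subset; rewrite lee_fin -(invrK M) -(invrK (2 ^+ n)).
by rewrite lef_pV2 ?posrE ?invr_gt0 ?exprn_gt0.
Qed.

End TestFunctions.

Section StepTails.
Context (R : realType) (p p' q : R).
Hypotheses (hp : 1 < p) (hpq : p <= q) (hp' : p^-1 + p'^-1 = 1).
Context (p1 : 1 <= p) (q1 : 1 <= q).
Local Notation lam := (halfline_measure R).
Local Notation a := (p'^-1).
Local Notation c := (q^-1).

Let p'0 : 0 < p' := conjugate_gt0 hp hp'.
Let a0 : 0 < a. Proof. by rewrite invr_gt0. Qed.
Let q0 : 0 < q. Proof. exact: (lt_le_trans ltr01). Qed.

(** Where b_n is nonzero it is at least 2^-n. If this happens at x, the image of the test function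
    with s = 2^-n is bounded below on (0, x), and its finite norm bounds x. *)
Lemma step_parameter_eventually0 b n (H : {linear Lp p1 -> Lp q1}) :
  hardy_operator (step_parameter b n) H ->
  exists2 M : R, 0 < M & forall x, M <= x -> step_parameter b n x = 0%E.
Proof.
move=> hH; have s0 : 0 < 2 ^- n :> R by rewrite invr_gt0 exprn_gt0.
pose k := Lp_norm (H (test_class hp p1 s0)) `^ q.
have sq0 : 0 < (2 ^- n : R) `^ (a * q) by rewrite powR_gt0.
have k0 : 0 <= k / (2 ^- n) `^ (a * q) by rewrite divr_ge0 ?powR_ge0.
exists (k / (2 ^- n) `^ (a * q) + 1); first by rewrite ltr_wpDl.
move=> x Mx; have x0 : 0 < x by apply: lt_le_trans Mx; rewrite ltr_wpDl.
rewrite step_parameterE//; case sx : (step_level b n x) => [|j]; first by rewrite mulr0.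
have sb : ((2 ^- n)%:E <= step_parameter b n x)%E.
  by rewrite step_parameterE// sx lee_fin ler_peMr ?(ltW s0)// ler1n.
have bd := (step_parameter_normal b n).2.
have := hardy_test_lower hp hp' s0 hH bd (lexx 0) x0 sb; rewrite subr0 => h.
have := le_trans h (tail_int_le (H (test_class hp p1 s0)) (measurable_window 0 x)).
rewrite lee_fin -/k -ler_pdivlMr// => xk.
by have := le_trans Mx xk; rewrite gerDl ler10.
Qed.

(** Hoelder and b_n <= n bound the image pointwise by n^(1/p'), which settles x near 0; far out b_n
    = 0 and the image vanishes. *)
Lemma step_small_tails b n (H : {linear Lp p1 -> Lp q1}) :
  hardy_operator (step_parameter b n) H -> small_tails H.
Proof.
move=> hH e e0; have [M M0 hM] := step_parameter_eventually0 hH.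
pose k := n%:R `^ (a * q) + 1 : R.
have k0 : 0 < k by rewrite ltr_wpDl ?powR_ge0.
exists (e / k), M; split => //; first by rewrite divr_gt0.
move=> F F0 F1.
have hpos : \forall x \ae lam, 0 < (x : R) by apply: halfline_aeW.
have bound : \forall x \ae lam, 0 < (x : R) /\
    ((normc (Lp_fun (H F) x))%:E <= lam (below (step_parameter b n x)) `^ a)%E.
  apply: filterS2 hpos (hardy_operator_normc hH F0) => x x0 ->; split => //.
  apply: (le_trans (cint_bound hp hp' (Lp_fun_cLfun F) (measurable_below _))).
  rewrite -[leRHS]mul1e; apply: lee_pmul => //; rewrite ?poweR_ge0 ?lee_fin//.
  exact: Lp_norm_ge0.
split.
  apply: (@le_trans _ _ (\int[lam]_(x in below (e / k)%:E) (n%:R `^ (a * q))%:E)%E).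
    apply: (ae_ge0_le_integral (measurable_below _)).
    - by move=> x _; exact: pow_normc_ge0.
    - exact: measurable_pow_normc.
    - by move=> x _; rewrite lee_fin powR_ge0.
    - exact: measurable_cst.
    apply: filterS bound => x [x0 hx] _; rewrite lee_fin powRrM.
    apply: ge0_ler_powR; rewrite ?nnegrE ?(ltW q0) ?powR_ge0 ?normc_ge0//.
    rewrite -lee_fin; apply: (le_trans hx); rewrite -poweR_EFin.
    have n0 : 0 <= n%:R :> R by [].
    rewrite -(halfline_below n0); apply: gt0_ler_poweR; first exact: ltW.
    - by rewrite in_itv/= leey andbT measure_ge0.
    - by rewrite in_itv/= leey andbT measure_ge0.
    apply: le_measure; rewrite ?inE.
    - exact: measurable_below.
    - exact: measurable_below.
    - by apply: below_subset; exact: step_parameter_bounded.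
  rewrite integral_cst; last exact: measurable_below.
  rewrite [X in (_ * X)%E](halfline_below (ltW (divr_gt0 e0 k0))) -EFinM lee_fin.
  rewrite mulrC -mulrA ger_pMr// mulrC ler_pdivrMr// mul1r.
  by rewrite /k lerDl.
apply: (@le_trans _ _ (\int[lam]_(x in ~` below M%:E) 0)%E); last first.
  by rewrite integral0 lee_fin ltW.
have mC : measurable (~` below M%:E) by apply: measurableC; exact: measurable_below.
apply: (ae_ge0_le_integral mC).
- by move=> x _; exact: pow_normc_ge0.
- exact: measurable_pow_normc.
- by [].
- exact: measurable_cst.
apply: filterS bound => x [x0 hx] /negP; rewrite lte_fin -leNgt => Mx.
move: hx; rewrite hM// (halfline_below (lexx 0)) poweR0r ?gt_eqF// lee_fin => hx.
have -> : normc (Lp_fun (H F) x) = 0 by apply/eqP; rewrite eq_le hx normc_ge0.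
by rewrite powR0// gt_eqF.
Qed.

Lemma opnorm_ub (A : Lp p1 -> Lp q1) F (k : R) : (opnorm A <= k%:E)%E ->
  Lp_norm F <= 1 -> Lp_norm (A F) <= k.
Proof. by move=> Ak F1; rewrite -lee_fin; apply: le_trans Ak; exact: le_opnorm. Qed.

(** A single approximating operator within k^(1/q) of H suffices: on the unit ball H inherits its
    tails through [tail_int_perturb]. *)
Lemma small_tails_limit (H : Lp p1 -> Lp q1) (Hn : nat -> Lp p1 -> Lp q1) :
  (\forall n \near \oo, small_tails (Hn n)) ->
  opnorm (fun f => Hn n f - H f) @[n --> \oo] --> 0%E -> small_tails H.
Proof.
move=> hn /ereal_cvg0P cH e e0.
pose k := e / 2 `^ q / 2.
have k0 : 0 < k by rewrite !divr_gt0// powR_gt0.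
have r0 : 0 < k `^ c by rewrite powR_gt0.
have [N _ hN] := filterI hn (cH (fun n => opnorm_ge0 _) _ r0).
have [tN oN] := hN N (leqnn N).
have [d [M [d0 M0 h]]] := tN k k0.
exists d, M; split => // F F0 F1; have [h1 h2] := h F F0 F1.
have kE : k = (k `^ c) `^ q by rewrite -powRrM mulVf ?gt_eqF// powRr1// ltW.
have pert S : measurable S -> (tail_int S (Hn N F) <= k%:E)%E ->
    (tail_int S (H F) <= e%:E)%E.
  move=> mS SG; apply: (le_trans (tail_int_perturb (H F) (Hn N F) mS)).
  have -> : e%:E = ((2 `^ q)%:E * (k%:E + k%:E))%E.
    by rewrite -EFinD -EFinM; congr EFin; rewrite /k; field; rewrite ?gt_eqF ?powR_gt0.
  rewrite lee_wpmul2l ?lee_fin ?powR_ge0//; apply: leeD => //.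
  rewrite lee_fin [leRHS]kE ge0_ler_powR ?(ltW q0) ?nnegrE ?powR_ge0 ?Lp_norm_ge0//.
  by rewrite Lp_norm_distC; exact: (opnorm_ub (ltW oN) F1).
split; apply: pert => //; first exact: measurable_below.
by apply: measurableC; exact: measurable_below.
Qed.

End StepTails.

(** * Totally bounded sets *)

Section RealNorm.
Context (R : realType) (V : normedModType R[i]).
Implicit Types v w : V.

(** The norm as a real number, so that comparisons take place in a total order. *)
Definition rnorm v : R := complex.Re `|v|.

Lemma rnormE v : `|v| = (rnorm v)%:C%C.
Proof.
rewrite /rnorm; have : 0 <= `|v| by [].
by case: `|v| => x y; rewrite lecE /= => /andP[/eqP -> _].
Qed.

Lemma rnorm_ge0 v : 0 <= rnorm v.
Proof. by have : 0 <= `|v| by []; rewrite rnormE lecR. Qed.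

Lemma rnormD v w : rnorm (v + w) <= rnorm v + rnorm w.
Proof. by rewrite -lecR rmorphD /= -!rnormE; exact: ler_normD. Qed.

Lemma rnormZ (z : R[i]) v : rnorm (z *: v) = Normc.normc z * rnorm v.
Proof. by apply: complexI; rewrite rmorphM /= -!rnormE normrZ. Qed.

Lemma rnormN v : rnorm (- v) = rnorm v.
Proof. by rewrite /rnorm normrN. Qed.

Lemma rnormB v w : rnorm (v - w) = rnorm (w - v).
Proof. by rewrite -rnormN opprB. Qed.

Lemma rnorm0 : rnorm 0 = 0.
Proof. by rewrite /rnorm normr0. Qed.

Lemma rnorm0_eq0 v : rnorm v = 0 -> v = 0.
Proof. by move=> v0; apply/eqP; rewrite -normr_eq0 rnormE v0. Qed.

Lemma rnorm_trans v w u : rnorm (v - w) <= rnorm (v - u) + rnorm (u - w).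
Proof. by have := rnormD (v - u) (u - w); rewrite addrA subrK. Qed.

Lemma rnorm_sum (m : nat) (F : nat -> V) :
  rnorm (\sum_(i < m) F i) <= \sum_(i < m) rnorm (F i).
Proof.
elim: m => [|m IHm]; first by rewrite !big_ord0 rnorm0.
by rewrite !big_ord_recr/=; apply: (le_trans (rnormD _ _)); rewrite lerD2r.
Qed.

End RealNorm.

Section GeometricLimits.
Context (R : realType).
Implicit Types (C : R) (n k j : nat).

Lemma pow2S n : 2 ^- n = 2 * 2 ^- n.+1 :> R.
Proof. by rewrite exprS invfM mulrA mulfV ?mul1r// pnatr_eq0. Qed.

Lemma pow2_gt0 n : 0 < 2 ^- n :> R.
Proof. by rewrite invr_gt0 exprn_gt0. Qed.

Lemma pow2_small (e : R) : 0 < e -> exists n, 2 ^- n < e.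
Proof.
move=> e0; exists (Num.truncn e^-1).+1; rewrite -[ltRHS](invrK e).
rewrite ltf_pV2 ?posrE ?invr_gt0 ?exprn_gt0//.
apply: (lt_trans (truncnS_gt _)); rewrite -natrX ltr_nat; exact: ltn_expl.
Qed.

(** The intervals of radius 2 C 2^-k around S k are nested; every left endpoint is below every right
    endpoint, so the supremum of the left endpoints lies in all of them. *)
Lemma geometric_cauchy (S : nat -> R) C : 0 <= C ->
  (forall k, `|S k.+1 - S k| <= C * 2 ^- k) ->
  exists l : R, forall k, `|l - S k| <= 2 * C * 2 ^- k.
Proof.
move=> C0 hS.
have mono k j : S k - 2 * C * 2 ^- k <= S (k + j)%N - 2 * C * 2 ^- (k + j).
  elim: j => [|j IHj]; first by rewrite addn0.
  apply: (le_trans IHj); rewrite addnS; have := hS (k + j)%N.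
  by rewrite ler_norml (pow2S (k + j)) => /andP[h _]; lra.
have anti k j : S (k + j)%N + 2 * C * 2 ^- (k + j) <= S k + 2 * C * 2 ^- k.
  elim: j => [|j IHj]; first by rewrite addn0.
  apply: le_trans IHj; rewrite addnS; have := hS (k + j)%N.
  by rewrite ler_norml (pow2S (k + j)) => /andP[_ h]; lra.
have pos k : 0 <= 2 * C * 2 ^- k by rewrite !mulr_ge0// ltW// pow2_gt0.
have cross k j : S k - 2 * C * 2 ^- k <= S j + 2 * C * 2 ^- j.
  have m := mono k j; have an := anti j k; rewrite addnC in an.
  by have := pos (k + j)%N; lra.
pose A := [set x : R | exists k, x = S k - 2 * C * 2 ^- k].
have A0 : A !=set0 by exists (S 0%N - 2 * C * 2 ^- 0); exists 0%N.
exists (sup A) => k; rewrite ler_distl; apply/andP; split.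
  apply: ub_le_sup; last by exists k.
  by exists (S 0%N + 2 * C * 2 ^- 0) => _ [j ->].
by apply: ge_sup => // _ [j ->].
Qed.

Lemma geometric_cauchyC (S : nat -> R[i]) C : 0 <= C ->
  (forall k, Normc.normc (S k.+1 - S k) <= C * 2 ^- k) ->
  exists l : R[i], forall k, Normc.normc (l - S k) <= 4 * C * 2 ^- k.
Proof.
move=> C0 hS.
have ReB (x y : R[i]) : complex.Re (x - y) = complex.Re x - complex.Re y.
  by case: x y => ? ? [].
have ImB (x y : R[i]) : complex.Im (x - y) = complex.Im x - complex.Im y.
  by case: x y => ? ? [].
have [u hu] : exists u : R, forall k, `|u - complex.Re (S k)| <= 2 * C * 2 ^- k.
  by apply: geometric_cauchy => // k; rewrite -ReB; apply: le_trans (hS k); exact: abs_Re_le.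
have [v hv] : exists v : R, forall k, `|v - complex.Im (S k)| <= 2 * C * 2 ^- k.
  by apply: geometric_cauchy => // k; rewrite -ImB; apply: le_trans (hS k); exact: abs_Im_le.
exists (Complex u v) => k.
have -> : Complex u v - S k = Complex (u - complex.Re (S k)) (v - complex.Im (S k)).
  by case: (S k).
by apply: (le_trans (normc_le_abs _ _)); have := hu k; have := hv k; lra.
Qed.

End GeometricLimits.

Section FiniteDimension.
Context (R : realType) (W : normedModType R[i]).
Implicit Types (e : nat -> W) (z : nat -> R[i]).

(** The vectors may be dependent, so only a suitable choice z' of coefficients can be bounded.
    Induction on m: a vector in the span of its predecessors is eliminated; otherwise it has
    distance at least some delta > 0 from that span, and its coefficient is at most the norm of the
    combination divided by delta. *)
Lemma finite_dim_coef e (m : nat) : exists2 K : R, 0 <= K & forall z, exists z',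
  \sum_(i < m) z' i *: e i = \sum_(i < m) z i *: e i /\
  forall i, (i < m)%N -> Normc.normc (z' i) <= K * rnorm (\sum_(i < m) z i *: e i).
Proof.
elim: m => [|m [K K0 IHm]].
  by exists 0 => // z; exists z; split.
have [[d ed]|nspan] := pselect (exists d : nat -> R[i], e m = \sum_(i < m) d i *: e i).
  exists K => // z.
  have [z' [z'E z'K]] := IHm (fun i => z i + z m * d i).
  have zE : \sum_(i < m.+1) z i *: e i = \sum_(i < m) (z i + z m * d i) *: e i.
    rewrite big_ord_recr/= [e m in LHS]ed scaler_sumr -big_split/=.
    by apply: eq_bigr => i _; rewrite scalerDl scalerA.
  exists (fun i => if (i < m)%N then z' i else 0); split.
    rewrite zE -z'E big_ord_recr/= ltnn scale0r addr0.
    by apply: eq_bigr => i _; rewrite ltn_ord.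
  move=> i _; rewrite zE; case: ifP => [im|_]; first exact: z'K.
  by rewrite Normc.normc0 mulr_ge0// rnorm_ge0.
have [delta d0 hd] : exists2 delta : R, 0 < delta &
    forall d : nat -> R[i], delta <= rnorm (e m - \sum_(i < m) d i *: e i).
  (* Otherwise combinations of the e i, i < m, approach e m; the induction
     hypothesis corrects their coefficients so that they converge. *)
  apply: contrapT => hno; apply: nspan.
  have app k : exists d : nat -> R[i], rnorm (e m - \sum_(i < m) d i *: e i) < 2 ^- k.
    apply: contrapT => h; apply: hno; exists (2 ^- k); first exact: pow2_gt0.
    move=> d; rewrite leNgt; apply/negP => hd; apply: h; by exists d.
  have [d hd] := choice app.
  have step k : exists r : nat -> R[i],
      \sum_(i < m) r i *: e i = \sum_(i < m) (d k.+1 i - d k i) *: e i /\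
      forall i, (i < m)%N -> Normc.normc (r i) <= (2 * K) * 2 ^- k.
    have [r [rE rK]] := IHm (fun i => d k.+1 i - d k i).
    exists r; split => // i im; apply: (le_trans (rK i im)).
    rewrite mulrAC mulrC ler_wpM2r//.
    have -> : \sum_(i < m) (d k.+1 i - d k i) *: e i =
        \sum_(i < m) d k.+1 i *: e i - \sum_(i < m) d k i *: e i.
      by rewrite -sumrB; apply: eq_bigr => j _; rewrite scalerBl.
    apply: (le_trans (rnorm_trans _ _ (e m))); rewrite rnormB.
    have h1 := hd k.+1; have h2 := hd k; have := pow2S R k; have := pow2_gt0 R k.+1.
    by lra.
  have [r hr] := choice step.
  (* Gives the same combination as the coefficients [d k], but with geometrically small increments,
     so that each coefficient converges. *)
  pose s (k i : nat) : R[i] := d 0%N i + \sum_(j < k) r j i.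
  have sE k : \sum_(i < m) s k i *: e i = \sum_(i < m) d k i *: e i.
    elim: k => [|k IHk]; first by apply: eq_bigr => i _; rewrite /s big_ord0 addr0.
    have -> : \sum_(i < m) s k.+1 i *: e i =
        \sum_(i < m) s k i *: e i + \sum_(i < m) r k i *: e i.
      rewrite -big_split/=; apply: eq_bigr => i _.
      by rewrite /s big_ord_recr/= addrA scalerDl.
    rewrite IHk (hr k).1 -big_split/=; apply: eq_bigr => i _.
    by rewrite -scalerDl addrC subrK.
  have lim i : exists l : R[i], (i < m)%N ->
      forall k, Normc.normc (l - s k i) <= 4 * (2 * K) * 2 ^- k.
    have [im|_] := ltnP i m; last by exists 0.
    have [l hl] : exists l : R[i], forall k, Normc.normc (l - s k i) <= 4 * (2 * K) * 2 ^- k.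
      apply: geometric_cauchyC => [|k]; first by rewrite mulr_ge0.
      rewrite /s big_ord_recr/= addrA.
      rewrite [X in Normc.normc (X - _)]addrC addrK; exact: (hr k).2.
    by exists l.
  have [l hl] := choice lim.
  exists l; apply/eqP; rewrite -subr_eq0; apply/eqP; apply: rnorm0_eq0.
  pose B := 1 + \sum_(i < m) (4 * (2 * K)) * rnorm (e i).
  have B0 : 0 < B.
    by rewrite ltr_wpDr// sumr_ge0// => i _; rewrite !mulr_ge0// rnorm_ge0.
  have small k : rnorm (e m - \sum_(i < m) l i *: e i) <= B * 2 ^- k.
    apply: (le_trans (rnorm_trans _ _ (\sum_(i < m) d k i *: e i))).
    rewrite mulrDl mul1r; apply: lerD; first exact: ltW (hd k).
    rewrite -sE -sumrB mulr_suml.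
    under eq_bigr do rewrite -scalerBl.
    apply: (le_trans (rnorm_sum m (fun i => (s k i - l i) *: e i))).
    apply: ler_sum => i _; rewrite rnormZ mulrAC ler_wpM2r ?rnorm_ge0//.
    by rewrite -normcN opprB; exact: hl.
  apply/eqP; rewrite eq_le rnorm_ge0 andbT leNgt; apply/negP => pos.
  have [k hk] := pow2_small (divr_gt0 pos B0).
  by have := small k; rewrite leNgt mulrC -ltr_pdivlMr// hk.
(* The last coefficient is at most delta^-1 times the norm of v. Removing its term leaves a vector
   of norm at most 1 + rnorm (e m) / delta times that of v, to which the induction hypothesis
   applies. *)
pose K1 := K * (1 + rnorm (e m) / delta) + delta^-1.
have re0 : 0 <= rnorm (e m) / delta by rewrite divr_ge0 ?rnorm_ge0// ltW.
have di0 : 0 <= delta^-1 by rewrite invr_ge0 ltW.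
exists K1; first by rewrite addr_ge0// mulr_ge0// addr_ge0.
move=> z; set v := \sum_(i < m.+1) z i *: e i.
have vE : v = \sum_(i < m) z i *: e i + z m *: e m by rewrite /v big_ord_recr.
have zm : Normc.normc (z m) <= rnorm v / delta.
  have [->|zm0] := eqVneq (z m) 0.
    by rewrite Normc.normc0 divr_ge0 ?rnorm_ge0// ltW.
  rewrite ler_pdivlMr//; have := hd (fun i => - (z i / z m)).
  have -> : v = z m *: (e m - \sum_(i < m) (- (z i / z m)) *: e i).
    rewrite vE scalerBr addrC; congr (_ + _); rewrite scaler_sumr -sumrN.
    by apply: eq_bigr => i _; rewrite scalerA mulrN scaleNr opprK mulrC divfK.
  by rewrite rnormZ => h; rewrite ler_wpM2l// normc_ge0.
have [z' [z'E z'K]] := IHm z.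
have uE : rnorm (\sum_(i < m) z i *: e i) <= rnorm v * (1 + rnorm (e m) / delta).
  have -> : \sum_(i < m) z i *: e i = v - z m *: e m by rewrite vE addrK.
  apply: (le_trans (rnormD _ _)); rewrite rnormN rnormZ mulrDr mulr1 lerD2l.
  by rewrite [leRHS]mulrCA [leLHS]mulrC ler_wpM2l ?rnorm_ge0.
exists (fun i => if (i < m)%N then z' i else z m); split.
  rewrite vE -z'E big_ord_recr/= ltnn; congr (_ + _).
  by apply: eq_bigr => i _; rewrite ltn_ord.
move=> i _; case: ifP => [im|_].
  apply: (le_trans (z'K i im)); rewrite /K1 mulrDl.
  apply: (@le_trans _ _ (K * (rnorm v * (1 + rnorm (e m) / delta)))).
    by rewrite ler_wpM2l.
  by rewrite [rnorm v * _]mulrC mulrA lerDl mulr_ge0 ?rnorm_ge0.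
apply: (le_trans zm); rewrite /K1 mulrDl mulrC lerDr.
by rewrite !mulr_ge0 ?rnorm_ge0// addr_ge0.
Qed.

End FiniteDimension.

Section TotalBoundedness.
Context (R : realType).

Lemma real_grid (K e : R) : 0 < e -> exists s : seq R, forall x, `|x| <= K ->
  exists2 y, y \in s & `|x - y| <= e.
Proof.
move=> e0; exists [seq i%:R * e - K | i <- iota 0 (Num.truncn (2 * K / e)).+1] => x.
rewrite ler_norml => /andP[Kx xK].
have xe0 : 0 <= (x + K) / e by rewrite divr_ge0 ?(ltW e0)//; lra.
have xe : (x + K) / e <= 2 * K / e by rewrite ler_wpM2r ?invr_ge0 ?(ltW e0)//; lra.
have /andP[] := truncn_itv xe0; set i := Num.truncn _ => i1 i2.
exists (i%:R * e - K).
  by apply/mapP; exists i => //; rewrite mem_iota/= add0n ltnS; exact: le_truncn.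
move: i1 i2; rewrite ler_pdivlMr// ltr_pdivrMr// -natr1 mulrDl mul1r => i1 i2.
by rewrite ler_norml; apply/andP; split; lra.
Qed.

Lemma complex_grid (K e : R) : 0 < e -> exists s : seq R[i], forall z,
  Normc.normc z <= K -> exists2 z', z' \in s & Normc.normc (z - z') <= e.
Proof.
move=> e0; have e20 : 0 < e / 2 by rewrite divr_gt0.
have [s hs] := real_grid K e20.
exists [seq Complex u v | u <- s, v <- s] => z zK.
have [u us hu] := hs _ (le_trans (abs_Re_le z) zK).
have [v vs hv] := hs _ (le_trans (abs_Im_le z) zK).
exists (Complex u v); first by apply: allpairs_f.
have -> : z - Complex u v = Complex (complex.Re z - u) (complex.Im z - v) by case: z {zK hu hv}.
by apply: (le_trans (normc_le_abs _ _)); lra.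
Qed.

Context (W : normedModType R[i]).

Definition tbounded (A : set W) := forall e : R, 0 < e -> exists s : seq W,
  forall v, A v -> exists2 w, w \in s & rnorm (v - w) <= e.

Lemma tbounded_subset (A B : set W) : A `<=` B -> tbounded B -> tbounded A.
Proof. by move=> AB hB e e0; have [s hs] := hB e e0; exists s => v /AB /hs. Qed.

Lemma tbounded_span (e : nat -> W) (m : nat) (K : R) :
  tbounded [set v | exists2 z : nat -> R[i], v = \sum_(i < m) z i *: e i &
    forall i, (i < m)%N -> Normc.normc (z i) <= K].
Proof.
elim: m => [|m IHm] d d0.
  exists [:: 0] => v [z -> _]; exists 0; first by rewrite inE.
  by rewrite big_ord0 subr0 rnorm0 ltW.
have d20 : 0 < d / 2 by rewrite divr_gt0.
have [s hs] := IHm _ d20.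
have N0 : 0 < rnorm (e m) + 1 by rewrite ltr_wpDl ?rnorm_ge0.
(* The mesh is divided by the norm of [e m], increased by 1 in case this vector is 0. *)
have [t ht] := complex_grid K (divr_gt0 d20 N0).
exists [seq u + z *: e m | u <- s, z <- t] => v [z -> zK].
have [u us hu] := hs (\sum_(i < m) z i *: e i) (ex_intro2 _ _ z erefl
  (fun i im => zK i (ltnW im))).
have [z' zt hz] := ht (z m) (zK m (ltnSn m)).
exists (u + z' *: e m); first exact: (allpairs_f (fun u z => u + z *: e m)).
rewrite big_ord_recr/= opprD addrACA -scalerBl.
apply: (le_trans (rnormD _ _)); rewrite rnormZ (splitr d); apply: lerD => //.
apply: (@le_trans _ _ (d / 2 / (rnorm (e m) + 1) * rnorm (e m))).
  by rewrite ler_wpM2r ?rnorm_ge0.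
by rewrite mulrAC ler_pdivrMr// ler_wpM2l ?(ltW d20)// lerDl.
Qed.

(** By [finite_dim_coef] a bounded image has bounded coefficients for a suitable choice, which
    places it inside the set of [tbounded_span]. *)
Lemma tbounded_finite_rank (V : normedModType R[i]) (A : V -> W) (B : set V) (k : R) :
  finite_rank A -> (forall v, B v -> rnorm (A v) <= k) -> tbounded (A @` B).
Proof.
move=> [m [e eA]] hk.
pose e' (i : nat) := odflt 0 (omap e (insub i)).
have e'E (i : 'I_m) : e' i = e i by rewrite /e' valK.
have [K K0 hK] := finite_dim_coef e' m.
apply: (tbounded_subset _ (@tbounded_span e' m (K * k))) => _ [v Bv <-].
have [c vc] := eA v.
pose z (i : nat) : R[i] := odflt 0 (omap c (insub i)).
have zE : A v = \sum_(i < m) z i *: e' i.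
  by rewrite vc; apply: eq_bigr => i _; rewrite e'E /z valK.
have [z' [z'E z'K]] := hK z.
exists z'; first by rewrite z'E.
move=> i im; apply: (le_trans (z'K i im)); rewrite ler_wpM2l// -zE; exact: hk.
Qed.

Lemma tbounded_limit (V : Type) (H : V -> W) (B : set V) :
  (forall e : R, 0 < e -> exists2 F : V -> W, tbounded (F @` B) &
     forall v, B v -> rnorm (F v - H v) <= e) -> tbounded (H @` B).
Proof.
move=> h e e0; have e20 : 0 < e / 2 by rewrite divr_gt0.
have [F tF FH] := h _ e20; have [s hs] := tF _ e20.
exists s => _ [v Bv <-]; have [w ws hw] := hs (F v) (imageP _ Bv).
exists w => //; apply: (le_trans (rnorm_trans _ _ (F v))).
by rewrite (splitr e) rnormB lerD// FH.
Qed.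

(* Enough for completeness, since a Cauchy sequence has such subsequences. *)
Definition geometrically_complete := forall G : nat -> W,
  (forall k, rnorm (G k.+1 - G k) <= 2 ^- k * 2 ^- k) ->
  exists l, forall e : R, 0 < e -> exists N, forall k, (N <= k)%N -> rnorm (l - G k) <= e.

Lemma ultra_seq (U : set_system W) (s : seq W) (P : W -> W -> Prop) : UltraFilter U ->
  U [set v | exists2 w, w \in s & P w v] -> exists w, U [set v | P w v].
Proof.
move=> UU; elim: s => [|w s IHs] h.
  by have [v [w]] := filter_ex h; rewrite in_nil.
have [Pw|nPw] := in_ultra_setVsetC [set v | P w v] UU; first by exists w.
apply: IHs; apply: filterS2 h nPw => v [u]; rewrite inE => /orP[/eqP ->|us] Pu nP.
  by case: nP.
by exists u.
Qed.

(** An ultrafilter on the closure contains balls of every radius. Two such balls meet, so their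
    centres are close; a sequence of centres converges by completeness, and the ultrafilter
    converges to the same limit. *)
Lemma tbounded_precompact (A : set W) : geometrically_complete -> tbounded A ->
  precompact A.
Proof.
move=> cW tA; rewrite precompactE compact_ultra => U UU UA.
have tC (e : R) : 0 < e -> exists w, U [set v | rnorm (v - w) <= e].
  move=> e0; have e20 : 0 < e / 2 by rewrite divr_gt0.
  have [s hs] := tA _ e20.
  apply: (@ultra_seq U s (fun w v => rnorm (v - w) <= e)).
  apply: filterS UA => v vA.
  have e2C : 0 < (e / 2)%:C%C by rewrite ltcR.
  have [u [Au uv]] := vA _ (nbhsx_ballx v _ e2C).
  have [w ws hw] := hs u Au; exists w => //.
  apply: (le_trans (rnorm_trans _ _ u)); rewrite (splitr e) lerD//.
  by move: uv; rewrite -ball_normE /= rnormE ltcR => /ltW.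
(* The radii are 4^-k / 4: two consecutive ones add up to at most 4^-k, the step allowed by
   [geometrically_complete]. *)
have rpos k : 0 < 2 ^- k * 2 ^- k / 4 :> R.
  by rewrite divr_gt0// mulr_gt0 ?pow2_gt0.
have [w hw] := choice (fun k => tC _ (rpos k)).
have wC k : rnorm (w k.+1 - w k) <= 2 ^- k * 2 ^- k.
  have [v [v1 v2]] := filter_ex (filterI (hw k.+1) (hw k)).
  apply: (le_trans (rnorm_trans _ _ v)); rewrite rnormB.
  apply: (le_trans (lerD v1 v2)).
  have := pow2S R k; have := pow2_gt0 R k.+1; move: (2 ^- k) (2 ^- k.+1) => x y y0 ->.
  have : 0 <= y * y by rewrite mulr_ge0// ltW.
  by nra.
have [l hl] := cW w wC.
have Ul : U --> l.
  move=> N /nbhs_ballP[eps /= eps0 hN].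
  have epsE : eps = (complex.Re eps)%:C%C.
    by move: eps0; case: eps {hN} => x y; rewrite ltcE /= => /andP[/eqP -> _].
  have r0 : 0 < complex.Re eps by rewrite -ltcR -epsE.
  set r := complex.Re eps in epsE r0.
  have r40 : 0 < r / 4 by rewrite divr_gt0.
  have [N1 h1] := hl _ r40.
  have [k2 h2] := pow2_small r40.
  pose k := maxn N1 k2.
  apply: filterS (hw k) => v /= hv; apply: hN.
  rewrite -ball_normE /= rnormE epsE ltcR.
  apply: (le_lt_trans (rnorm_trans _ _ (w k))); rewrite [X in _ + X]rnormB.
  have hk1 := h1 k (leq_maxl _ _).
  have hk2 : 2 ^- k <= 2 ^- k2 :> R.
    by rewrite lef_pV2 ?posrE ?exprn_gt0// ler_weXn2l ?ler1n// leq_maxr.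
  have k1 : 2 ^- k <= 1 :> R by rewrite invf_le1 ?exprn_gt0// exprn_ege1// ler1n.
  have k0 : 0 < 2 ^- k :> R by exact: pow2_gt0.
  have hv' : rnorm (v - w k) <= r / 4.
    by apply: (le_trans hv); nra.
  by lra.
exists l; split => //.
have /closure_id -> := @closed_closure W A.
by move=> N Nl; have [v [v1 v2]] := filter_ex (filterI UA (Ul _ Nl)); exists v.
Qed.

End TotalBoundedness.

(** * Completeness *)

Section RieszFischer.
Context (R : realType) (q : R) (q1 : 1 <= q).
Local Notation lam := (halfline_measure R).

Let q0 : 0 < q. Proof. exact: (lt_le_trans ltr01). Qed.

(** The upper limit is measurable whether or not the sequence converges, and equals the limit where
    it does; it serves to define the limit function everywhere. *)
Lemma limn_esup_geometric (u : nat -> R) (l C : R) :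
  (forall k, `|l - u k| <= C * 2 ^- k) -> fine (limn_esup (fun k => (u k)%:E)) = l.
Proof.
move=> h; suff ul : (u k)%:E @[k --> \oo] --> l%:E by rewrite (cvg_limn_einf_sup ul).2.
apply: cvg_EFin; first exact: nearW.
apply/cvgrPdist_le => e e0 /=.
have C1 : 0 < `|C| + 1 by rewrite ltr_wpDl.
apply: filterS (near_pow2_le (divr_gt0 e0 C1)) => k hk; apply: (le_trans (h k)).
move: hk; rewrite ler_pdivlMr// mulrC; apply: le_trans.
by rewrite ler_wpM2r ?(ltW (pow2_gt0 R k))// (le_trans (ler_norm C))// lerDl.
Qed.

Lemma geometric_sum_le n : \sum_(0 <= k < n) 2 ^- k <= 2 :> R.
Proof.
suff : \sum_(0 <= k < n) 2 ^- k <= 2 - 2 * 2 ^- n :> R.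
  by move=> /le_trans; apply; rewrite gerBl mulr_ge0// ltW// pow2_gt0.
elim: n => [|n IHn]; first by rewrite big_nil expr0 invr1 mulr1 subrr.
by rewrite big_nat_recr//=; have := pow2S R n; lra.
Qed.

Section Sequence.
Variable G : nat -> Lp q1.
Hypothesis hG : forall k, Lp_norm (G k.+1 - G k) <= 2 ^- k * 2 ^- k.

Let D k (x : lebR R) : R := normc (Lp_fun (G k.+1 - G k) x).

(* The weights 2^k turn the finiteness of [S x] into a geometric bound on [D k x]. *)
Let T k (x : lebR R) : \bar R := ((2 ^+ k * D k x) `^ q)%:E.

Let S (x : lebR R) : \bar R := (\sum_(0 <= k <oo) T k x)%E.

Let T0 k x : (0 <= T k x)%E. Proof. by rewrite lee_fin powR_ge0. Qed.

Let mD k : measurable_fun setT (D k).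
Proof. exact: (measurable_normc (Lp_fun_measurable _)). Qed.

Let mT k : measurable_fun setT (T k).
Proof.
apply/measurable_EFinP; apply: measurableT_comp (measurable_powR _) _.
by apply: measurable_funM; [exact: measurable_cst|exact: mD].
Qed.

Let S0 x : (0 <= S x)%E. Proof. by apply: nneseries_ge0 => k _ _; exact: T0. Qed.

(** The weighted difference has norm at most 2^k 4^-k = 2^-k, and (2^-k)^q <= 2^-k as q >= 1. Hence
    the squared rate in [geometrically_complete]. *)
Let intT k : (\int[lam]_x T k x <= (2 ^- k)%:E)%E.
Proof.
have -> : (\int[lam]_x T k x = ((2 ^+ k) `^ q)%:E * (Lp_norm (G k.+1 - G k) `^ q)%:E)%E.
  rewrite -tail_intT /tail_int -(ge0_integralZl lam measurableT).
  - by apply: eq_integral => x _; rewrite -EFinM -powRM ?exprn_ge0 ?normc_ge0.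
  - exact: measurable_pow_normc.
  - by move=> x _; exact: pow_normc_ge0.
  - by rewrite lee_fin powR_ge0.
rewrite -EFinM lee_fin -powRM ?exprn_ge0 ?Lp_norm_ge0//.
have h : 2 ^+ k * Lp_norm (G k.+1 - G k) <= 2 ^- k.
  by rewrite mulrC -ler_pdivlMr ?exprn_gt0//; exact: hG.
apply: (@le_trans _ _ ((2 ^- k) `^ q)).
  apply: ge0_ler_powR h; rewrite ?nnegrE ?(ltW q0) ?mulr_ge0 ?exprn_ge0 ?Lp_norm_ge0//.
rewrite -[leRHS](powRr1 (ltW (pow2_gt0 R k))); apply: ger_powR => //.
by rewrite pow2_gt0/= invf_le1 ?exprn_gt0// exprn_ege1// ler1n.
Qed.

Let mS : measurable_fun setT S.
Proof.
apply: (@ge0_emeasurable_sum _ _ _ setT T xpredT) => [k x _ _|k _].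
  exact: T0.
exact: mT.
Qed.

Let intS : (\int[lam]_x S x <= 2%:E)%E.
Proof.
rewrite (integral_nneseries lam measurableT mT (fun k x _ => T0 k x)).
apply: lime_le.
  by apply: is_cvg_nneseries => k _ _; apply: integral_ge0 => x _; exact: T0.
apply: nearW => n; apply: (@le_trans _ _ (\sum_(0 <= k < n) (2 ^- k)%:E)%E).
  by apply: lee_sum => k _; exact: intT.
by rewrite sumEFin lee_fin geometric_sum_le.
Qed.

Let Sfin : \forall x \ae lam, S x \is a fin_num.
Proof.
have iS : lam.-integrable setT S.
  apply/integrableP; split; first exact: mS.
  apply: (@le_lt_trans _ _ 2%:E); last exact: ltry.
  apply: le_trans intS; rewrite le_eqVlt; apply/orP; left; apply/eqP.
  by apply: eq_integral => x _; rewrite gee0_abs.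
by apply: filterS (integrable_ae measurableT iS) => x; apply.
Qed.

Let C (x : lebR R) : R := fine (S x) `^ q^-1.

(** One term of the series is at most its sum, so 2^k D k x is at most S(x)^(1/q). *)
Let DC : \forall x \ae lam, forall k, D k x <= C x * 2 ^- k.
Proof.
apply: filterS Sfin => x Sx k.
have TS : (T k x <= S x)%E.
  apply: le_trans (@nneseries_lim_ge _ (T ^~ x) xpredT 0%N k.+1 _); last first.
    by move=> j _ _; exact: T0.
  by rewrite big_nat_recr//= leeDr// sume_ge0.
have Sx0 : 0 <= fine (S x) by apply: fine_ge0; exact: S0.
rewrite -(fineK Sx) lee_fin in TS.
have D0 : 0 <= 2 ^+ k * D k x by rewrite mulr_ge0 ?exprn_ge0 ?normc_ge0.
rewrite -ler_pdivrMr ?pow2_gt0// invrK mulrC /C.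
have -> : 2 ^+ k * D k x = ((2 ^+ k * D k x) `^ q) `^ q^-1.
  by rewrite -powRrM mulfV ?gt_eqF// powRr1.
by apply: ge0_ler_powR TS; rewrite ?nnegrE ?invr_ge0 ?(ltW q0) ?powR_ge0.
Qed.

Let f (x : lebR R) : R[i]^o :=
  Complex (fine (limn_esup (fun k => (complex.Re (Lp_fun (G k) x))%:E)))
          (fine (limn_esup (fun k => (complex.Im (Lp_fun (G k) x))%:E))).

Let mf : measurable_cfun f.
Proof.
split; (apply: measurableT_comp; first exact: fine_measurable);
  apply: measurable_fun_limn_esup => k; apply/measurable_EFinP;
  by have [] := Lp_fun_measurable (G k).
Qed.

Let fG : \forall x \ae lam, forall k, normc (f x - Lp_fun (G k) x) <= 4 * C x * 2 ^- k.
Proof.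
have hB : \forall x \ae lam, forall k,
    Lp_fun (G k.+1 - G k) x = Lp_fun (G k.+1) x - Lp_fun (G k) x.
  by apply/ae_foralln => k; exact: Lp_funB.
apply: filterS2 DC hB => x hD hx k.
have C0 : 0 <= C x by rewrite powR_ge0.
have [l hl] : exists l : R[i], forall k, normc (l - Lp_fun (G k) x) <= 4 * C x * 2 ^- k.
  by apply: geometric_cauchyC => // j; rewrite -hx; exact: hD.
suff -> : f x = l by exact: hl.
have ReB (z w : R[i]) : complex.Re (z - w) = complex.Re z - complex.Re w.
  by case: z w => ? ? [].
have ImB (z w : R[i]) : complex.Im (z - w) = complex.Im z - complex.Im w.
  by case: z w => ? ? [].
rewrite /f (@limn_esup_geometric _ (complex.Re l) (4 * C x)); last first.
  by move=> j; rewrite -ReB; exact: le_trans (abs_Re_le _) (hl j).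
rewrite (@limn_esup_geometric _ (complex.Im l) (4 * C x)); last first.
  by move=> j; rewrite -ImB; exact: le_trans (abs_Im_le _) (hl j).
by case: (l).
Qed.

Let g k := f + (-1) *: Lp_fun (G k).

Let mg k : measurable_cfun (g k).
Proof.
by apply: (measurable_cfunD mf); apply: measurable_cfunZ; exact: Lp_fun_measurable.
Qed.

Let gE k x : g k x = f x - Lp_fun (G k) x.
Proof. by rewrite /g !fctE scaleN1r. Qed.

(** The pointwise error is at most 4 C(x) 2^-k with C^q = S almost everywhere, and S has integral at
    most 2 <= 2^q; hence the constant 8. *)
Let g_norm k : (cLnorm lam q (g k) <= (8 * 2 ^- k)%:E)%E.
Proof.
have k0 : 0 <= 4 * 2 ^- k :> R by rewrite mulr_ge0// ltW// pow2_gt0.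
apply: cLnorm_le_int => //.
apply: (@le_trans _ _ (\int[lam]_x (((4 * 2 ^- k) `^ q)%:E * S x))%E).
  apply: (ae_ge0_le_integral measurableT).
  - by move=> x _; rewrite lee_fin powR_ge0.
  - apply/measurable_EFinP.
    exact: measurableT_comp (measurable_powR _) (measurable_normc (mg k)).
  - by move=> x _; rewrite mule_ge0// lee_fin powR_ge0.
  - by apply: emeasurable_funM; [exact: measurable_cst|exact: mS].
  apply: filterS2 Sfin fG => x Sx hx _.
  have Sx0 : 0 <= fine (S x) by apply: fine_ge0; exact: S0.
  rewrite -(fineK Sx) -EFinM lee_fin gE.
  have -> : fine (S x) = C x `^ q.
    by rewrite /C -powRrM mulVf ?gt_eqF// powRr1.
  rewrite -powRM ?powR_ge0//; apply: ge0_ler_powR.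
  - exact: ltW.
  - by rewrite nnegrE normc_ge0.
  - by rewrite nnegrE mulr_ge0 ?powR_ge0.
  - by rewrite mulrAC; exact: hx.
rewrite (ge0_integralZl lam measurableT mS (fun x _ => S0 x)) ?lee_fin ?powR_ge0//.
apply: (@le_trans _ _ (((4 * 2 ^- k) `^ q)%:E * 2%:E)%E).
  by apply: lee_pmul => //; rewrite ?lee_fin ?powR_ge0// integral_ge0.
rewrite -EFinM lee_fin.
have -> : 8 * 2 ^- k = (4 * 2 ^- k) * 2 :> R by ring.
by rewrite (powRM _ k0)// ler_wpM2l ?powR_ge0// le1r_powR// ler1n.
Qed.

Let fP : f \in cLfun lam q.
Proof.
rewrite inE; split; first exact: mf.
have -> : f = g 0%N + Lp_fun (G 0%N).
  by rewrite /g scaleN1r subrK.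
apply: (le_lt_trans (cLnormD lam q1 (mg 0) (Lp_fun_measurable (G 0%N)))).
apply: lte_add_pinfty; first exact: le_lt_trans (g_norm 0) (ltry _).
by have [] := set_mem (Lp_fun_cLfun (G 0%N)).
Qed.

Lemma geometric_Lp_limit : exists l : Lp q1, forall k, Lp_norm (l - G k) <= 8 * 2 ^- k.
Proof.
exists (Lp_class q1 fP) => k; apply: (Lp_norm_leW (mg k) _ (g_norm k)).
apply: filterS2 (Lp_funB (Lp_class q1 fP) (G k)) (Lp_classE q1 fP) => x -> ->.
by rewrite gE.
Qed.

End Sequence.

Lemma Lp_geometrically_complete : geometrically_complete (Lp q1).
Proof.
move=> G hG; have [l hl] := geometric_Lp_limit hG.
exists l => e e0; have e8 : 0 < e / 8 by rewrite divr_gt0.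
have [N hN] := pow2_small e8; exists N => k Nk.
apply: (le_trans (hl k)); rewrite mulrC -ler_pdivlMr//; apply: le_trans (ltW hN).
by rewrite lef_pV2 ?posrE ?exprn_gt0// ler_weXn2l ?ler1n.
Qed.

End RieszFischer.

(** * Compactness of Hardy operators *)

(** Each F n maps the unit ball to a totally bounded set, a property that survives uniform limits on
    the ball; completeness of the target turns it into compactness. *)
Lemma finite_rank_limit_compact (R : realType) (p q : R) (p1 : 1 <= p) (q1 : 1 <= q)
    (H : {linear Lp p1 -> Lp q1}) (F : nat -> {linear Lp p1 -> Lp q1}) :
  (forall n, bounded_operator (F n) /\ finite_rank (F n)) ->
  opnorm (fun f => F n f - H f) @[n --> \oo] --> 0%E -> compact_operator H.
Proof.
move=> hF /ereal_cvg0P cF; apply: tbounded_precompact.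
  exact: Lp_geometrically_complete.
apply: tbounded_limit => e e0.
have [N _ hN] := cF (fun n => opnorm_ge0 _) e e0.
have unit_ball (v : Lp p1) : `|v| <= 1 -> Lp_norm v <= 1.
  by move=> v1; rewrite -Lp_norm_le.
have [bF rF] := hF N; exists (F N).
  apply: (@tbounded_finite_rank _ _ _ _ _ (fine (opnorm (F N))) rF) => v /unit_ball v1.
  apply: opnorm_ub v1; rewrite fineK// ge0_fin_numE//; exact: opnorm_ge0.
by move=> v /unit_ball v1; apply: (opnorm_ub (ltW (hN N (leqnn N))) v1).
Qed.

Theorem theorem3p23 (R : realType) (p p' q : R) (hp : 1 < p) (hpq : p <= q)
    (hp' : p^-1 + p'^-1 = 1) (b : R -> \bar R) (hb : normal_form b) :
  let Lp_p := Lp (ltW hp) in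
  let Lp_q := Lp (le_trans (ltW hp) hpq) in
  [<->
    (* (i) *)
    exists2 H : {linear Lp_p -> Lp_q},
      hardy_operator b H & compact_operator H;
    (* (ii) *)
    exists2 H : {linear Lp_p -> Lp_q}, hardy_operator b H &
      exists2 F : nat -> {linear Lp_p -> Lp_q},
        (forall n, bounded_operator (F n) /\ finite_rank (F n)) &
        opnorm (fun f => F n f - H f) @[n --> \oo] --> 0%E;
    (* (iii) *)
    exists2 H : {linear Lp_p -> Lp_q}, hardy_operator b H &
      exists2 Hn : nat -> {linear Lp_p -> Lp_q},
        (\forall n \near \oo, hardy_operator (step_parameter b n) (Hn n)) &
        opnorm (fun f => Hn n f - H f) @[n --> \oo] --> 0%E;
    (* (iv) *)
    (b x `^ p'^-1 * (x `^ q^-1)%:E)%E @[x --> +oo] --> 0%E /\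
    (b x `^ p'^-1 * (x `^ q^-1)%:E)%E @[x --> 0^'+] --> 0%E].
Proof.
move=> Lp_p Lp_q.
have compact_vanishing (H : {linear Lp_p -> Lp_q}) :
    hardy_operator b H -> compact_operator H -> vanishing p' q b.
  by move=> hH cH; apply: (small_tails_vanishing hp hp' hb hH); exact: compact_small_tails.
have ops := vanishing_operators hp hpq hp' (ltW hp) (le_trans (ltW hp) hpq) hb.
have finite_rank_compact (H : {linear Lp_p -> Lp_q}) (F : nat -> {linear Lp_p -> Lp_q}) :
    (forall n, bounded_operator (F n) /\ finite_rank (F n)) ->
    opnorm (fun f => F n f - H f) @[n --> \oo] --> 0%E -> compact_operator H.
  exact: finite_rank_limit_compact.
tfae.
(* Compactness gives (iv), from which an operator is built together with its finite-rank
   approximations; it replaces the given H. *)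
- move=> [H hH cH]; have [H' hH' [Hn hn cn]] := ops (compact_vanishing H hH cH).
  exists H' => //; exists Hn => // n; have [[bn _] rn] := hn n; split => //.
- move=> [H hH [F hF cF]].
  have [H' hH' [Hn hn cn]] := ops (compact_vanishing H hH (finite_rank_compact H F hF cF)).
  by exists H' => //; exists Hn => //; apply: nearW => n; have [] := hn n.
(* Small tails of the H_{b_n} are deduced from their boundedness, and H inherits them in the
   limit. *)
- move=> [H hH [Hn hn cn]]; apply/vanishingP.
  apply: (small_tails_vanishing hp hp' hb hH); apply: small_tails_limit cn.
  by apply: filterS hn => n; exact: (step_small_tails hp hp').
- move=> /vanishingP vb; have [H hH [Hn hn cn]] := ops vb.
  exists H => //; apply: (finite_rank_compact H Hn) => // n.
  by have [[]] := hn n.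
Qed.
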